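(* There exist an integer $n\ge 1$ and two odd measurable functions $F,G:\mathbb{R}^n\to\mathbb{R}$ such that $$\frac{\Phi_{F,G}(i)}{i}>\frac{2}{\pi}\ln(1+\sqrt{2}),$$ where $i$ is the imaginary unit and $\Phi_{F,G}(i)$ is the value at $t=i$ of the analytic extension to $\{t\in\mathbb{C}:|\mathrm{Re}(t)|<1\}$ of the function $t\mapsto\mathbb{E}[\mathrm{sign}(F(\vec X))\,\mathrm{sign}(G(\vec Y))]$, with $(\vec X,\vec Y)$ consisting of $n$ independent pairs of standard Gaussians of correlation $t$. Explicitly, $$\frac{\Phi_{F,G}(i)}{i}=(2\pi\sqrt{2})^{-n}\int_{\mathbb{R}^{2n}}\mathrm{sign}(F(\vec{x}))\,\mathrm{sign}(G(\vec{y}))\,e^{-\frac{\|\vec{x}\|^2+\|\vec{y}\|^2}{4}}\sin\!\left(\frac{\langle\vec{x},\vec{y}\rangle}{2}\right)d\vec{x}\,d\vec{y}.$$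
   Context: A function $F:\mathbb{R}^n\to\mathbb{R}$ is odd if $F(-\vec{x})=-F(\vec{x})$ for all $\vec{x}\in\mathbb{R}^n$. The function $\mathrm{sign}:\mathbb{R}\to\{-1,0,1\}$ is the usual sign function, with $\mathrm{sign}(0)=0$. The notation $\langle\cdot,\cdot\rangle$ and $\|\cdot\|$ denotes the Euclidean inner product and norm on $\mathbb{R}^n$. For real $t\in(-1,1)$, let $(X_j,Y_j)$, $0\le j\le n-1$, be independent pairs of jointly Gaussian random variables, where each of $X_j,Y_j$ is centered with variance $1$ and $\mathbb{E}(X_jY_j)=t$. Put $\vec X=(X_0,\dots,X_{n-1})$ and $\vec Y=(Y_0,\dots,Y_{n-1})$. For odd measurable functions $F,G:\mathbb{R}^n\to\mathbb{R}$ set $$\Phi_{F,G}(t)=\mathbb{E}\left[\mathrm{sign}(F(\vec X))\,\mathrm{sign}(G(\vec Y))\right]=(2\pi\sqrt{1-t^2})^{-n}\int_{\mathbb{R}^{2n}}\mathrm{sign}(F(\vec{x}))\,\mathrm{sign}(G(\vec{y}))\,e^{-\frac{\|\vec{x}\|^2+\|\vec{y}\|^2-2t\langle\vec{x},\vec{y}\rangle}{2(1-t^2)}}\,d\vec{x}\,d\vec{y}.$$ The integral formula (with the principal branch of the square root) defines an analytic function of $t$ on $\{t\in\mathbb{C}:|\mathrm{Re}(t)|<1\}$, still denoted $\Phi_{F,G}$. It is an odd function of $t$, and $\Phi_{F,G}(i)/i$ is real. *)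

(* Defs.v *)
From HB Require Import structures.
From mathcomp Require Import all_boot all_order all_algebra.
From mathcomp Require Import all_classical all_reals all_analysis.
From mathcomp Require Import complex.

Set Implicit Arguments.
Unset Strict Implicit.
Unset Printing Implicit Defensive.

Import Order.TTheory GRing.Theory Num.Theory.
Import numFieldNormedType.Exports.

Local Open Scope classical_set_scope.
Local Open Scope ring_scope.
Local Open Scope complex_scope.

(* R^n is the type n.-tuple R with its product (= Borel) sigma-algebra. *)
Section lebesgue_tuple.
Context {R : realType}.

Definition tuple_cons n (z : R * n.-tuple R) : n.+1.-tuple R :=
  [tuple of z.1 :: z.2].

Lemma measurable_tuple_cons n : measurable_fun [set: R * n.-tuple R] (@tuple_cons n).
Proof. exact: measurable_cons. Qed.

Definition lebesgue_cons n
    (m : {sigma_finite_measure set (n.-tuple R) -> \bar R}) :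
    set (n.+1.-tuple R) -> \bar R :=
  pushforward (lebesgue_measure \x m)%E (@tuple_cons n).

Section lebesgue_cons_instances.
Variables (n : nat) (m : {sigma_finite_measure set (n.-tuple R) -> \bar R}).

Let lebesgue_cons0 : lebesgue_cons m set0 = 0%E.
Proof. by rewrite /lebesgue_cons /pushforward preimage_set0 measure0. Qed.

Let lebesgue_cons_ge0 A : (0 <= lebesgue_cons m A)%E.
Proof. exact: (measure_ge0 (lebesgue_measure \x m)%E). Qed.

Let lebesgue_cons_sigma_additive : semi_sigma_additive (lebesgue_cons m).
Proof.
move=> F mF tF mUF; rewrite /lebesgue_cons /pushforward preimage_bigcup.
apply: measure_semi_sigma_additive.
- by move=> k; rewrite -[_ @^-1` _]setTI; exact: measurable_tuple_cons.
- apply/trivIsetP => i j _ _ ij; rewrite -preimage_setI.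
  by move/trivIsetP : tF => /(_ i j Logic.I Logic.I ij) ->; rewrite preimage_set0.
- by rewrite -preimage_bigcup -[_ @^-1` _]setTI; exact: measurable_tuple_cons.
Qed.

HB.instance Definition _ := isMeasure.Build _ _ _ (lebesgue_cons m)
  lebesgue_cons0 lebesgue_cons_ge0 lebesgue_cons_sigma_additive.

Let lebesgue_cons_sigma_finite : sigma_finite setT (lebesgue_cons m).
Proof.
have /sigma_finiteP[F [TF ndF Foo]] := sigma_finiteT (@lebesgue_measure R).
have /sigma_finiteP[G [TG ndG Goo]] := sigma_finiteT m.
pose g (t : n.+1.-tuple R) : R * n.-tuple R := (thead t, [tuple of behead t]).
have mg : measurable_fun setT g.
  by apply: measurable_fun_pair; [exact: measurable_tnth|exact: measurable_behead].
have gK : g \o @tuple_cons n = id.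
  by apply/funext => -[a b]; rewrite /g/=; congr pair; apply/val_inj.
exists (fun k => g @^-1` (F k `*` G k)).
  apply/seteqP; split => // t _.
  have [i _ Fi] : (\bigcup_k F k) (g t).1 by rewrite -TF.
  have [j _ Gj] : (\bigcup_k G k) (g t).2 by rewrite -TG.
  exists (maxn i j) => //; split.
  - by move: Fi; exact/subsetPset/ndF/leq_maxl.
  - by move: Gj; exact/subsetPset/ndG/leq_maxr.
move=> k; have [mFk Fk] := Foo k; have [mGk Gk] := Goo k; split.
  by rewrite -[_ @^-1` _]setTI; apply: mg => //; exact: measurableX.
rewrite /lebesgue_cons /pushforward.
rewrite -comp_preimage gK preimage_id.
by rewrite product_measure1E// lte_mul_pinfty// ge0_fin_numE.
Qed.

HB.instance Definition _ := Measure_isSigmaFinite.Build _ _ _ (lebesgue_cons m)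
  lebesgue_cons_sigma_finite.

End lebesgue_cons_instances.

(* n-dimensional Lebesgue measure, as an iterated product measure. *)
Fixpoint lebesgue_tuple n : {sigma_finite_measure set (n.-tuple R) -> \bar R} :=
  match n with
  | 0 => \d_([tuple] : 0.-tuple R)
  | k.+1 => lebesgue_cons (lebesgue_tuple k)
  end.

End lebesgue_tuple.

Section euclidean.
Context {R : realType} {n : nat}.
Implicit Types x y : n.-tuple R.

Definition dotp x y : R := \sum_(j < n) tnth x j * tnth y j.

Definition enorm x : R := Num.sqrt (dotp x x).

Definition odd_function (F : n.-tuple R -> R) :=
  forall x, F (map_tuple -%R x) = - F x.

End euclidean.

Section random_vectors.
Context {R : realType} d {T : measurableType d} (P : probability T R).

(* density of the centered bivariate normal law with unit variances and
   covariance t, for -1 < t < 1 *)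
Definition gauss2_pdf (t : R) (z : R * R) : R :=
  (2 * pi * Num.sqrt (1 - t ^+ 2))^-1 *
  expR (- ((z.1 ^+ 2 + z.2 ^+ 2 - 2 * t * (z.1 * z.2)) / (2 * (1 - t ^+ 2)))).

Definition gaussian_pair (t : R) (U V : {RV P >-> R}) :=
  forall A : set (R * R), measurable A ->
    P [set w | A (U w, V w)] =
    (\int[lebesgue_measure \x lebesgue_measure]_(z in A) (gauss2_pdf t z)%:E)%E.

(* Since the events A j may be the full plane, the product rule over the whole
   index set contains the product rule over every subfamily. *)
Definition independent_pairs n (X Y : 'I_n -> {RV P >-> R}) :=
  forall A : 'I_n -> set (R * R), (forall j, measurable (A j)) ->
    P [set w | forall j, A j (X j w, Y j w)] =
    (\prod_(j < n) P [set w | A j (X j w, Y j w)])%E.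

Definition correlated_gaussians n (t : R) (X Y : 'I_n -> {RV P >-> R}) :=
  (forall j, gaussian_pair t (X j) (Y j)) /\ independent_pairs X Y.

Definition random_vector n (X : 'I_n -> {RV P >-> R}) (w : T) : n.-tuple R :=
  [tuple X j w | j < n].

End random_vectors.

Section Phi.
Context {R : realType}.
Implicit Types t z : R[i].

Definition cexp z : R[i] :=
  (expR (complex.Re z))%:C * (cos (complex.Im z) +i* sin (complex.Im z)).

Definition Cintegral d (T : measurableType d) (mu : {measure set T -> \bar R})
    (f : T -> R[i]) : R[i] :=
  (\int[mu]_x complex.Re (f x)) +i* (\int[mu]_x complex.Im (f x)).

(* sqrtc is the principal branch: its values have nonnegative real part
   (unlike sqrtC, whose values have nonnegative imaginary part). *)
Definition Phi n (F G : n.-tuple R -> R) t : R[i] :=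
  (2 * pi%:C * sqrtc (1 - t ^+ 2)) ^- n *
  Cintegral (lebesgue_tuple n \x lebesgue_tuple n)%E
    (fun z : n.-tuple R * n.-tuple R =>
      (Num.sg (F z.1) * Num.sg (G z.2))%:C *
      cexp (- (((enorm z.1 ^+ 2 + enorm z.2 ^+ 2)%:C
                - 2 * t * (dotp z.1 z.2)%:C) / (2 * (1 - t ^+ 2))))).

(* f is holomorphic on the strip |Re t| < 1 and restricts on ]-1, 1[ to
   t |-> E[sign F(X) sign G(Y)]; the expectation depends only on the joint law
   of (X, Y), so it is taken over every realization of that law. By the identity
   theorem such an f is unique on the strip. *)
Definition analytic_extension n (F G : n.-tuple R -> R) (f : R[i] -> R[i]) :=
  (forall t, `|complex.Re t| < 1 -> derivable (f : R[i]^o -> R[i]^o) t 1) /\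
  (forall (t : R), -1 < t < 1 ->
    forall d (T : measurableType d) (P : probability T R)
      (X Y : 'I_n -> {RV P >-> R}), correlated_gaussians t X Y ->
    f t%:C = (fine 'E_P[fun w => Num.sg (F (random_vector X w)) *
                                 Num.sg (G (random_vector Y w))])%:C).

End Phi.

(* Main.v *)
(* Take n = 6 and F = G with F x = x_0 - eta * (x_1 * ... * x_5), eta > 0 small.
   For eta = 0 the integral factors into one-dimensional ones and gives exactly
   the value (2 / pi) * ln (1 + sqrt 2) attained by half-spaces. For eta > 0, put
   p = x_1 * ... * x_5 and q = y_1 * ... * y_5, and integrate out (x_0, y_0) first:
   the inner integral is a function of (eta * p, eta * q) whose Taylor expansion of
   order 4 has an explicit remainder. Integrating the monomials p ^ j * q ^ k
   against the remaining Gaussian gives fifth powers of the moments of a pair of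
   standard Gaussians of formal correlation i, namely E x y = i, E x^2 y^2 = - 1,
   E x^3 y = 3 i and E x^4 = 3. Since i ^ 5 = i, the terms in eta ^ 2 cancel, and
   since 3 ^ 5 is large the coefficient of eta ^ 4, which is 40, is positive.

   Holomorphy of Phi on the strip comes from a uniform quadratic bound on the
   first order remainder of the integrand, and its values on ]-1, 1[ from the
   identification of the law of (X, Y) on boxes. *)
Require Import Defs.
From HB Require Import structures.
From mathcomp Require Import all_boot all_order all_algebra.
From mathcomp Require Import all_classical all_reals all_analysis.
From mathcomp Require Import measurable_realfun lebesgue_integral_under.
From mathcomp Require Import complex ring lra.

Import Order.TTheory GRing.Theory Num.Theory.
Import numFieldNormedType.Exports.

Local Open Scope classical_set_scope.
Local Open Scope ring_scope.

Set Implicit Arguments.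
Unset Strict Implicit.
Unset Printing Implicit Defensive.

Section lebesgue_tuple_integral.
Context {R : realType}.
Local Notation mR := (measurableTypeR R).
Local Notation mu := (@lebesgue_measure R).
Local Notation lam := (@lebesgue_tuple R).
Local Open Scope ereal_scope.

Lemma ge0_integral_oppr (f : R -> \bar R) :
  measurable_fun setT f -> (forall x, 0 <= f x) ->
  \int[mu]_x f (- x)%R = \int[mu]_x f x.
Proof.
move=> mf f0.
have mN : measurable_fun [set: mR] (-%R : _ -> mR) by exact: oppr_measurable.
rewrite -[LHS](@ge0_integral_pushforward _ _ _ _ _ _ mN mu setT f) //.
apply: eq_measure_integral => A mA _; symmetry; by rewrite [RHS]lebesgue_measureN.
Qed.

Lemma measurable_tuple_consR n :
  measurable_fun [set: mR * n.-tuple R] (@tuple_cons R n).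
Proof. exact: measurable_tuple_cons. Qed.

Lemma ge0_integral_lebesgue_tupleS n (f : n.+1.-tuple R -> \bar R) :
  measurable_fun setT f -> (forall x, 0 <= f x) ->
  \int[lam n.+1]_x f x = \int[mu]_u \int[lam n]_x f (tuple_cons (u, x)).
Proof.
move=> mf f0.
have mf' : measurable_fun [set: mR * n.-tuple R] (f \o @tuple_cons R n).
  by apply: measurableT_comp => //; exact: measurable_tuple_consR.
rewrite -(fubini_tonelli1 (m1 := mu) (m2 := lam n) (f \o @tuple_cons R n))//.
exact: (ge0_integral_pushforward (@measurable_tuple_consR n) (mu \x lam n) measurableT mf).
by move=> z; exact: f0.
Qed.

End lebesgue_tuple_integral.

Section pairs.
Context {R : realType}.
Local Notation mR := (measurableTypeR R).
Local Notation mu := (@lebesgue_measure R).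
Local Notation lam := (@lebesgue_tuple R).
Local Open Scope ereal_scope.

Lemma measure_integral_indic d (T : measurableType d)
    (m : {measure set T -> \bar R}) (A : set T) :
  measurable A -> m A = \int[m]_x (\1_A x)%:E.
Proof. by move=> mA; rewrite integral_indic// setIT. Qed.

Lemma ge0_integral_prodM d1 d2 (T1 : measurableType d1) (T2 : measurableType d2)
    (m1 : {sigma_finite_measure set T1 -> \bar R})
    (m2 : {sigma_finite_measure set T2 -> \bar R})
    (f : T1 -> \bar R) (g : T2 -> \bar R) :
  measurable_fun setT f -> measurable_fun setT g ->
  (forall x, 0 <= f x) -> (forall x, 0 <= g x) ->
  \int[m1 \x m2]_z (f z.1 * g z.2) = (\int[m1]_x f x) * (\int[m2]_y g y).
Proof.
move=> mf mg f0 g0.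
rewrite (fubini_tonelli1 (m1 := m1) (m2 := m2) (fun z => f z.1 * g z.2))/=.
- transitivity (\int[m1]_x (f x * \int[m2]_y g y)).
    by apply: eq_integral => x _; rewrite /fubini_F/= ge0_integralZl.
  by rewrite ge0_integralZr// integral_ge0.
- by apply: emeasurable_funM; exact: measurableT_comp.
- by move=> z; rewrite mule_ge0.
Qed.

Section sigma_finite_product.
Context d1 d2 (T1 : measurableType d1) (T2 : measurableType d2).
Variables (m1 : {sigma_finite_measure set T1 -> \bar R})
  (m2 : {sigma_finite_measure set T2 -> \bar R}).

Definition sf_product : set (T1 * T2) -> \bar R := m1 \x m2.

HB.instance Definition _ := Measure.copy sf_product (m1 \x m2).

Let sf_product_sigma_finite : sigma_finite setT sf_product.
Proof.
have /sigma_finiteP[F [TF ndF Foo]] := sigma_finiteT m1.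
have /sigma_finiteP[G [TG ndG Goo]] := sigma_finiteT m2.
exists (fun k => F k `*` G k) => [|k].
  apply/seteqP; split => // -[x y] _.
  have [i _ Fx] : (\bigcup_k F k) x by rewrite -TF.
  have [j _ Gy] : (\bigcup_k G k) y by rewrite -TG.
  exists (maxn i j) => //; split => /=.
    by move: x Fx; exact/subsetPset/ndF/leq_maxl.
  by move: y Gy; exact/subsetPset/ndG/leq_maxr.
have [mF Fk] := Foo k; have [mG Gk] := Goo k; split; first exact: measurableX.
by rewrite /sf_product product_measure1E// lte_mul_pinfty// ge0_fin_numE.
Qed.

HB.instance Definition _ :=
  Measure_isSigmaFinite.Build _ _ _ sf_product sf_product_sigma_finite.

End sigma_finite_product.

Definition lebesgue_pairs n :
    {sigma_finite_measure set (n.-tuple R * n.-tuple R)%type -> \bar R} :=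
  sf_product (lam n) (lam n).

Definition lebesgue2 : {sigma_finite_measure set (mR * mR)%type -> \bar R} :=
  sf_product mu mu.

Local Notation lam2 := lebesgue_pairs.
Local Notation mu2 := lebesgue2.

(* Moves the first coordinates of a pair of (n+1)-tuples into the plane. *)
Definition consp n (z : (n.-tuple R * n.-tuple R) * (mR * mR)) :
    n.+1.-tuple R * n.+1.-tuple R :=
  (tuple_cons (z.2.1, z.1.1), tuple_cons (z.2.2, z.1.2)).

Lemma measurable_consp n : measurable_fun setT (@consp n).
Proof.
by apply: measurable_fun_pair; apply: measurable_cons => /=;
  repeat (apply: measurableT_comp => //).
Qed.

Lemma ge0_integral_lebesgue_tuple_prod n (A B : set (n.+1.-tuple R)) :
  measurable A -> measurable B ->
  pushforward (lam2 n \x mu2) (@consp n) (A `*` B) =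
  lam n.+1 A * lam n.+1 B.
Proof.
move=> mA mB.
pose a (z : n.-tuple R * mR) : \bar R := (\1_A (tuple_cons (z.2, z.1)))%:E.
pose b (z : n.-tuple R * mR) : \bar R := (\1_B (tuple_cons (z.2, z.1)))%:E.
have mcons : measurable_fun setT (fun z : n.-tuple R * mR => tuple_cons (z.2, z.1)).
  by apply: measurable_cons => /=; apply: measurableT_comp.
have ma : measurable_fun setT a.
  apply/measurable_EFinP.
  exact: (measurableT_comp (measurable_indic mA) mcons).
have mb : measurable_fun setT b.
  apply/measurable_EFinP; exact: (measurableT_comp (measurable_indic mB) mcons).
have lamE C (mC : measurable C) : lam n.+1 C =
    \int[lam n]_x \int[mu]_u (\1_C (tuple_cons (u, x)))%:E.
  transitivity (\int[lam n.+1]_x (\1_C x)%:E).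
    exact: measure_integral_indic.
  rewrite ge0_integral_lebesgue_tupleS//.
  - rewrite (fubini_tonelli (m1 := mu) (m2 := lam n) (fun z => (\1_C (tuple_cons z))%:E))//.
      apply/measurable_EFinP; apply: measurableT_comp; first exact: measurable_indic.
      exact: measurable_tuple_consR.
  - apply/measurable_EFinP; exact: measurable_indic.
have mAB : measurable (consp (n:=n) @^-1` (A `*` B)).
  by rewrite -[X in measurable X]setTI; apply: measurable_consp => //; exact: measurableX.
rewrite /pushforward.
transitivity (\int[lam2 n \x mu2]_z
    (a (z.1.1, z.2.1) * b (z.1.2, z.2.2))).
  transitivity (\int[lam2 n \x mu2]_z
      (\1_(consp (n:=n) @^-1` (A `*` B)) z)%:E).
    exact: measure_integral_indic.
  apply: eq_integral => -[[x y] [u v]] _.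
  rewrite /a /b /= -EFinM !indicE; congr EFin.
  rewrite -natrM mulnb; congr (nat_of_bool _)%:R.
  by apply/idP/andP; rewrite !inE.
rewrite (fubini_tonelli1 (m1 := lam2 n) (m2 := mu2)
  (fun z => a (z.1.1, z.2.1) * b (z.1.2, z.2.2)))/=.
- transitivity (\int[lam2 n]_z
     ((\int[mu]_u a (z.1, u)) * (\int[mu]_v b (z.2, v)))).
    apply: eq_integral => -[x y] _; rewrite /fubini_F/=.
    rewrite (@ge0_integral_prodM _ _ _ _ mu mu (fun u => a (x, u)) (fun v => b (y, v)))//.
    + exact: measurableT_comp.
    + exact: measurableT_comp.
    + by move=> u; rewrite lee_fin.
    + by move=> u; rewrite lee_fin.
  rewrite (@ge0_integral_prodM _ _ _ _ (lam n) (lam n) (fun x => \int[mu]_u a (x, u))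
     (fun y => \int[mu]_v b (y, v))).
  + by rewrite !lamE.
  + by apply: (measurable_fun_fubini_tonelli_F a) => // z; rewrite lee_fin.
  + by apply: (measurable_fun_fubini_tonelli_F b) => // z; rewrite lee_fin.
  + by move=> x; apply: integral_ge0 => u _; rewrite lee_fin.
  + by move=> x; apply: integral_ge0 => u _; rewrite lee_fin.
- apply: emeasurable_funM; apply: measurableT_comp => //;
   apply: measurable_fun_pair; repeat apply: measurableT_comp => //.
- by move=> z; rewrite mule_ge0// lee_fin.
Qed.

Definition consp_measure n : {measure set _ -> \bar R} :=
  measure_function_pushforward__canonical__measure_function_Measure
    (lam2 n \x mu2) (@measurable_consp n).

Lemma lebesgue_tuple_pairS n (X : set (n.+1.-tuple R * n.+1.-tuple R)) :
  measurable X -> lam2 n.+1 X = consp_measure n X.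
Proof.
apply: (@product_measure_unique _ _ _ _ _ (lam n.+1) (lam n.+1) (consp_measure n)).
exact: ge0_integral_lebesgue_tuple_prod.
Qed.

Lemma integral_consp_measure n (f : n.+1.-tuple R * n.+1.-tuple R -> \bar R) :
  \int[lam2 n.+1]_z f z = \int[pushforward (lam2 n \x mu2) (@consp n)]_z f z.
Proof.
rewrite (@eq_measure_integral _ _ _ setT (consp_measure n))// => A mA _.
exact: lebesgue_tuple_pairS.
Qed.

Lemma ge0_integral_lebesgue_tuple_pairS n
    (f : n.+1.-tuple R * n.+1.-tuple R -> \bar R) :
  measurable_fun setT f -> (forall z, 0 <= f z) ->
  \int[lam2 n.+1]_z f z =
  \int[lam2 n]_z \int[mu2]_w f (consp (z, w)).
Proof.
move=> mf f0.
rewrite integral_consp_measure.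
rewrite ge0_integral_pushforward//; last exact: measurable_consp.
rewrite preimage_setT fubini_tonelli1//.
  apply: measurableT_comp => //; exact: measurable_consp.
by move=> z; exact: f0.
Qed.

Lemma integrable_lebesgue_tuple_pairS n
    (f : n.+1.-tuple R * n.+1.-tuple R -> \bar R) :
  (lam2 n.+1).-integrable setT f ->
  (lam2 n \x mu2).-integrable setT (f \o @consp n).
Proof.
move=> intf; have mf := measurable_int _ intf.
apply/integrableP; split; first exact: measurableT_comp (@measurable_consp n).
move/integrableP : intf => [_].
rewrite ge0_integral_lebesgue_tuple_pairS//; last exact: measurableT_comp.
rewrite (fubini_tonelli1 (m1 := lam2 n) (m2 := mu2) (fun z => `|(f \o @consp n) z|))//.
by do 2 apply: measurableT_comp => //; exact: measurable_consp.
Qed.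

Lemma integral_lebesgue_tuple_pairS n
    (f : n.+1.-tuple R * n.+1.-tuple R -> \bar R) :
  (lam2 n.+1).-integrable setT f ->
  \int[lam2 n.+1]_z f z =
  \int[lam2 n]_z \int[mu2]_w f (consp (z, w)).
Proof.
move=> intf; have mf := measurable_int _ intf.
have intf' := integrable_lebesgue_tuple_pairS intf.
rewrite integral_consp_measure.
rewrite integral_pushforward//; last exact: measurable_consp.
by rewrite preimage_setT -integral12_prod_meas1.
Qed.

End pairs.

Section subexponential.
Context {R : realType} d (T : measurableType d) (q : T -> R).
Hypothesis q0 : forall z, 0 <= q z.
Implicit Types g h : T -> R.

Definition subexp (g : T -> R) := measurable_fun setT g /\
  forall e, 0 < e -> exists C, forall z, `|g z| <= C * expR (e * q z).

Lemma subexp_bounded g C : measurable_fun setT g -> (forall z, `|g z| <= C) ->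
  subexp g.
Proof.
move=> mg gC; split=> // e e0; exists C => z.
rewrite (le_trans (gC z))// ler_peMr//; first exact: le_trans (gC z).
by rewrite -expR0 ler_expR mulr_ge0// ltW.
Qed.

Lemma subexp_cst c : subexp (fun=> c).
Proof. exact: (@subexp_bounded _ `|c|). Qed.

Lemma subexpM g h : subexp g -> subexp h -> subexp (fun z => g z * h z).
Proof.
move=> [mg gC] [mh hC]; split=> [|e e0]; first exact: measurable_funM.
have e20 : 0 < e / 2 by rewrite divr_gt0.
have [C gC'] := gC _ e20; have [D hD] := hC _ e20; exists (C * D) => z.
rewrite normrM (le_trans (ler_pM _ _ (gC' z) (hD z)))//.
by rewrite mulrACA -expRD -mulrDl -splitr.
Qed.

Lemma subexpD g h : subexp g -> subexp h -> subexp (fun z => g z + h z).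
Proof.
move=> [mg gC] [mh hC]; split=> [|e e0]; first exact: measurable_funD.
have [C gC'] := gC _ e0; have [D hD] := hC _ e0; exists (C + D) => z.
by rewrite (le_trans (ler_normD _ _))// mulrDl lerD.
Qed.

Lemma subexpZ c g : subexp g -> subexp (fun z => c * g z).
Proof. by move=> ?; apply: subexpM => //; exact: subexp_cst. Qed.

Lemma subexpN g : subexp g -> subexp (fun z => - g z).
Proof.
move=> [mg gC]; split=> [|e e0]; first exact: measurableT_comp.
by have [C gC'] := gC _ e0; exists C => z; rewrite normrN.
Qed.

Lemma subexpB g h : subexp g -> subexp h -> subexp (fun z => g z - h z).
Proof. by move=> ? ?; apply: subexpD => //; exact: subexpN. Qed.

Lemma subexpX g k : subexp g -> subexp (fun z => g z ^+ k).
Proof.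
move=> sg; elim: k => [|k IH]; first exact: subexp_cst.
by under [X in subexp X]eq_fun do rewrite exprS; exact: subexpM.
Qed.

Lemma subexp_norm g : subexp g -> subexp (fun z => `|g z|).
Proof.
move=> [mg gC]; split=> [|e e0]; first exact: measurableT_comp.
by have [C gC'] := gC _ e0; exists C => z; rewrite normr_id.
Qed.

Lemma subexp_prod (I : eqType) (s : seq I) (g : I -> T -> R) :
  (forall i, subexp (g i)) -> subexp (fun z => \prod_(i <- s) g i z).
Proof.
move=> sg; elim: s => [|i s IH].
  by under [X in subexp X]eq_fun do rewrite big_nil; exact: subexp_cst.
by under [X in subexp X]eq_fun do rewrite big_cons; exact: subexpM.
Qed.

Lemma subexp_coord g : measurable_fun setT g -> (forall z, g z ^+ 2 <= q z) ->
  subexp g.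
Proof.
move=> mg gq; split=> // e e0; exists (1 + e^-1) => z.
have e10 : 0 < e^-1 by rewrite invr_gt0.
have /le_trans : `|g z| <= (1 + e^-1) * (1 + e * q z).
  have := gq z; rewrite -real_normK ?num_real//; set x := `|g z| => xq.
  have x0 : 0 <= x by exact: normr_ge0.
  have -> : (1 + e^-1) * (1 + e * q z) = 1 + e^-1 + e * q z + q z.
    by field; rewrite gt_eqF.
  have : 0 <= e * q z by rewrite mulr_ge0// ltW.
  have : 0 <= (x - 1) ^+ 2 by exact: sqr_ge0.
  nra.
apply; rewrite ler_pM2l ?addr_gt0//.
exact: expR_ge1Dx.
Qed.

Lemma subexp_self : measurable_fun setT q -> subexp q.
Proof.
move=> mq; split=> // e e0; exists e^-1 => z.
rewrite ger0_norm// -ler_pdivrMl ?invr_gt0// invrK.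
by rewrite (le_trans _ (expR_ge1Dx _))// lerDr.
Qed.

Lemma subexp_integrable (m : {measure set T -> \bar R}) (g : T -> R) a :
  measurable_fun setT q ->
  (forall e, 0 < e -> m.-integrable setT (EFin \o (fun z => expR (- (e * q z))))) ->
  subexp g -> 0 < a ->
  m.-integrable setT (EFin \o (fun z => g z * expR (- (a * q z)))).
Proof.
move=> mq eint [mg gC] a0.
have a20 : 0 < a / 2 by rewrite divr_gt0.
have [C gC'] := gC _ a20.
apply: (@le_integrable _ _ _ m setT measurableT _
  (EFin \o (fun z => C * expR (- (a / 2 * q z))))).
- apply/measurable_EFinP; apply: measurable_funM => //.
  apply: measurableT_comp => //; apply: measurableT_comp => //.
  exact: measurable_funM.
- move=> z _ /=; rewrite lee_fin normrM [`|expR _|]ger0_norm ?expR_ge0//.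
  rewrite (le_trans (ler_wpM2r (expR_ge0 _) (gC' z)))// -[C * _ * _]mulrA -expRD.
  have -> : a / 2 * q z + - (a * q z) = - (a / 2 * q z) by field.
  exact: ler_norm.
- have := integrableZl measurableT C (eint _ a20).
  by apply: eq_integrable => // z _ /=; rewrite EFinM.
Qed.

End subexponential.

Section Rfubini.
Context d1 d2 (T1 : measurableType d1) (T2 : measurableType d2) (R : realType).
Context (m1 : {sigma_finite_measure set T1 -> \bar R})
  (m2 : {sigma_finite_measure set T2 -> \bar R}).
Variable f : T1 * T2 -> R.
Hypothesis intf : (m1 \x m2)%E.-integrable setT (EFin \o f).

Lemma Rfubini12 :
  (forall x, m2.-integrable setT (EFin \o (fun y => f (x, y)))) ->
  \int[(m1 \x m2)%E]_z f z = \int[m1]_x \int[m2]_y f (x, y).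
Proof.
move=> intf2; rewrite /Rintegral -integral12_prod_meas1//; congr fine.
apply: eq_integral => x _; rewrite /fubini_F/= fineK//.
exact: (integrable_fin_num measurableT (intf2 x)).
Qed.

Lemma Rfubini21 :
  (forall y, m1.-integrable setT (EFin \o (fun x => f (x, y)))) ->
  \int[(m1 \x m2)%E]_z f z = \int[m2]_y \int[m1]_x f (x, y).
Proof.
move=> intf2; rewrite /Rintegral -integral21_prod_meas1//; congr fine.
apply: eq_integral => x _; rewrite /fubini_G/= fineK//.
exact: (integrable_fin_num measurableT (intf2 x)).
Qed.

End Rfubini.

Section gauss.
Context {R : realType}.
Local Notation mR := (measurableTypeR R).
Local Notation mu := (@lebesgue_measure R).
Local Notation lam2 := (@lebesgue_pairs R).
Local Notation mu2 := (@lebesgue2 R).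

Lemma measurable_expRN_quad d (T : measurableType d) (q : T -> R) e :
  measurable_fun setT q -> measurable_fun setT (fun z => expR (- (e * q z))).
Proof.
move=> mq; apply: measurableT_comp => //; apply: measurableT_comp => //.
exact: measurable_funM.
Qed.

Lemma integral_gauss_scale (e : R) : 0 < e ->
  (\int[mu]_x (expR (- (e * x ^+ 2)))%:E = (Num.sqrt (pi / e))%:E)%E.
Proof.
move=> e0; pose s := (Num.sqrt (e *+ 2))^-1.
have e20 : 0 < e *+ 2 by rewrite pmulrn_lgt0.
have s0 : s != 0 by rewrite gt_eqF// invr_gt0 sqrtr_gt0.
have s2 : s ^+ 2 = (e *+ 2)^-1 by rewrite exprVn sqr_sqrtr// ltW.
have pk0 : 0 < normal_peak s := normal_peak_gt0 s0.
transitivity (\int[mu]_x ((normal_peak s)^-1%:E * (normal_pdf 0 s x)%:E))%E.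
  apply: eq_integral => x _; rewrite -EFinM normal_pdfE// mulKf ?gt_eqF//.
  rewrite /normal_fun subr0 s2; congr (expR _)%:E.
  by field; rewrite gt_eqF.
rewrite ge0_integralZl//=.
- rewrite integral_normal_pdf mule1 /normal_peak invrK s2; congr (Num.sqrt _)%:E.
  by field; rewrite gt_eqF.
- by apply/measurable_EFinP; exact: measurable_normal_pdf.
- by move=> x _; rewrite lee_fin normal_pdf_ge0.
- by rewrite lee_fin invr_ge0 ltW.
Qed.

Lemma integrable_gauss_scale (e : R) : 0 < e ->
  mu.-integrable setT (EFin \o (fun x : mR => expR (- (e * x ^+ 2)))).
Proof.
move=> e0; apply/integrableP; split.
  by apply/measurable_EFinP; apply: measurable_expRN_quad; exact: measurable_funX.
under eq_integral do rewrite /= ger0_norm ?expR_ge0//.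
by rewrite integral_gauss_scale// ltry.
Qed.

Definition sqnorm2 (w : mR * mR) : R := w.1 ^+ 2 + w.2 ^+ 2.

Lemma sqnorm2_ge0 w : 0 <= sqnorm2 w.
Proof. by rewrite addr_ge0// sqr_ge0. Qed.

Lemma measurable_sqnorm2 : measurable_fun setT sqnorm2.
Proof. by apply: measurable_funD; apply: measurable_funX. Qed.

Lemma integrable_gauss2 (e : R) : 0 < e ->
  mu2.-integrable setT (EFin \o (fun w => expR (- (e * sqnorm2 w)))).
Proof.
move=> e0; apply/integrableP; split.
  apply/measurable_EFinP; apply: measurable_expRN_quad; exact: measurable_sqnorm2.
under eq_integral => w _.
  rewrite /= ger0_norm ?expR_ge0// mulrDr opprD expRD EFinM.
  over.
rewrite (ge0_integral_prodM mu mu (f := fun x => (expR (- (e * x ^+ 2)))%:E)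
  (g := fun x => (expR (- (e * x ^+ 2)))%:E)).
- by rewrite integral_gauss_scale// -EFinM ltry.
- by apply/measurable_EFinP; apply: measurable_expRN_quad; exact: measurable_funX.
- by apply/measurable_EFinP; apply: measurable_expRN_quad; exact: measurable_funX.
- by move=> x; rewrite lee_fin expR_ge0.
- by move=> x; rewrite lee_fin expR_ge0.
Qed.

Lemma tnth_tuple_cons0 n (z : R * n.-tuple R) : tnth (tuple_cons z) ord0 = z.1.
Proof. by rewrite (tnth_nth 0). Qed.

Lemma tnth_tuple_consS n (z : R * n.-tuple R) j :
  tnth (tuple_cons z) (lift ord0 j) = tnth z.2 j.
Proof. by rewrite !(tnth_nth 0). Qed.

Lemma dotp_tuple_cons n (z w : R * n.-tuple R) :
  dotp (tuple_cons z) (tuple_cons w) = z.1 * w.1 + dotp z.2 w.2.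
Proof.
rewrite /dotp big_ord_recl !tnth_tuple_cons0; congr (_ + _).
by apply: eq_bigr => j _; rewrite !tnth_tuple_consS.
Qed.

Definition sqnorm_pair n (z : n.-tuple R * n.-tuple R) : R :=
  dotp z.1 z.1 + dotp z.2 z.2.

Lemma dotp_ge0 n (x : n.-tuple R) : 0 <= dotp x x.
Proof. by apply: sumr_ge0 => j _; rewrite -expr2 sqr_ge0. Qed.

Lemma sqnorm_pair_ge0 n z : 0 <= @sqnorm_pair n z.
Proof. by rewrite addr_ge0// dotp_ge0. Qed.

Lemma sqnorm_pairS n (z : (n.-tuple R * n.-tuple R) * (mR * mR)) :
  sqnorm_pair (consp z) = sqnorm_pair z.1 + sqnorm2 z.2.
Proof.
by rewrite /sqnorm_pair /consp/= !dotp_tuple_cons/= -!expr2 addrACA addrC.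
Qed.

Lemma sqnorm_pair0 z : @sqnorm_pair 0 z = 0.
Proof. by rewrite /sqnorm_pair /dotp !big_ord0 addr0. Qed.

Lemma measurable_dotp d (T : measurableType d) n (f g : T -> n.-tuple R) :
  measurable_fun setT f -> measurable_fun setT g ->
  measurable_fun setT (fun t => dotp (f t) (g t)).
Proof.
move=> mf mg; apply: measurable_sum => j; apply: measurable_funM.
  exact: measurableT_comp (measurable_tnth j) mf.
exact: measurableT_comp (measurable_tnth j) mg.
Qed.

Lemma measurable_sqnorm_pair n : measurable_fun setT (@sqnorm_pair n).
Proof. by apply: measurable_funD; exact: measurable_dotp. Qed.

Lemma integral_lebesgue_pairs0 (f : 0.-tuple R * 0.-tuple R -> R) :
  (\int[lam2 0]_z (f z)%:E = (f ([tuple], [tuple]))%:E)%E.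
Proof.
transitivity (\int[lam2 0]_z (f ([tuple], [tuple]))%:E)%E.
  by apply: eq_integral => -[x y] _; rewrite (tuple0 x) (tuple0 y).
rewrite integral_cst//.
rewrite [X in (_ * X)%E](_ : _ = 1%E) ?mule1//.
rewrite -setXTT [LHS]product_measure1E//.
by rewrite /= !diracT mule1.
Qed.

Lemma ge0_integral_pairs_prod n (f : 'I_n -> mR * mR -> R) :
  (forall j, measurable_fun setT (f j)) -> (forall j w, 0 <= f j w) ->
  (\int[lam2 n]_z (\prod_(j < n) f j (tnth z.1 j, tnth z.2 j))%:E =
  \prod_(j < n) \int[mu2]_w (f j w)%:E)%E.
Proof.
have mprod k (g : 'I_k -> mR * mR -> R) : (forall j, measurable_fun setT (g j)) ->
  measurable_fun setT (fun z : k.-tuple R * k.-tuple R => \prod_(j < k) g j (tnth z.1 j, tnth z.2 j)).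
  move=> mg; apply: measurable_prod => j _; apply: (measurableT_comp (mg j)).
  apply: measurable_fun_pair.
    exact: measurableT_comp (measurable_tnth j) measurable_fst.
  exact: measurableT_comp (measurable_tnth j) measurable_snd.
elim: n f => [|n IH] f mf f0.
  by rewrite integral_lebesgue_pairs0 !big_ord0.
rewrite ge0_integral_lebesgue_tuple_pairS; last 2 first.
- by apply/measurable_EFinP; exact: mprod.
- by move=> z; rewrite lee_fin prodr_ge0.
rewrite big_ord_recl -IH//.
rewrite -ge0_integralZl//; last 3 first.
- by apply/measurable_EFinP; exact: (mprod _ (fun j => f (lift ord0 j))).
- by move=> z _; rewrite lee_fin prodr_ge0.
- by apply: integral_ge0 => w _; rewrite lee_fin.
apply: eq_integral => -[x y] _ /=.
rewrite -ge0_integralZr//; last 3 first.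
- by apply/measurable_EFinP.
- by move=> w _; rewrite lee_fin.
- by rewrite lee_fin prodr_ge0.
apply: eq_integral => -[u v] _ /=.
rewrite -EFinM big_ord_recl !tnth_tuple_cons0/=; congr (_ * _)%:E.
by apply: eq_bigr => j _; rewrite !tnth_tuple_consS.
Qed.

Lemma integrable_gauss_pairs n (e : R) : 0 < e ->
  (lam2 n).-integrable setT (EFin \o (fun z => expR (- (e * sqnorm_pair z)))).
Proof.
move=> e0; apply/integrableP; split.
  apply/measurable_EFinP; apply: measurable_expRN_quad; exact: measurable_sqnorm_pair.
rewrite (_ : (\int[_]_(_ in _) _)%E = (\int[lam2 n]_z
  (\prod_(j < n) expR (- (e * sqnorm2 (tnth z.1 j, tnth z.2 j))))%:E)%E); last first.
  apply: eq_integral => z _; rewrite /= ger0_norm ?expR_ge0//; congr EFin.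
  rewrite -expR_sum; congr expR; rewrite sumrN -mulr_sumr /sqnorm_pair /dotp -big_split.
  by congr (- (_ * _)); apply: eq_bigr => j _; rewrite /sqnorm2/= !expr2.
rewrite (ge0_integral_pairs_prod (f := fun _ w => expR (- (e * sqnorm2 w)))).
- rewrite -(@fineK _ (\int[mu2]_w _)%E); last first.
    exact: (integrable_fin_num measurableT (integrable_gauss2 e0)).
  by rewrite prodEFin ltry.
- by move=> _; apply: measurable_expRN_quad; exact: measurable_sqnorm2.
- by move=> *; exact: expR_ge0.
Qed.

End gauss.

Section pairs_Rintegral.
Context {R : realType}.
Local Notation mR := (measurableTypeR R).
Local Notation lam2 := (@lebesgue_pairs R).
Local Notation mu2 := (@lebesgue2 R).

Lemma subexp_integrable2 (g : mR * mR -> R) a : subexp sqnorm2 g -> 0 < a ->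
  mu2.-integrable setT (EFin \o (fun z => g z * expR (- (a * sqnorm2 z)))).
Proof.
apply: subexp_integrable => //; first exact: measurable_sqnorm2.
exact: integrable_gauss2.
Qed.

Lemma subexp_integrable_pairs n (g : n.-tuple R * n.-tuple R -> R) a :
  subexp (@sqnorm_pair R n) g -> 0 < a ->
  (lam2 n).-integrable setT (EFin \o (fun z => g z * expR (- (a * sqnorm_pair z)))).
Proof.
apply: subexp_integrable => //; first exact: measurable_sqnorm_pair.
exact: integrable_gauss_pairs.
Qed.

Lemma subexp_consp n (g : n.+1.-tuple R * n.+1.-tuple R -> R) z :
  subexp (@sqnorm_pair R n.+1) g -> subexp sqnorm2 (fun w => g (consp (z, w))).
Proof.
move=> [mg gC]; split=> [|e e0].
  apply: measurableT_comp => //; apply: measurableT_comp; first exact: measurable_consp.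
  exact: pair1_measurable.
have [C gC'] := gC e e0; exists (C * expR (e * sqnorm_pair z)) => w.
by rewrite (le_trans (gC' _))// sqnorm_pairS/= mulrDr expRD mulrA.
Qed.

Lemma expR_sqnorm_pairS n a (z : n.-tuple R * n.-tuple R) w :
  expR (- (a * sqnorm_pair (consp (z, w)))) =
  expR (- (a * sqnorm2 w)) * expR (- (a * sqnorm_pair z)).
Proof. by rewrite sqnorm_pairS/= -expRD -opprD -mulrDr [in RHS]addrC. Qed.

Lemma Rintegral_pairsS n (g : n.+1.-tuple R * n.+1.-tuple R -> R) a :
  subexp (@sqnorm_pair R n.+1) g -> 0 < a ->
  \int[lam2 n.+1]_z (g z * expR (- (a * sqnorm_pair z))) =
  \int[lam2 n]_z ((\int[mu2]_w (g (consp (z, w)) * expR (- (a * sqnorm2 w))))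
    * expR (- (a * sqnorm_pair z))).
Proof.
move=> sg a0; have ig := subexp_integrable_pairs sg a0.
rewrite /Rintegral integral_lebesgue_tuple_pairS//; congr fine.
apply: eq_integral => z _.
have igz := subexp_integrable2 (subexp_consp z sg) a0.
rewrite EFinM fineK; last exact: (integrable_fin_num measurableT igz).
rewrite -integralZr//; apply: eq_integral => w _.
by rewrite /= expR_sqnorm_pairS -EFinM mulrA.
Qed.

Lemma subexp_Rintegral_consp n (g : n.+1.-tuple R * n.+1.-tuple R -> R) a :
  subexp (@sqnorm_pair R n.+1) g -> 0 < a ->
  subexp (@sqnorm_pair R n)
    (fun z => \int[mu2]_w (g (consp (z, w)) * expR (- (a * sqnorm2 w)))).
Proof.
move=> sg a0; split.
  have ig := subexp_integrable_pairs sg a0.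
  have /measurable_fubini_F := integrable_lebesgue_tuple_pairS ig.
  move=> mF; have {}mF : measurable_fun setT (fine \o
    (fubini_F mu2 ((EFin \o (fun z => g z * expR (- (a * sqnorm_pair z)))) \o @consp R n))).
    exact: measurableT_comp mF.
  have : measurable_fun setT (fun z => (fine \o
    (fubini_F mu2 ((EFin \o (fun z => g z * expR (- (a * sqnorm_pair z)))) \o @consp R n))) z
     * expR (a * sqnorm_pair z)).
    apply: measurable_funM => //; apply: measurableT_comp => //.
    by apply: measurable_funM => //; exact: measurable_sqnorm_pair.
  apply: eq_measurable_fun => z _ /=.
  rewrite /fubini_F/=.
  have igz := subexp_integrable2 (subexp_consp z sg) a0.
  under eq_integral do rewrite expR_sqnorm_pairS mulrA EFinM.
  rewrite integralZr//.
  rewrite fineM//; last exact: (integrable_fin_num measurableT igz).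
  by rewrite /= -mulrA -expRD addNr expR0 mulr1.
move=> e e0; have [_ /(_ (Num.min e (a / 2)))[|C gC]] := sg.
  by rewrite lt_min e0 divr_gt0.
pose K := \int[mu2]_w (C * expR (- (a / 2 * sqnorm2 w))).
exists K => z.
have igz := subexp_integrable2 (subexp_consp z sg) a0.
have a20 : 0 < a / 2 by rewrite divr_gt0.
have C0 : 0 <= C.
  rewrite -(@pmulr_rge0 _ (expR (Num.min e (a / 2) * sqnorm_pair (consp (z, (0, 0)))))) ?expR_gt0//.
  by rewrite mulrC (le_trans _ (gC _)).
have igC : mu2.-integrable setT (EFin \o (fun w => C * expR (- (a / 2 * sqnorm2 w)))).
  by apply: subexp_integrable2 => //; exact: subexp_cst sqnorm2_ge0 _.
have igCz : mu2.-integrable setT (EFin \o (fun w => C * expR (- (a / 2 * sqnorm2 w)) *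
    expR (e * sqnorm_pair z))).
  have := integrableZr measurableT (expR (e * sqnorm_pair z)) igC.
  by apply: eq_integrable.
rewrite (le_trans (le_normr_Rintegral measurableT igz))//.
rewrite /K -RintegralZr//.
apply: le_Rintegral => //; first exact: (integrable_norm igz).
move=> w _; rewrite normrM [`|expR _|]ger0_norm ?expR_ge0//.
rewrite (le_trans (ler_wpM2r (expR_ge0 _) (gC _)))//.
rewrite -!mulrA ler_wpM2l// -!expRD ler_expR sqnorm_pairS/= mulrDr.
have h1 : Num.min e (a / 2) * sqnorm_pair z <= e * sqnorm_pair z.
  by rewrite ler_wpM2r ?sqnorm_pair_ge0// ge_min lexx.
have h2 : Num.min e (a / 2) * sqnorm2 w <= a / 2 * sqnorm2 w.
  by rewrite ler_wpM2r ?sqnorm2_ge0// ge_min lexx orbT.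
have -> : a * sqnorm2 w = a / 2 * sqnorm2 w + a / 2 * sqnorm2 w by field.
lra.
Qed.

End pairs_Rintegral.

Section tensor.
Context {R : realType}.
Local Notation mR := (measurableTypeR R).
Local Notation lam2 := (@lebesgue_pairs R).
Local Notation mu2 := (@lebesgue2 R).

Variables (al th : mR * mR -> R) (a : R).
Hypotheses (sal : subexp sqnorm2 al) (mth : measurable_fun setT th) (a0 : 0 < a).

Definition tprod n (z : n.-tuple R * n.-tuple R) : R :=
  \prod_(j < n) al (tnth z.1 j, tnth z.2 j).
Definition tphase n (z : n.-tuple R * n.-tuple R) : R :=
  \sum_(j < n) th (tnth z.1 j, tnth z.2 j).

Lemma measurable_tnth_pair n (j : 'I_n) :
  measurable_fun setT (fun z : n.-tuple R * n.-tuple R => (tnth z.1 j, tnth z.2 j)).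
Proof.
apply: measurable_fun_pair.
  exact: measurableT_comp (measurable_tnth j) measurable_fst.
exact: measurableT_comp (measurable_tnth j) measurable_snd.
Qed.

Lemma subexp_tnth_pair (g : mR * mR -> R) n (j : 'I_n) :
  subexp sqnorm2 g ->
  subexp (@sqnorm_pair R n) (fun z => g (tnth z.1 j, tnth z.2 j)).
Proof.
move=> [mg gC]; split=> [|e e0].
  exact: measurableT_comp mg (measurable_tnth_pair j).
have [C gC'] := gC e e0; exists C => z.
have C0 : 0 <= C.
  rewrite -(@pmulr_rge0 _ (expR (e * sqnorm2 (0, 0)))) ?expR_gt0//.
  by rewrite mulrC (le_trans _ (gC' _)).
rewrite (le_trans (gC' _))// ler_wpM2l// ler_expR ler_pM2l// /sqnorm2/= /sqnorm_pair.
rewrite /dotp -big_split/= (bigD1 j)//= !expr2 lerDl sumr_ge0// => i _.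
by rewrite -!expr2 addr_ge0 ?sqr_ge0.
Qed.

Lemma subexp_tprod n : subexp (@sqnorm_pair R n) (@tprod n).
Proof.
apply: subexp_prod => [|j]; first exact: sqnorm_pair_ge0.
exact: subexp_tnth_pair.
Qed.

Lemma measurable_tphase n : measurable_fun setT (@tphase n).
Proof.
apply: measurable_sum => j; exact: measurableT_comp mth (measurable_tnth_pair j).
Qed.

Lemma subexp_cos d (T : measurableType d) (q f : T -> R) :
  (forall z, 0 <= q z) -> measurable_fun setT f -> subexp q (fun z => cos (f z)).
Proof.
move=> q0 mf; apply: (@subexp_bounded _ _ _ _ q0 _ 1) => [|z].
  by apply: measurableT_comp mf; exact: continuous_measurable_fun (@continuous_cos _).
by rewrite ler_norml cos_geN1 cos_le1.
Qed.

Lemma subexp_sin d (T : measurableType d) (q f : T -> R) :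
  (forall z, 0 <= q z) -> measurable_fun setT f -> subexp q (fun z => sin (f z)).
Proof.
move=> q0 mf; apply: (@subexp_bounded _ _ _ _ q0 _ 1) => [|z].
  by apply: measurableT_comp mf; exact: continuous_measurable_fun (@continuous_sin _).
by rewrite ler_norml sin_geN1 sin_le1.
Qed.

Lemma tprodS n z w : @tprod n.+1 (consp (z, w)) = al w * tprod z.
Proof.
rewrite /tprod big_ord_recl /consp/= !tnth_tuple_cons0/=; case: w => u v/=; congr (_ * _).
by apply: eq_bigr => j _; rewrite !tnth_tuple_consS.
Qed.

Lemma tphaseS n z w : @tphase n.+1 (consp (z, w)) = th w + tphase z.
Proof.
rewrite /tphase big_ord_recl /consp/= !tnth_tuple_cons0/=; case: w => u v/=; congr (_ + _).
by apply: eq_bigr => j _; rewrite !tnth_tuple_consS.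
Qed.

Local Notation C2 := (\int[mu2]_w (al w * cos (th w) * expR (- (a * sqnorm2 w)))).
Local Notation S2 := (\int[mu2]_w (al w * sin (th w) * expR (- (a * sqnorm2 w)))).

Let sC2 : subexp sqnorm2 (fun w => al w * cos (th w)).
Proof. apply: subexpM => //; exact: subexp_cos sqnorm2_ge0 mth. Qed.
Let sS2 : subexp sqnorm2 (fun w => al w * sin (th w)).
Proof. apply: subexpM => //; exact: subexp_sin sqnorm2_ge0 mth. Qed.

Let sC n : subexp (@sqnorm_pair R n) (fun z => tprod z * cos (tphase z)).
Proof.
apply: subexpM; first exact: subexp_tprod.
by apply: subexp_cos; [exact: sqnorm_pair_ge0|exact: measurable_tphase].
Qed.
Let sS n : subexp (@sqnorm_pair R n) (fun z => tprod z * sin (tphase z)).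
Proof.
apply: subexpM; first exact: subexp_tprod.
by apply: subexp_sin; [exact: sqnorm_pair_ge0|exact: measurable_tphase].
Qed.

Lemma Rintegral_tensor n :
  Complex (\int[lam2 n]_z (tprod z * cos (tphase z) * expR (- (a * sqnorm_pair z))))
          (\int[lam2 n]_z (tprod z * sin (tphase z) * expR (- (a * sqnorm_pair z)))) =
  (Complex C2 S2) ^+ n.
Proof.
elim: n => [|n IH].
  rewrite expr0 /Rintegral !integral_lebesgue_pairs0/= /tprod /tphase !big_ord0.
  by rewrite sin0 cos0 sqnorm_pair0 mulr0 oppr0 expR0 !mulr1 !mulr0.
have int2 (g : mR * mR -> R) c : subexp sqnorm2 g ->
    mu2.-integrable setT (EFin \o (fun w => g w * expR (- (a * sqnorm2 w)) * c)).
  move=> sg; have := integrableZr measurableT c (subexp_integrable2 sg a0).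
  exact: eq_integrable.
have intn (g : n.-tuple R * n.-tuple R -> R) c : subexp (@sqnorm_pair R n) g ->
    (lam2 n).-integrable setT (EFin \o (fun w => c * (g w * expR (- (a * sqnorm_pair w))))).
  move=> sg; have := integrableZl measurableT c (subexp_integrable_pairs sg a0).
  exact: eq_integrable.
rewrite exprS -IH.
rewrite [RHS](_ : _ = Complex
   (C2 * (\int[lam2 n]_z (tprod z * cos (tphase z) * expR (- (a * sqnorm_pair z)))) -
    S2 * (\int[lam2 n]_z (tprod z * sin (tphase z) * expR (- (a * sqnorm_pair z)))))
   (C2 * (\int[lam2 n]_z (tprod z * sin (tphase z) * expR (- (a * sqnorm_pair z)))) +
    S2 * (\int[lam2 n]_z (tprod z * cos (tphase z) * expR (- (a * sqnorm_pair z))))))//.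
congr Complex.
- rewrite Rintegral_pairsS//.
  rewrite -!RintegralZl//; do ?exact: subexp_integrable_pairs.
  rewrite -RintegralB//; try exact: intn.
  apply: eq_Rintegral => z _; rewrite /=.
  under eq_Rintegral do rewrite tprodS tphaseS cosD.
  have -> : \int[mu2]_w (al w * tprod z * (cos (th w) * cos (tphase z) - sin (th w) * sin (tphase z)) *
      expR (- (a * sqnorm2 w))) = C2 * (tprod z * cos (tphase z)) - S2 * (tprod z * sin (tphase z)).
    rewrite -!RintegralZr//; do ?exact: subexp_integrable2.
    rewrite -RintegralB//; try exact: int2.
    by apply: eq_Rintegral => w _ /=; ring.
  by ring.
- rewrite Rintegral_pairsS//.
  rewrite -!RintegralZl//; do ?exact: subexp_integrable_pairs.
  rewrite -RintegralD//; try exact: intn.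
  apply: eq_Rintegral => z _; rewrite /=.
  under eq_Rintegral do rewrite tprodS tphaseS sinD.
  have -> : \int[mu2]_w (al w * tprod z * (sin (th w) * cos (tphase z) + cos (th w) * sin (tphase z)) *
      expR (- (a * sqnorm2 w))) = C2 * (tprod z * sin (tphase z)) + S2 * (tprod z * cos (tphase z)).
    rewrite -!RintegralZr//; do ?exact: subexp_integrable2.
    rewrite -RintegralD//; try exact: int2.
    by apply: eq_Rintegral => w _ /=; ring.
  by ring.
Qed.

End tensor.

Section symmetry.
Context {R : realType}.
Local Notation mR := (measurableTypeR R).
Local Notation mu := (@lebesgue_measure R).
Local Notation lam := (@lebesgue_tuple R).
Local Notation lam2 := (@lebesgue_pairs R).

Lemma measurable_map_oppr n :
  measurable_fun setT (fun x : n.-tuple R => map_tuple -%R x).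
Proof.
apply/measurable_fun_tnthP => j.
rewrite (_ : _ \o _ = fun x : n.-tuple R => - tnth x j).
  by apply: measurableT_comp => //; exact: measurable_tnth.
by apply/funext => x /=; rewrite tnth_map.
Qed.

Lemma map_oppr_tuple_cons n (z : R * n.-tuple R) :
  map_tuple -%R (tuple_cons z) = tuple_cons (- z.1, map_tuple -%R z.2).
Proof. by apply/val_inj. Qed.

Lemma ge0_integral_map_oppr n (f : n.-tuple R -> \bar R) :
  measurable_fun setT f -> (forall x, (0 <= f x)%E) ->
  (\int[lam n]_x f (map_tuple -%R x) = \int[lam n]_x f x)%E.
Proof.
elim: n f => [|n IH] f mf f0.
  by apply: eq_integral => x _; congr f; apply/val_inj; rewrite /= (tuple0 x).
have mfN : measurable_fun setT (fun x : n.+1.-tuple R => f (map_tuple -%R x)).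
  exact: measurableT_comp mf (@measurable_map_oppr n.+1).
have mfc : measurable_fun [set: mR * n.-tuple R] (f \o @tuple_cons R n).
  by apply: measurableT_comp => //; exact: measurable_tuple_consR.
rewrite !ge0_integral_lebesgue_tupleS//.
transitivity (\int[mu]_u \int[lam n]_x f (tuple_cons ((- u)%R, x)))%E.
  apply: eq_integral => u _.
  under eq_integral do rewrite map_oppr_tuple_cons/=.
  rewrite (IH (fun x => f (tuple_cons ((- u)%R, x))))//.
  exact: measurableT_comp mfc (pair1_measurable _).
apply: (ge0_integral_oppr (f := fun u => \int[lam n]_x f (tuple_cons (u, x)))%E).
  apply: (measurable_fun_fubini_tonelli_F (m2 := lam n) (f \o @tuple_cons R n)) => // z; exact: f0.
by move=> u; apply: integral_ge0.
Qed.

Lemma integral_pairs_map_oppr1 n (f : n.-tuple R * n.-tuple R -> R) :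
  measurable_fun setT f ->
  \int[lam2 n]_z f (map_tuple -%R z.1, z.2) = \int[lam2 n]_z f z.
Proof.
have ge0 (g : n.-tuple R * n.-tuple R -> \bar R) : measurable_fun setT g ->
    (forall z, (0 <= g z)%E) ->
    (\int[lam2 n]_z g (map_tuple -%R z.1, z.2) = \int[lam2 n]_z g z)%E.
  move=> mg g0.
  have mgN : measurable_fun setT (fun z : n.-tuple R * n.-tuple R => g (map_tuple -%R z.1, z.2)).
    apply: measurableT_comp => //; apply: measurable_fun_pair => //.
    exact: measurableT_comp (@measurable_map_oppr n) measurable_fst.
  rewrite (fubini_tonelli1 (m1 := lam n) (m2 := lam n) (fun z => g (map_tuple -%R z.1, z.2)))//.
  rewrite (fubini_tonelli1 (m1 := lam n) (m2 := lam n) g)//.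
  apply: (ge0_integral_map_oppr (f := fubini_F (lam n) g)).
    exact: measurable_fun_fubini_tonelli_F.
  by move=> x; apply: integral_ge0.
move=> mf; have mf' : measurable_fun setT (EFin \o f) by apply/measurable_EFinP.
rewrite /Rintegral; congr fine; rewrite integralE [RHS]integralE.
congr (_ - _)%E.
- rewrite -[RHS]ge0; last 2 first.
  + exact: measurable_funepos.
  + by move=> z; exact: funepos_ge0.
  by apply: eq_integral => z _; rewrite !funeposE.
- rewrite -[RHS]ge0; last 2 first.
  + exact: measurable_funeneg.
  + by move=> z; exact: funeneg_ge0.
  by apply: eq_integral => z _; rewrite !funenegE.

Qed.

End symmetry.

Section Phi_at_i.
Context {R : realType} {n : nat}.
Variables F G : n.-tuple R -> R.
Hypotheses (mF : measurable_fun setT F) (mG : measurable_fun setT G).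
Local Notation lam2 := (@lebesgue_pairs R).
Local Open Scope complex_scope.

Lemma measurable_sgr : measurable_fun [set: R] (Num.sg : R -> R).
Proof.
rewrite (_ : Num.sg = fun x : R => \1_`]0, +oo[ x - \1_`]-oo, 0[ x).
  by apply: measurable_funB; exact: measurable_indic.
apply/funext => x; rewrite !indicE !mem_setE !in_itv/= andbT.
by have [x0|x0|->] := ltgtP x 0;
  rewrite ?sgr0 ?(ltr0_sg x0) ?(gtr0_sg x0) ?subr0 ?sub0r.
Qed.

Lemma enorm2 (x : n.-tuple R) : enorm x ^+ 2 = dotp x x.
Proof. by rewrite /enorm sqr_sqrtr// dotp_ge0. Qed.

Lemma dotp_oppl (x y : n.-tuple R) : dotp (map_tuple -%R x) y = - dotp x y.
Proof.
by rewrite /dotp -sumrN; apply: eq_bigr => j _; rewrite tnth_map mulNr.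
Qed.

Definition sgFG (z : n.-tuple R * n.-tuple R) : R := Num.sg (F z.1) * Num.sg (G z.2).

Lemma measurable_sgFG : measurable_fun setT sgFG.
Proof.
apply: measurable_funM.
  apply: measurableT_comp; first exact: measurable_sgr.
  exact: measurableT_comp mF measurable_fst.
apply: measurableT_comp; first exact: measurable_sgr.
exact: measurableT_comp mG measurable_snd.
Qed.

Lemma sgFG_le1 z : `|sgFG z| <= 1.
Proof.
rewrite /sgFG normrM !normr_sg -natrM mulnb lern1.
by case: (_ && _).
Qed.

Definition dotpp (z : n.-tuple R * n.-tuple R) : R := dotp z.1 z.2.

Lemma measurable_dotpp : measurable_fun setT dotpp.
Proof. exact: measurable_dotp. Qed.

Lemma integral_even_part0 : odd_function F ->
  \int[lam2 n]_z (sgFG z * expR (- (sqnorm_pair z / 4)) * cos (dotpp z / 2)) = 0.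
Proof.
move=> oF.
set f := fun z => _ * _ * _.
have mf : measurable_fun setT f.
  apply: measurable_funM.
    apply: measurable_funM; first exact: measurable_sgFG.
    apply: measurableT_comp => //; apply: measurableT_comp => //.
    by apply: measurable_funM => //; exact: measurable_sqnorm_pair.
  apply: measurableT_comp; first exact: continuous_measurable_fun (@continuous_cos _).
  by apply: measurable_funM => //; exact: measurable_dotpp.
have := integral_pairs_map_oppr1 mf.
have -> : (fun z => f (map_tuple -%R z.1, z.2)) = fun z => - f z.
  apply/funext => -[x y].
  have sqN : sqnorm_pair (map_tuple -%R x, y) = sqnorm_pair (x, y).
    rewrite {1}/sqnorm_pair; congr (_ + _).
    by apply: eq_bigr => j _; rewrite tnth_map mulrNN.
  have dN : dotpp (map_tuple -%R x, y) = - dotpp (x, y) by exact: dotp_oppl.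
  have sN : sgFG (map_tuple -%R x, y) = - sgFG (x, y).
    by rewrite /sgFG /= oF sgrN mulNr.
  by rewrite /f sqN dN sN (mulNr (dotpp _)) cosN !mulNr.
have -> : \int[lam2 n]_z (- f z) = - \int[lam2 n]_z f z.
  have sf : subexp (@sqnorm_pair R n) (fun z => sgFG z * cos (dotpp z / 2)).
    apply: subexpM.
      apply: subexp_bounded; [exact: sqnorm_pair_ge0|exact: measurable_sgFG|exact: sgFG_le1].
    apply: subexp_cos; first exact: sqnorm_pair_ge0.
    by apply: measurable_funM => //; exact: measurable_dotpp.
  have intf : (lam2 n).-integrable setT (EFin \o f).
    have := subexp_integrable_pairs sf (_ : 0 < 4^-1).
    rewrite invr_gt0 => /(_ (ltr0n _ 4)); apply: eq_integrable => // z _ /=.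
    by rewrite /f mulrAC [_ / 4]mulrC.
  under eq_Rintegral do rewrite -mulN1r.
  by rewrite RintegralZl// mulN1r.
lra.
Qed.

Lemma Phi_i_E : odd_function F ->
  Phi F G 'i%C / 'i%C =
   ((2 * pi * Num.sqrt 2) ^- n *
    \int[(lebesgue_tuple n \x lebesgue_tuple n)%E]_z
             (Num.sg (F z.1) * Num.sg (G z.2) *
              expR (- ((enorm z.1 ^+ 2 + enorm z.2 ^+ 2) / 4)) *
              sin (dotp z.1 z.2 / 2)))%:C.
Proof.
move=> oF; rewrite /Phi.
have i2 : 1 - 'i%C ^+ 2 = (2 : R)%:C by rewrite sqr_i opprK rmorph_nat.
rewrite i2 sqrtc_sqrtr; last by rewrite lecR.
have two : (2 : R[i]) = (2 : R)%:C by rewrite rmorph_nat.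
have -> : 2 * pi%:C * (Num.sqrt 2)%:C = (2 * pi * Num.sqrt 2 : R)%:C.
  by rewrite !rmorphM two.
rewrite -rmorphXn -fmorphV rmorphM -[LHS]mulrA; congr (_ * _).
pose I := \int[lam2 n]_z (sgFG z * expR (- (sqnorm_pair z / 4)) * sin (dotpp z / 2)).
have i0 : 'i%C != 0 :> R[i] by rewrite eq_complex/= oner_eq0 andbF.
apply: (mulIf i0). rewrite divfK//.
set f := fun z : n.-tuple R * n.-tuple R => _.
have fE z : f z = (sgFG z * expR (- (sqnorm_pair z / 4)) * cos (dotpp z / 2)) +i*
                  (sgFG z * expR (- (sqnorm_pair z / 4)) * sin (dotpp z / 2)).
  rewrite /f two; set S : R[i] := (_ * _)%:C.
  have -> : - (((enorm z.1 ^+ 2 + enorm z.2 ^+ 2)%:C -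
      (2 : R)%:C * 'i%C * (dotp z.1 z.2)%:C) / ((2 : R)%:C * (2 : R)%:C)) =
      (- (sqnorm_pair z / 4)) +i* (dotpp z / 2).
    rewrite !enorm2 -rmorphM -fmorphV; simpc.
    by congr (_ +i* _); rewrite /sqnorm_pair /dotpp; field.
  by rewrite /cexp /S /sgFG; simpc; rewrite !mulrA.
rewrite /Cintegral.
under eq_Rintegral do rewrite fE /=.
under [X in _ +i* X]eq_Rintegral do rewrite fE /=.
rewrite [X in X +i* _](integral_even_part0 oF).
simpc; congr (_ +i* _).
by apply: eq_Rintegral => z _; rewrite !enorm2.
Qed.

End Phi_at_i.

Section real_inequalities.
Context {R : realType}.
Implicit Types x y a b : R.

Lemma ge0_of_derive_ge0 (f df : R -> R) : (forall x, is_derive x 1 f (df x)) ->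
  (forall x, 0 <= x -> 0 <= df x) -> 0 <= f 0 -> forall x, 0 <= x -> 0 <= f x.
Proof.
move=> fdf df0 f0 x; rewrite le_eqVlt => /predU1P[<-//|x0].
have cf : {within `[0, x], continuous f}.
  apply: continuous_subspaceT => y.
  by apply: differentiable_continuous; apply/derivable1_diffP; case: (fdf y).
have [c + E] := MVT x0 (fun y _ => fdf y) cf.
rewrite in_itv/= => /andP[c0 _]; move: E => /eqP.
rewrite subr_eq subr0 => /eqP ->.
by rewrite addr_ge0// mulr_ge0 ?df0 ?ltW.
Qed.

Lemma sin_ub1 x : 0 <= x -> sin x <= x.
Proof.
move=> x0; rewrite -subr_ge0 -[_ - _]/((id - sin) x); move: x x0.
apply: (@ge0_of_derive_ge0 _ (fun x => 1 - cos x)).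
- by move=> y _; rewrite subr_ge0 cos_le1.
- by rewrite !fctE sin0 subrr.
Qed.

Lemma is_derive_scaleX c n x :
  is_derive x (1:R) (fun y : R => c * y ^+ n.+1) (c * n.+1%:R * x ^+ n).
Proof.
have -> : (fun y : R => c * y ^+ n.+1) = c \*: ((@id R : R^o -> R^o) ^+ n.+1).
  by apply/funext => y; rewrite !fctE.
apply: is_derive_eq.
by rewrite scaler1 /= /GRing.scale/= mulrA.
Qed.

Local Existing Instance is_derive_scaleX.

Lemma cos_lb2 x : 0 <= x -> 1 - 2^-1 * x ^+ 2 <= cos x.
Proof.
move=> x0; rewrite -subr_ge0.
have -> : cos x - (1 - 2^-1 * x ^+ 2) =
  ((cos - cst 1) + (fun y => 2^-1 * y ^+ 2)) x by rewrite !fctE; ring.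
move: x x0; apply: (@ge0_of_derive_ge0 _ (fun x => (- sin x - 0) + 2^-1 * 2%:R * x ^+ 1)).
- by move=> y y0; rewrite subr0 mulVf// mul1r expr1 addrC subr_ge0 sin_ub1.
- by rewrite !fctE cos0 expr0n/= mulr0; lra.
Qed.

Lemma sin_lb3 x : 0 <= x -> x - 6^-1 * x ^+ 3 <= sin x.
Proof.
move=> x0; rewrite -subr_ge0.
have -> : sin x - (x - 6^-1 * x ^+ 3) =
  ((sin - id) + (fun y => 6^-1 * y ^+ 3)) x by rewrite !fctE; ring.
move: x x0; apply: (@ge0_of_derive_ge0 _ (fun x => (cos x - 1) + 6^-1 * 3%:R * x ^+ 2)).
- by move=> y y0; have := cos_lb2 y0; lra.
- by rewrite !fctE sin0 expr0n/= mulr0; lra.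
Qed.

Lemma cos_ub4 x : 0 <= x -> cos x <= 1 - 2^-1 * x ^+ 2 + 24^-1 * x ^+ 4.
Proof.
move=> x0; rewrite -subr_ge0.
have -> : 1 - 2^-1 * x ^+ 2 + 24^-1 * x ^+ 4 - cos x =
  ((cst 1 - cos) - (fun y => 2^-1 * y ^+ 2) + (fun y => 24^-1 * y ^+ 4)) x.
  by rewrite !fctE; ring.
move: x x0; apply: (@ge0_of_derive_ge0 _ (fun x =>
  ((0 - - sin x) - (2^-1 * 2%:R * x ^+ 1)) + 24^-1 * 4%:R * x ^+ 3)).
- by move=> y y0; have := sin_lb3 y0; lra.
- by rewrite !fctE cos0 !expr0n/= !mulr0; lra.
Qed.

Lemma sin_ub5 x : 0 <= x -> sin x <= x - 6^-1 * x ^+ 3 + 120^-1 * x ^+ 5.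
Proof.
move=> x0; rewrite -subr_ge0.
have -> : x - 6^-1 * x ^+ 3 + 120^-1 * x ^+ 5 - sin x =
  ((id - sin) - (fun y => 6^-1 * y ^+ 3) + (fun y => 120^-1 * y ^+ 5)) x.
  by rewrite !fctE; ring.
move: x x0; apply: (@ge0_of_derive_ge0 _ (fun x =>
  ((1 - cos x) - (6^-1 * 3%:R * x ^+ 2)) + 120^-1 * 5%:R * x ^+ 4)).
- by move=> y y0; have := cos_ub4 y0; lra.
- by rewrite !fctE sin0 !expr0n/= !mulr0; lra.
Qed.

Lemma expRN_ub2 x : 0 <= x -> expR (- x) <= 1 - x + 2^-1 * x ^+ 2.
Proof.
move=> x0; rewrite -subr_ge0.
have -> : 1 - x + 2^-1 * x ^+ 2 - expR (- x) =
  ((cst 1 - id) + (fun y => 2^-1 * y ^+ 2) - (expR \o -%R)) x by rewrite !fctE.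
move: x x0; apply: (@ge0_of_derive_ge0 _ (fun x =>
  ((0 - 1) + (2^-1 * 2%:R * x ^+ 1)) - (expR (- x) * (- 1)))).
- by move=> y y0; have := expR_ge1Dx (- y); lra.
- by rewrite !fctE /= oppr0 expR0 expr0n/= mulr0; lra.
Qed.

Lemma normr_expR_sub1 a : `|expR a - 1| <= `|a| * expR `|a|.
Proof.
have [a0|a0] := leP 0 a.
  rewrite (ger0_norm a0) ger0_norm ?subr_ge0 -?expR0 ?ler_expR// expR0.
  have h1 := expR_ge1Dx (- a); have h2 := expR_gt0 a.
  have := expRD a (- a); rewrite subrr expR0; nra.
rewrite (ltr0_norm a0) ltr0_norm ?subr_lt0 -?expR0 ?ltr_expR// expR0 opprB.
have := expR_ge1Dx a; have := expR_ge1Dx (- a); nra.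
Qed.

Lemma normr_expR_sub1D a : `|expR a - 1 - a| <= a ^+ 2 * expR `|a|.
Proof.
have [a0|a0] := leP 0 a.
  rewrite (ger0_norm a0) ger0_norm; last by have := expR_ge1Dx a; lra.
  have := normr_expR_sub1 a; rewrite (ger0_norm a0) ger0_norm; last first.
    by rewrite subr_ge0 -expR0 ler_expR.
  have := expR_ge1Dx (- a); have := expR_gt0 a.
  have := expRD a (- a); rewrite subrr expR0; nra.
rewrite ger0_norm; last by have := expR_ge1Dx a; lra.
have aN : 0 <= - a by lra.
have := expRN_ub2 aN; rewrite opprK sqrrN => h.
have : 1 <= expR `|a| by rewrite -expR0 ler_expR.
have := sqr_ge0 a; nra.
Qed.

Lemma normr_expRN_sub1D x : 0 <= x -> `|expR (- x) - 1 + x| <= 2^-1 * x ^+ 2.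
Proof.
move=> x0; rewrite ger0_norm; last by have := expR_ge1Dx (- x); lra.
by have := expRN_ub2 x0; lra.
Qed.

Lemma normr_sin_le a : `|sin a| <= `|a|.
Proof.
wlog a0 : a / 0 <= a.
  move=> h; have [/h//|a0] := leP 0 a.
  by rewrite -normrN -sinN -[X in _ <= X]normrN h// oppr_ge0 ltW.
rewrite [X in _ <= X]ger0_norm// ler_norml sin_ub1// andbT.
have [a1|a1] := leP a 1; last by have := sin_geN1 a; lra.
have := sin_lb3 a0; rewrite -[a ^+ 3]/(a * (a * a)) => h.
have h2 : a * a <= 1 by nra.
nra.
Qed.

Lemma normr_cos_sub1 a : `|cos a - 1| <= 2^-1 * a ^+ 2.
Proof.
wlog a0 : a / 0 <= a.
  move=> h; have [/h//|a0] := leP 0 a.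
  by rewrite -cosN -sqrrN h// oppr_ge0 ltW.
rewrite ler0_norm; last by rewrite subr_le0 cos_le1.
have := cos_lb2 a0; lra.
Qed.

Lemma normr_sin_sub a : `|sin a - a| <= 6^-1 * `|a| ^+ 3.
Proof.
wlog a0 : a / 0 <= a.
  move=> h; have [/h//|a0] := leP 0 a.
  have -> : sin a - a = - (sin (- a) - - a) by rewrite sinN; lra.
  by rewrite normrN -[`|a|]normrN; apply: h; lra.
rewrite ler0_norm; last by rewrite subr_le0 sin_ub1.
rewrite ger0_norm//; have := sin_lb3 a0; lra.
Qed.

Lemma normr_sin_sub2 a : `|sin a - a| <= a ^+ 2.
Proof.
have [a1|a1] := leP `|a| 2.
  apply: le_trans (normr_sin_sub a) _; rewrite -[a ^+ 2]real_normK ?num_real//.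
  have := normr_ge0 a; nra.
apply: le_trans (ler_normB _ _) _; have := normr_sin_le a.
have := sin_le1 a; have := sin_geN1 a => h1 h2 h3.
have h4 : `|sin a| <= 1 by rewrite ler_norml h1 h2.
rewrite -[a ^+ 2]real_normK ?num_real//; nra.
Qed.

End real_inequalities.

Section complex_facts.
Context {R : realType}.
Local Open Scope complex_scope.
Local Notation nc := (@Normc.normc R).
Implicit Types z w d h : R[i].

Lemma normc_ge0 z : 0 <= nc z.
Proof. by case: z => a b; exact: sqrtr_ge0. Qed.

Lemma normr_Re_le z : `|complex.Re z| <= nc z.
Proof. by case: z => a b /=; rewrite -sqrtr_sqr ler_sqrt ?lerDl ?addr_ge0 ?sqr_ge0. Qed.

Lemma normr_Im_le z : `|complex.Im z| <= nc z.
Proof. by case: z => a b /=; rewrite -sqrtr_sqr ler_sqrt ?lerDr ?addr_ge0 ?sqr_ge0. Qed.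

Lemma normc_sqr z : nc z ^+ 2 = complex.Re z ^+ 2 + complex.Im z ^+ 2.
Proof. by case: z => a b /=; rewrite sqr_sqrtr// addr_ge0 ?sqr_ge0. Qed.

Lemma normc_le_ReIm z : nc z <= `|complex.Re z| + `|complex.Im z|.
Proof.
rewrite -(@ler_pXn2r _ 2) ?nnegrE ?normc_ge0 ?addr_ge0//.
rewrite normc_sqr; move: (complex.Re z) (complex.Im z) => a b.
have a2 : `|a| ^+ 2 = a ^+ 2 by rewrite real_normK ?num_real.
have b2 : `|b| ^+ 2 = b ^+ 2 by rewrite real_normK ?num_real.
have := mulr_ge0 (normr_ge0 a) (normr_ge0 b); nra.
Qed.

Lemma normc_real (x : R) : nc x%:C = `|x|.
Proof. by rewrite /= expr0n/= addr0 sqrtr_sqr. Qed.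

Lemma normc_gt0 z : (0 < nc z) = (z != 0).
Proof.
rewrite lt0r normc_ge0 andbT; congr (~~ _); apply/eqP/eqP => [|->].
  exact: Normc.eq0_normc.
by rewrite Normc.normc0.
Qed.

Lemma normc_cexp z : nc (cexp z) = expR (complex.Re z).
Proof.
rewrite /cexp Normc.normcM normc_real ger0_norm ?expR_ge0// /=.
by rewrite cos2Dsin2 sqrtr1 mulr1.
Qed.

Lemma cexpD z w : cexp (z + w) = cexp z * cexp w.
Proof.
case: z w => a b [c d]; rewrite /cexp; simpc => /=.
rewrite expRD sinD cosD; congr (_ +i* _); ring.
Qed.

Lemma cexp_sub1D d : nc (cexp d - 1 - d) <= 3 * nc d ^+ 2 * expR (nc d).
Proof.
apply: (le_trans (normc_le_ReIm _)).
set r := nc d; set E := expR r.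
have r0 : 0 <= r := normc_ge0 d.
have E1 : 1 <= E by rewrite -expR0 ler_expR.
have : nc d ^+ 2 = complex.Re d ^+ 2 + complex.Im d ^+ 2 := normc_sqr d.
have := normr_Re_le d; have := normr_Im_le d; rewrite -/r.
have -> : complex.Re (cexp d - 1 - d) =
    expR (complex.Re d) * cos (complex.Im d) - 1 - complex.Re d.
  by case: d @r @E r0 E1 => a b ? ? ? ?; rewrite /cexp; simpc.
have -> : complex.Im (cexp d - 1 - d) =
    expR (complex.Re d) * sin (complex.Im d) - complex.Im d.
  by case: d @r @E r0 E1 => a b ? ? ? ?; rewrite /cexp; simpc.
move: (complex.Re d) (complex.Im d) => a b bd ad r2.
have Ea : expR `|a| <= E by rewrite ler_expR.
have a2 : `|a| ^+ 2 = a ^+ 2 by rewrite real_normK ?num_real.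
have b2 : `|b| ^+ 2 = b ^+ 2 by rewrite real_normK ?num_real.
have aE : 1 + `|a| <= E by exact: le_trans (expR_ge1Dx _) Ea.
have h1 : `|expR a * cos b - 1 - a| <= r ^+ 2 * E.
  have -> : expR a * cos b - 1 - a = (expR a - 1 - a) * cos b + (1 + a) * (cos b - 1) by ring.
  apply: le_trans (ler_normD _ _) _; rewrite !normrM.
  have c1 : `|cos b| <= 1 by rewrite ler_norml cos_geN1 cos_le1.
  have k1 : `|expR a - 1 - a| * `|cos b| <= a ^+ 2 * E * 1.
    apply: ler_pM => //; apply: le_trans (normr_expR_sub1D a) _.
    by rewrite ler_wpM2l ?sqr_ge0.
  have k2 : `|1 + a| * `|cos b - 1| <= E * (2^-1 * b ^+ 2).
    apply: ler_pM => //; last exact: normr_cos_sub1.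
    by apply: le_trans (ler_normD _ _) _; rewrite normr1.
  have := sqr_ge0 b; have := sqr_ge0 a; rewrite r2; nra.
have h2 : `|expR a * sin b - b| <= 2 * r ^+ 2 * E.
  have -> : expR a * sin b - b = (expR a - 1) * sin b + (sin b - b) by ring.
  apply: le_trans (ler_normD _ _) _; rewrite normrM.
  have k1 : `|expR a - 1| * `|sin b| <= `|a| * E * `|b|.
    apply: ler_pM => //; last exact: normr_sin_le.
    by apply: le_trans (normr_expR_sub1 a) _; rewrite ler_wpM2l.
  have k2 : `|sin b - b| <= b ^+ 2 * E.
    by apply: le_trans (normr_sin_sub2 b) _; rewrite ler_peMr ?sqr_ge0.
  have k3 : `|a| * `|b| <= r ^+ 2.
    by rewrite expr2 ler_pM.
  have k4 : b ^+ 2 <= r ^+ 2 by rewrite r2 lerDr sqr_ge0.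
  have k5 : `|a| * E * `|b| <= r ^+ 2 * E.
    by rewrite mulrAC ler_wpM2r// (le_trans _ E1).
  have k6 : b ^+ 2 * E <= r ^+ 2 * E.
    by rewrite ler_wpM2r// (le_trans _ E1).
  lra.
lra.
Qed.

Lemma derivable_of_quadratic_bound (f : R[i] -> R[i]) t D (K rho : R) : 0 < rho ->
  (forall h, nc h < rho -> nc (f (t + h) - f t - h * D) <= K * nc h ^+ 2) ->
  derivable (f : R[i]^o -> R[i]^o) t 1.
Proof.
move=> rho0 fK; apply/cvg_ex; exists D; apply/cvgrPdist_le => /= e.
case: e => e e'; rewrite ltcE/= => /andP[/eqP -> e0].
pose K1 := `|K| + 1.
have K10 : 0 < K1 by rewrite ltr_wpDl.
exists (Num.min rho (e / K1))%:C => /=.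
  by rewrite ltcR lt_min rho0 divr_gt0.
move=> h; rewrite /ball_/= sub0r normrN => hr h0.
have {}hr : nc h < Num.min rho (e / K1) by rewrite -ltcR.
move: hr; rewrite lt_min => /andP[h1 h2].
have nh0 : 0 < nc h by rewrite normc_gt0.
suff : nc (D - h^-1 * (f (h * 1 + t) - f t)) <= e by rewrite -lecR.
have -> : D - h^-1 * (f (h * 1 + t) - f t) = - (h^-1 * (f (t + h) - f t - h * D)).
  by rewrite mulr1 [h + t]addrC; field.
rewrite normcN Normc.normcM Normc.normcV.
rewrite ler_pdivrMl//; apply: le_trans (fK _ h1) _.
rewrite expr2 mulrA [leRHS]mulrC ler_wpM2r ?normc_ge0//.
apply: (@le_trans _ _ (K1 * nc h)).
  rewrite ler_wpM2r ?normc_ge0// /K1; have := ler_norm K; lra.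
by rewrite mulrC -ler_pdivlMr// ltW.
Qed.

End complex_facts.

Section derivable_sqrtc.
Context {R : realType}.
Local Open Scope complex_scope.
Local Notation nc := (@Normc.normc R).
Implicit Types t : R[i].

Lemma Re_sqrtc_ge0 (z : R[i]) : 0 <= complex.Re (sqrtc z).
Proof. by case: z => a b; exact: sqrtr_ge0. Qed.

Lemma Re_sqrtc_gt0 t : `|complex.Re t| < 1 -> 0 < complex.Re (sqrtc (1 - t ^+ 2)).
Proof.
move=> t1; rewrite lt0r Re_sqrtc_ge0 andbT; apply/negP => /eqP s0.
have := sqr_sqrtc (1 - t ^+ 2); move: s0.
case: (sqrtc _) => a b /= ->; case: t t1 => x y /= x1.
rewrite !expr2; simpc => -[] E1 E2.
have xy : x * y = 0 by lra.
have x2 : x * x < 1.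
  by rewrite -expr2 -real_normK ?num_real// expr_lt1.
have := sqr_ge0 b; rewrite expr2 => b2.
have y2 : 0 <= y * y by rewrite -expr2 sqr_ge0.
have [x0|] := eqVneq x 0; first by rewrite x0 in E1 *; nra.
by move=> xN0; have y0 : y = 0 by [apply: (mulfI xN0); rewrite mulr0|]; rewrite y0 in E1; nra.
Qed.

Lemma oneD_neq0 t : `|complex.Re t| < 1 -> 1 + t != 0.
Proof.
case: t => x y /=; rewrite ltr_norml => /andP[x1 x2]; apply/negP => /eqP[] h _; lra.
Qed.

Lemma oneB_neq0 t : `|complex.Re t| < 1 -> 1 - t != 0.
Proof.
case: t => x y /=; rewrite ltr_norml => /andP[x1 x2]; apply/negP => /eqP[] h _; lra.
Qed.

Lemma derivable_sqrtc_oneBsqr t : `|complex.Re t| < 1 ->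
  derivable ((fun t => sqrtc (1 - t ^+ 2)) : R[i]^o -> R[i]^o) t 1.
Proof.
move=> t1; set r := fun t => _.
pose s := r t; pose rho := complex.Re s.
have rho0 : 0 < rho by exact: Re_sqrtc_gt0.
have s0 : 0 < nc s.
  by apply: lt_le_trans rho0 _; apply: le_trans (normr_Re_le _); exact: ler_norm.
have sN0 : s != 0 by rewrite -normc_gt0.
apply: (@derivable_of_quadratic_bound _ _ _ (- t / s)
  ((nc t * ((2 * nc t + 1) / rho) + nc s) / (nc s * rho)) 1) => // h h1.
pose s' := r (t + h).
have ss' : s' ^+ 2 - s ^+ 2 = - h * (2 * t + h).
  by rewrite /s' /s /r !sqr_sqrtc; ring.
have rs : rho <= nc (s' + s).
  apply: le_trans (normr_Re_le _); apply: le_trans (ler_norm _).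
  rewrite /rho; have : 0 <= complex.Re s' by exact: Re_sqrtc_ge0.
  by case: (s') (s) => a b [c d] /= ?; rewrite lerDr.
have ssN0 : s' + s != 0 by rewrite -normc_gt0 (lt_le_trans rho0).
have dE : s' - s = - h * (2 * t + h) / (s' + s).
  by apply: (mulIf ssN0); rewrite divfK// -ss'; ring.
have dn : nc (s' - s) <= nc h * ((2 * nc t + 1) / rho).
  rewrite dE !Normc.normcM Normc.normcV normcN -mulrA ler_wpM2l ?normc_ge0//.
  apply: ler_pM => //; rewrite ?normc_ge0 ?invr_ge0 ?normc_ge0//.
    apply: le_trans (le_normcD _ _) _; apply: lerD; last exact: ltW.
    by rewrite Normc.normcM -[X in nc X * _]/(2%:R) -(rmorph_nat (real_complex R)) normc_real ger0_norm.
  by rewrite lef_pV2// posrE (lt_le_trans rho0).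
have -> : r (t + h) - r t - h * (- t / s) = h * (t * (s' - s) - h * s) / (s * (s' + s)).
  rewrite -/s -/s'; have ssss : s * (s' + s) != 0 by rewrite mulf_neq0.
  apply: (mulIf ssss); rewrite divfK//.
  have key : (s' - s) * (s' + s) = - h * (2 * t + h) by rewrite -ss'; ring.
  have -> : (s' - s - h * (- t / s)) * (s * (s' + s)) =
    s * ((s' - s) * (s' + s)) + h * t * (s' + s) by field.
  by rewrite key; ring.
rewrite !Normc.normcM Normc.normcV Normc.normcM.
rewrite ler_pdivrMr; last by rewrite mulr_gt0// (lt_le_trans rho0).
apply: (@le_trans _ _ (nc h * (nc t * (nc h * ((2 * nc t + 1) / rho)) + nc h * nc s))).
  rewrite ler_wpM2l ?normc_ge0//; apply: le_trans (le_normcD _ _) _.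
  rewrite normcN !Normc.normcM lerD2r ler_wpM2l ?normc_ge0//.
have := ler_wpM2l (ltW s0) rs.
set X := nc t * ((2 * nc t + 1) / rho) + nc s.
set Z := nc s * nc (s' + s); set Y := nc s * rho; set B := nc h => YZ.
have Y0 : 0 < Y by rewrite mulr_gt0.
have X0 : 0 <= X.
  rewrite addr_ge0 ?normc_ge0// mulr_ge0 ?normc_ge0// divr_ge0 ?ltW//.
  by have := normc_ge0 t; lra.
have -> : B * (nc t * (B * ((2 * nc t + 1) / rho)) + B * nc s) = B ^+ 2 * X.
  by rewrite /X; ring.
have -> : X / Y * B ^+ 2 * Z = B ^+ 2 * X * (Z / Y) by ring.
apply: ler_peMr; first by rewrite mulr_ge0 ?sqr_ge0.
by rewrite ler_pdivlMr// mul1r.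
Qed.

End derivable_sqrtc.

Section complex_measurable.
Context {R : realType} d (T : measurableType d).
Local Open Scope complex_scope.
Implicit Types f g : T -> R[i].

Definition cmeas f := measurable_fun setT (fun x => complex.Re (f x)) /\
  measurable_fun setT (fun x => complex.Im (f x)).

Lemma cmeas_cst c : cmeas (fun=> c).
Proof. by split. Qed.

Lemma cmeas_real (g : T -> R) : measurable_fun setT g -> cmeas (fun x => (g x)%:C).
Proof. by split. Qed.

Lemma complexReM (z w : R[i]) :
  complex.Re (z * w) = complex.Re z * complex.Re w - complex.Im z * complex.Im w.
Proof. by case: z w => ? ? []. Qed.

Lemma complexImM (z w : R[i]) :
  complex.Im (z * w) = complex.Re z * complex.Im w + complex.Im z * complex.Re w.
Proof. by case: z w => ? ? []. Qed.

Lemma complexReD (z w : R[i]) : complex.Re (z + w) = complex.Re z + complex.Re w.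
Proof. by case: z w => ? ? []. Qed.

Lemma complexImD (z w : R[i]) : complex.Im (z + w) = complex.Im z + complex.Im w.
Proof. by case: z w => ? ? []. Qed.

Lemma complexReN (z : R[i]) : complex.Re (- z) = - complex.Re z.
Proof. by case: z. Qed.

Lemma complexImN (z : R[i]) : complex.Im (- z) = - complex.Im z.
Proof. by case: z. Qed.

Lemma Re_cexp (z : R[i]) : complex.Re (cexp z) = expR (complex.Re z) * cos (complex.Im z).
Proof. by rewrite /cexp complexReM/= mul0r subr0. Qed.

Lemma Im_cexp (z : R[i]) : complex.Im (cexp z) = expR (complex.Re z) * sin (complex.Im z).
Proof. by rewrite /cexp complexImM/= mul0r addr0. Qed.

Lemma cmeasD f g : cmeas f -> cmeas g -> cmeas (fun x => f x + g x).
Proof.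
move=> [mf mf'] [mg mg']; split.
  under eq_fun do rewrite complexReD.
  exact: measurable_funD.
under eq_fun do rewrite complexImD.
exact: measurable_funD.
Qed.

Lemma cmeasM f g : cmeas f -> cmeas g -> cmeas (fun x => f x * g x).
Proof.
move=> [mf mf'] [mg mg']; split.
  under eq_fun do rewrite complexReM.
  by apply: measurable_funB; exact: measurable_funM.
under eq_fun do rewrite complexImM.
  by apply: measurable_funD; exact: measurable_funM.
Qed.

Lemma cmeasN f : cmeas f -> cmeas (fun x => - f x).
Proof.
move=> [mf mf']; split.
  under eq_fun do rewrite complexReN.
  by exact: measurableT_comp.
under eq_fun do rewrite complexImN.
  by exact: measurableT_comp.
Qed.

Lemma cmeas_cexp f : cmeas f -> cmeas (fun x => cexp (f x)).
Proof.
move=> [mf mf']; split.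
  under eq_fun do rewrite Re_cexp.
  apply: measurable_funM.
    exact: measurableT_comp.
  by apply: measurableT_comp mf'; exact: continuous_measurable_fun (@continuous_cos _).
under eq_fun do rewrite Im_cexp.
apply: measurable_funM.
  exact: measurableT_comp.
by apply: measurableT_comp mf'; exact: continuous_measurable_fun (@continuous_sin _).
Qed.

Variable m : {measure set T -> \bar R}.

Definition cint f := m.-integrable setT (EFin \o (fun x => complex.Re (f x))) /\
  m.-integrable setT (EFin \o (fun x => complex.Im (f x))).

Lemma cint_dominated f (b : T -> R) : cmeas f ->
  m.-integrable setT (EFin \o b) -> (forall x, Normc.normc (f x) <= b x) -> cint f.
Proof.
move=> [mf mf'] ib fb; split.
  apply: (le_integrable measurableT _ _ ib); first exact/measurable_EFinP.
  move=> x _ /=; rewrite lee_fin; apply: le_trans (normr_Re_le _) _.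
  exact: le_trans (fb x) (ler_norm _).
apply: (le_integrable measurableT _ _ ib); first exact/measurable_EFinP.
move=> x _ /=; rewrite lee_fin; apply: le_trans (normr_Im_le _) _.
exact: le_trans (fb x) (ler_norm _).
Qed.

Lemma normc_Cintegral_le f (b : T -> R) : cint f ->
  m.-integrable setT (EFin \o b) -> (forall x, Normc.normc (f x) <= b x) ->
  Normc.normc (Cintegral m f) <= 2 * \int[m]_x b x.
Proof.
move=> [iR iI] ib fb; apply: le_trans (normc_le_ReIm _) _; rewrite /Cintegral/=.
rewrite mulr_natl mulr2n; apply: lerD.
  apply: le_trans (le_normr_Rintegral measurableT iR) _.
  apply: le_Rintegral => //; first exact: integrable_norm iR.
  by move=> x _; apply: le_trans (normr_Re_le _) (fb x).
apply: le_trans (le_normr_Rintegral measurableT iI) _.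
apply: le_Rintegral => //; first exact: integrable_norm iI.
by move=> x _; apply: le_trans (normr_Im_le _) (fb x).
Qed.

Lemma CintegralB f g : cint f -> cint g ->
  Cintegral m (fun x => f x - g x) = Cintegral m f - Cintegral m g.
Proof.
move=> [f1 f2] [g1 g2]; rewrite /Cintegral; simpc; congr (_ +i* _).
  by rewrite -RintegralB//; apply: eq_Rintegral => x _; rewrite complexReD complexReN.
by rewrite -RintegralB//; apply: eq_Rintegral => x _; rewrite complexImD complexImN.
Qed.

Lemma cintB f g : cint f -> cint g -> cint (fun x => f x - g x).
Proof.
move=> [f1 f2] [g1 g2]; split.
  have := integrableB measurableT f1 g1; apply: eq_integrable => // x _ /=.
  by rewrite complexReD complexReN EFinB.
have := integrableB measurableT f2 g2; apply: eq_integrable => // x _ /=.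
by rewrite complexImD complexImN EFinB.
Qed.

Lemma CintegralZl c f : cint f ->
  Cintegral m (fun x => c * f x) = c * Cintegral m f.
Proof.
case: c => c1 c2 [f1 f2]; rewrite /Cintegral; simpc.
have intZ (k : R) (g : T -> R) : m.-integrable setT (EFin \o g) ->
    m.-integrable setT (EFin \o (fun x => k * g x)).
  by move=> ig; have := integrableZl measurableT k ig; apply: eq_integrable.
congr (_ +i* _).
  rewrite -!RintegralZl// -RintegralB//; [|exact: intZ..].
  by apply: eq_Rintegral => x _; rewrite complexReM.
rewrite -!RintegralZl// -RintegralD//; [|exact: intZ..].
by apply: eq_Rintegral => x _; rewrite complexImM.
Qed.

End complex_measurable.

Section Phi_holomorphic.
Context {R : realType} {n : nat}.
Local Open Scope complex_scope.
Local Notation nc := (@Normc.normc R).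
Local Notation lam2 := (@lebesgue_pairs R).
Local Notation Q := (@sqnorm_pair R n).
Local Notation B := (@dotpp R n).
Variable s : n.-tuple R * n.-tuple R -> R.
Hypotheses (ms : measurable_fun setT s) (s1 : forall z, `|s z| <= 1).

(* |x + y|^2 / 4 and |x - y|^2 / 4: in these coordinates the exponent is linear
   in 1 / (1 + t) and 1 / (1 - t), whose real parts are positive on the strip. *)
Definition sumsq (z : n.-tuple R * n.-tuple R) : R := (Q z + 2 * B z) / 4.
Definition diffsq (z : n.-tuple R * n.-tuple R) : R := (Q z - 2 * B z) / 4.

Lemma sumsq_ge0 z : 0 <= sumsq z.
Proof.
rewrite divr_ge0// /sqnorm_pair /dotpp /dotp mulr_sumr -!big_split/=.
by apply: sumr_ge0 => j _; have := sqr_ge0 (tnth z.1 j + tnth z.2 j); rewrite !expr2; lra.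
Qed.

Lemma diffsq_ge0 z : 0 <= diffsq z.
Proof.
rewrite divr_ge0// /sqnorm_pair /dotpp /dotp mulr_sumr -sumrN -!big_split/=.
by apply: sumr_ge0 => j _; have := sqr_ge0 (tnth z.1 j - tnth z.2 j); rewrite !expr2; lra.
Qed.

Lemma sumsqDdiffsq z : sumsq z + diffsq z = Q z / 2.
Proof. by rewrite /sumsq /diffsq; field. Qed.

Lemma sumsq_le z : sumsq z <= Q z.
Proof. have := sumsqDdiffsq z; have := diffsq_ge0 z; have := sqnorm_pair_ge0 z; lra. Qed.

Lemma diffsq_le z : diffsq z <= Q z.
Proof. have := sumsqDdiffsq z; have := sumsq_ge0 z; have := sqnorm_pair_ge0 z; lra. Qed.

Lemma measurable_sumsq : measurable_fun setT sumsq.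
Proof.
apply: measurable_funM => //; apply: measurable_funD; first exact: measurable_sqnorm_pair.
by apply: measurable_funM => //; exact: measurable_dotpp.
Qed.

Lemma measurable_diffsq : measurable_fun setT diffsq.
Proof.
apply: measurable_funM => //; apply: measurable_funB; first exact: measurable_sqnorm_pair.
by apply: measurable_funM => //; exact: measurable_dotpp.
Qed.

Definition phase (al be : R[i]) z := - (al * (sumsq z)%:C + be * (diffsq z)%:C).
Definition kern (al be : R[i]) z := (s z)%:C * cexp (phase al be z).

Lemma cmeas_phase al be : cmeas (phase al be).
Proof.
apply: cmeasN; apply: cmeasD; apply: cmeasM; try exact: cmeas_cst;
  apply: cmeas_real; [exact: measurable_sumsq|exact: measurable_diffsq].
Qed.

Lemma cmeas_kern al be : cmeas (kern al be).
Proof.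
apply: cmeasM; first exact: cmeas_real.
apply: cmeas_cexp; exact: cmeas_phase.
Qed.

Lemma normc_kern_le al be (e : R) z : e <= complex.Re al -> e <= complex.Re be ->
  nc (cexp (phase al be z)) <= expR (- (e / 2 * Q z)).
Proof.
move=> ea eb; rewrite normc_cexp ler_expR /phase complexReN complexReD !complexReM/= !mulr0 !subr0.
rewrite lerN2.
have h1 := ler_wpM2r (sumsq_ge0 z) ea; have h2 := ler_wpM2r (diffsq_ge0 z) eb.
have := sumsqDdiffsq z => h3.
have -> : e / 2 * Q z = e * (sumsq z + diffsq z) by rewrite h3; field.
by rewrite mulrDr lerD.
Qed.

Lemma normc_kern_le1 al be (e : R) z : e <= complex.Re al -> e <= complex.Re be ->
  nc (kern al be z) <= expR (- (e / 2 * Q z)).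
Proof.
move=> ea eb; rewrite /kern Normc.normcM normc_real -[leRHS]mul1r.
by apply: ler_pM; rewrite ?normc_ge0//; exact: normc_kern_le.
Qed.

Lemma subexpQ : subexp Q Q.
Proof. by apply: subexp_self; [exact: sqnorm_pair_ge0|exact: measurable_sqnorm_pair]. Qed.

Lemma cint_kern al be : 0 < complex.Re al -> 0 < complex.Re be -> cint (lam2 n) (kern al be).
Proof.
move=> a0 b0; pose e := Num.min (complex.Re al) (complex.Re be).
have e0 : 0 < e / 2 by rewrite divr_gt0// lt_min a0.
apply: (@cint_dominated _ _ _ _ _ (fun z => 1 * expR (- (e / 2 * Q z)))).
- exact: cmeas_kern.
- apply: subexp_integrable_pairs => //; apply: subexp_cst; exact: sqnorm_pair_ge0.
- by move=> z; rewrite mul1r; apply: normc_kern_le1; rewrite ge_min lexx ?orbT.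
Qed.

Lemma normc_lin_le (a b : R[i]) z :
  nc (a * (sumsq z)%:C + b * (diffsq z)%:C) <= (nc a + nc b) * Q z.
Proof.
apply: le_trans (le_normcD _ _) _; rewrite mulrDl; apply: lerD;
  rewrite Normc.normcM normc_real ler_wpM2l ?normc_ge0// ger0_norm.
- exact: sumsq_le.
- exact: sumsq_ge0.
- exact: diffsq_le.
- exact: diffsq_ge0.
Qed.

Lemma cint_lin_kern (a b al be : R[i]) : 0 < complex.Re al -> 0 < complex.Re be ->
  cint (lam2 n) (fun z => (a * (sumsq z)%:C + b * (diffsq z)%:C) * kern al be z).
Proof.
move=> a0 b0; pose e := Num.min (complex.Re al) (complex.Re be).
have e0 : 0 < e / 2 by rewrite divr_gt0// lt_min a0.
apply: (@cint_dominated _ _ _ _ _ (fun z => (nc a + nc b) * Q z * expR (- (e / 2 * Q z)))).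
- apply: cmeasM; last exact: cmeas_kern.
  apply: cmeasD; apply: cmeasM; try exact: cmeas_cst;
    apply: cmeas_real; [exact: measurable_sumsq|exact: measurable_diffsq].
- apply: subexp_integrable_pairs => //; apply: subexpZ; first exact: sqnorm_pair_ge0.
  exact: subexpQ.
- move=> z; rewrite Normc.normcM; apply: ler_pM; rewrite ?normc_ge0//.
    exact: normc_lin_le.
  by apply: normc_kern_le1; rewrite ge_min lexx ?orbT.
Qed.

Definition alp (t : R[i]) := (1 + t)^-1.
Definition bet (t : R[i]) := (1 - t)^-1.

Lemma Re_inv_gt0 (z : R[i]) : 0 < complex.Re z -> 0 < complex.Re z^-1.
Proof.
case: z => x y /= x0.
rewrite divr_gt0//; have := sqr_ge0 y; have : 0 < x ^+ 2 by rewrite exprn_gt0.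
lra.
Qed.

Lemma Re_alp_gt0 t : `|complex.Re t| < 1 -> 0 < complex.Re (alp t).
Proof.
rewrite ltr_norml => /andP[t1 t2]; apply: Re_inv_gt0; rewrite complexReD/=; lra.
Qed.

Lemma Re_bet_gt0 t : `|complex.Re t| < 1 -> 0 < complex.Re (bet t).
Proof.
rewrite ltr_norml => /andP[t1 t2]; apply: Re_inv_gt0; rewrite complexReD complexReN/=; lra.
Qed.

Lemma inv_expansion (w h : R[i]) : w != 0 -> nc h < nc w / 2 ->
  [/\ w + h != 0, nc ((w + h)^-1 - w^-1) <= 2 * nc w^-1 ^+ 2 * nc h &
   nc ((w + h)^-1 - w^-1 + h * w^-1 ^+ 2) <= 2 * nc w^-1 ^+ 3 * nc h ^+ 2].
Proof.
move=> w0 hw.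
have nw0 : 0 < nc w by rewrite normc_gt0.
have nwh : nc w / 2 < nc (w + h).
  have := le_normcD (w + h) (- h); rewrite addrK normcN; lra.
have wh0 : w + h != 0 by rewrite -normc_gt0 (lt_trans _ nwh)// divr_gt0.
have iwh : nc (w + h)^-1 <= 2 * nc w^-1.
  rewrite !Normc.normcV -[2]invrK -invfM lef_pV2 ?posrE ?mulr_gt0 ?invr_gt0//.
    by rewrite mulrC ltW.
  by rewrite (lt_trans _ nwh)// divr_gt0.
have E1 : (w + h)^-1 - w^-1 = - (h * (w^-1 * (w + h)^-1)) by field; apply/andP.
have E2 : (w + h)^-1 - w^-1 + h * w^-1 ^+ 2 = h ^+ 2 * (w^-1 ^+ 2 * (w + h)^-1).
  by field; apply/andP.
have nw := normc_ge0 w^-1; have nh := normc_ge0 h.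
split => //.
  rewrite E1 normcN !Normc.normcM mulrC ler_wpM2r//.
  by rewrite expr2 mulrCA ler_wpM2l.
rewrite E2 !expr2 !Normc.normcM mulrC -expr2 ler_wpM2r ?sqr_ge0//.
have -> : 2 * nc w^-1 ^+ 3 = nc w^-1 * nc w^-1 * (2 * nc w^-1) by ring.
by rewrite ler_wpM2l// mulr_ge0.
Qed.

Lemma kern_remainder t : `|complex.Re t| < 1 -> exists D1 D2 (K : R) (rho a : R),
  [/\ 0 < rho, 0 < a, 0 <= K &
  forall h, nc h < rho -> [/\ 1 + (t + h) != 0, 1 - (t + h) != 0,
    0 < complex.Re (alp (t + h)), 0 < complex.Re (bet (t + h)) & forall z,
   nc (kern (alp (t + h)) (bet (t + h)) z - kern (alp t) (bet t) z -
    h * ((D1 * (sumsq z)%:C + D2 * (diffsq z)%:C) * kern (alp t) (bet t) z)) <=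
   nc h ^+ 2 * (K * (Q z + Q z ^+ 2) * expR (- (a * Q z)))]].
Proof.
move=> t1; have a0 := Re_alp_gt0 t1; have b0 := Re_bet_gt0 t1.
have w0 := oneD_neq0 t1; have w'0 := oneB_neq0 t1.
pose A := nc (alp t); pose A' := nc (bet t).
pose L := 2 * (A ^+ 2 + A' ^+ 2 + A ^+ 3 + A' ^+ 3) + 1.
pose e := Num.min (complex.Re (alp t)) (complex.Re (bet t)).
have e0 : 0 < e by rewrite lt_min a0.
have A0 : 0 <= A := normc_ge0 _; have A'0 : 0 <= A' := normc_ge0 _.
have L0 : 0 < L by rewrite ltr_wpDl// mulr_ge0// !addr_ge0// exprn_ge0.
exists (alp t ^+ 2), (- bet t ^+ 2), (3 * L ^+ 2 + L),
  (Num.min (Num.min (nc (1 + t) / 2) (nc (1 - t) / 2))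
    (Num.min (e / (4 * L)) (1 - `|complex.Re t|))), (e / 4); split.
- by rewrite !lt_min !divr_gt0 ?normc_gt0 ?mulr_gt0//= subr_gt0.
- by rewrite divr_gt0.
- by rewrite addr_ge0 ?ltW// mulr_gt0// exprn_gt0.
move=> h; rewrite !lt_min => /andP[/andP[h1 h2] /andP[h3 h4]].
have th : `|complex.Re (t + h)| < 1.
  rewrite complexReD; apply: le_lt_trans (ler_normD _ _) _.
  have := normr_Re_le h; lra.
have [wh0 i1 i2] := inv_expansion w0 h1.
have h2' : nc (- h) < nc (1 - t) / 2 by rewrite normcN.
have [w'h0 j1 j2] := inv_expansion w'0 h2'.
rewrite normcN in j1 j2.
have E' : 1 - t - h = 1 - (t + h) by ring.
rewrite E' in w'h0 j1 j2; rewrite -addrA in wh0 i1 i2.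
split => //; [exact: Re_alp_gt0|exact: Re_bet_gt0|move=> z].
set da := (1 + (t + h))^-1 - _ in i1 i2.
set db := (1 - (t + h))^-1 - _ in j1 j2.
pose D := alp t ^+ 2 * (sumsq z)%:C + - bet t ^+ 2 * (diffsq z)%:C.
pose Del := - (da * (sumsq z)%:C + db * (diffsq z)%:C).
have phE : phase (alp (t + h)) (bet (t + h)) z = phase (alp t) (bet t) z + Del.
  by rewrite /phase /Del /da /db /alp /bet; ring.
have -> : kern (alp (t + h)) (bet (t + h)) z - kern (alp t) (bet t) z -
    h * (D * kern (alp t) (bet t) z) =
   kern (alp t) (bet t) z * ((cexp Del - 1 - Del) + (Del - h * D)).
  by rewrite /kern phE cexpD; ring.
rewrite Normc.normcM.
have Q0 : 0 <= Q z := sqnorm_pair_ge0 z.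
have nh := normc_ge0 h.
have A2 : 0 <= A ^+ 2 by exact: sqr_ge0.
have A'2 : 0 <= A' ^+ 2 by exact: sqr_ge0.
have A3 : 0 <= A ^+ 3 by exact: exprn_ge0.
have A'3 : 0 <= A' ^+ 3 by exact: exprn_ge0.
have nDel : nc Del <= L * nc h * Q z.
  rewrite /Del normcN; apply: le_trans (normc_lin_le _ _ _) _.
  rewrite ler_wpM2r//; apply: le_trans (lerD i1 j1) _.
  rewrite -mulrDl ler_wpM2r//.
  by rewrite -[nc (1 + t)^-1]/A -[nc (1 - t)^-1]/A' /L; lra.
have nD : nc (Del - h * D) <= L * nc h ^+ 2 * Q z.
  have -> : Del - h * D = - ((da + h * (1 + t)^-1 ^+ 2) * (sumsq z)%:C +
     (db + - h * (1 - t)^-1 ^+ 2) * (diffsq z)%:C).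
    by rewrite /Del /D /alp /bet; ring.
  rewrite normcN; apply: le_trans (normc_lin_le _ _ _) _.
  rewrite ler_wpM2r//; apply: le_trans (lerD i2 j2) _.
  rewrite -mulrDl ler_wpM2r ?sqr_ge0//.
  by rewrite -[nc (1 + t)^-1]/A -[nc (1 - t)^-1]/A' /L; lra.
have eL : expR (nc Del) <= expR (e / 4 * Q z).
  rewrite ler_expR; apply: le_trans nDel _; rewrite ler_wpM2r//.
  rewrite mulrC -ler_pdivlMr//; apply: le_trans (ltW h3) _.
  by rewrite invfM mulrA.
have k1 : nc (kern (alp t) (bet t) z) <= expR (- (e / 2 * Q z)).
  by apply: normc_kern_le1; rewrite ge_min lexx ?orbT.
have nDel2 : nc Del ^+ 2 <= (L * nc h * Q z) ^+ 2.
  by rewrite ler_pXn2r ?nnegrE ?normc_ge0// !mulr_ge0// ltW.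
have k2 : nc (cexp Del - 1 - Del + (Del - h * D)) <=
    nc h ^+ 2 * ((3 * L ^+ 2 + L) * (Q z + Q z ^+ 2)) * expR (e / 4 * Q z).
  apply: le_trans (le_normcD _ _) _.
  have E1 : 1 <= expR (e / 4 * Q z) by rewrite -expR0 ler_expR mulr_ge0// divr_ge0// ltW.
  apply: le_trans (lerD (cexp_sub1D _) nD) _.
  apply: (@le_trans _ _ (3 * (L * nc h * Q z) ^+ 2 * expR (e / 4 * Q z) +
     L * nc h ^+ 2 * Q z * expR (e / 4 * Q z))).
    apply: lerD; last first.
      by rewrite ler_peMr// !mulr_ge0// ?sqr_ge0// ltW.
    apply: ler_pM => //; [by rewrite mulr_ge0 ?sqr_ge0|by rewrite ler_wpM2l].
  rewrite -mulrDl ler_wpM2r ?expR_ge0//.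
  have -> : 3 * (L * nc h * Q z) ^+ 2 + L * nc h ^+ 2 * Q z =
    nc h ^+ 2 * (3 * L ^+ 2 * Q z ^+ 2 + L * Q z) by ring.
  rewrite ler_wpM2l ?sqr_ge0//.
  have := mulr_ge0 (sqr_ge0 L) Q0; have := mulr_ge0 (ltW L0) (sqr_ge0 (Q z)).
  lra.
apply: le_trans (ler_pM (normc_ge0 _) (normc_ge0 _) k1 k2) _.
have -> : expR (- (e / 4 * Q z)) = expR (- (e / 2 * Q z)) * expR (e / 4 * Q z).
  by rewrite -expRD; congr expR; field.
by rewrite le_eqVlt; apply/orP; left; apply/eqP; ring.
Qed.

Lemma derivable_Cintegral_kern t : `|complex.Re t| < 1 ->
  derivable ((fun t => Cintegral (lam2 n) (kern (alp t) (bet t))) : R[i]^o -> R[i]^o) t 1.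
Proof.
move=> t1; have [D1 [D2 [K [rho [a [rho0 a0 K0 H]]]]]] := kern_remainder t1.
pose b z := K * (Q z + Q z ^+ 2).
have sb : subexp Q b.
  apply: subexpZ; first exact: sqnorm_pair_ge0.
  by apply: subexpD; [exact: subexpQ|apply: subexpX; [exact: sqnorm_pair_ge0|exact: subexpQ]].
have ib := subexp_integrable_pairs sb a0.
pose k z := (D1 * (sumsq z)%:C + D2 * (diffsq z)%:C) * kern (alp t) (bet t) z.
have at0 := Re_alp_gt0 t1; have bt0 := Re_bet_gt0 t1.
have ck : cint (lam2 n) k by exact: cint_lin_kern.
apply: (@derivable_of_quadratic_bound _ _ _ (Cintegral (lam2 n) k)
  (2 * \int[lam2 n]_z (b z * expR (- (a * Q z)))) rho) => // h hr.
have [_ _ ah bh Hz] := H h hr.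
have ckh : cint (lam2 n) (fun z => h * k z).
  have [c1 c2] := ck.
  have intZ (c : R) (g : n.-tuple R * n.-tuple R -> R) : (lam2 n).-integrable setT (EFin \o g) ->
    (lam2 n).-integrable setT (EFin \o (fun x => c * g x)).
    by move=> ig; have := integrableZl measurableT c ig; apply: eq_integrable.
  split.
    have := integrableB measurableT (intZ (complex.Re h) _ c1) (intZ (complex.Im h) _ c2).
    by apply: eq_integrable => // z _ /=; rewrite -EFinB -complexReM.
  have := integrableD measurableT (intZ (complex.Re h) _ c2) (intZ (complex.Im h) _ c1).
  by apply: eq_integrable => // z _ /=; rewrite -EFinD -complexImM.
have c1 := cint_kern ah bh; have c2 := cint_kern at0 bt0.
rewrite -CintegralZl// -CintegralB// -CintegralB//; last exact: cintB.
have ibh : (lam2 n).-integrable setT (EFin \o (fun z => nc h ^+ 2 * (b z * expR (- (a * Q z))))).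
  by have := integrableZl measurableT (nc h ^+ 2) ib; apply: eq_integrable.
apply: le_trans (normc_Cintegral_le _ ibh Hz) _.
  by apply: cintB => //; exact: cintB.
by rewrite RintegralZl// mulrCA mulrC.
Qed.

End Phi_holomorphic.

Section Phi_derivable.
Context {R : realType} {n : nat}.
Local Open Scope complex_scope.
Variables F G : n.-tuple R -> R.
Hypotheses (mF : measurable_fun setT F) (mG : measurable_fun setT G).

Lemma PhiE t : 1 - t ^+ 2 != 0 ->
  Phi F G t = (2 * pi%:C * sqrtc (1 - t ^+ 2)) ^- n *
    Cintegral (lebesgue_pairs n) (kern (sgFG F G) (alp t) (bet t)).
Proof.
move=> t0; rewrite /Phi; congr (_ * _).
suff fE z : (Num.sg (F z.1) * Num.sg (G z.2))%:C *
     cexp (- (((enorm z.1 ^+ 2 + enorm z.2 ^+ 2)%:C - 2 * t * (dotp z.1 z.2)%:C) /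
             (2 * (1 - t ^+ 2)))) = kern (sgFG F G) (alp t) (bet t) z.
  by rewrite /Cintegral; congr (_ +i* _); apply: eq_Rintegral => z _; rewrite fE.
rewrite /kern; congr (_ * cexp _); rewrite /phase; congr (- _).
have : (1 - t) * (1 + t) != 0 by rewrite -subr_sqr expr1n.
rewrite mulf_eq0 negb_or => /andP[tB tD].
rewrite !enorm2 -/(sqnorm_pair z) -/(dotpp z) /sumsq /diffsq /alp /bet.
rewrite !(rmorphM, rmorphD, rmorphN, fmorphV, rmorph_nat)/=.
by field; rewrite tB tD t0.
Qed.

Lemma Phi_derivable t : `|complex.Re t| < 1 ->
  derivable (Phi F G : R[i]^o -> R[i]^o) t 1.
Proof.
move=> t1.
pose g : R[i]^o -> R[i]^o := (fun t => (2 * pi%:C * sqrtc (1 - t ^+ 2)) ^- n) *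
    (fun t => Cintegral (lebesgue_pairs n) (kern (sgFG F G) (alp t) (bet t))).
have ms := measurable_sgFG mF mG.
have s1 := sgFG_le1 F G.
have r0 : 0 < complex.Re (sqrtc (1 - t ^+ 2)) := Re_sqrtc_gt0 t1.
have sq0 : sqrtc (1 - t ^+ 2) != 0.
  by apply/eqP => E; move: r0; rewrite E ltxx.
have dg : derivable g t 1.
  apply: derivableM; last exact: derivable_Cintegral_kern.
  apply: (@derivableV R[i] R[i]^o (fun t : R[i]^o => (2 * pi%:C * sqrtc (1 - t ^+ 2)) ^+ n)).
    rewrite expf_neq0// !mulf_neq0// ?pnatr_eq0// eq_complex/= eqxx andbT.
    by rewrite gt_eqF// pi_gt0.
  rewrite (_ : (fun t : R[i]^o => _) =
     (fun t : R[i]^o => 2 * pi%:C * sqrtc (1 - t ^+ 2) : R[i]) ^+ n); last first.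
    by apply/funext => u; rewrite exprfctE.
  apply: derivableX.
  apply: (@derivableM R[i] R[i]^o (cst (2 * pi%:C)) (fun t => sqrtc (1 - t ^+ 2))).
    exact: derivable_cst.
  exact: derivable_sqrtc_oneBsqr.
apply: near_eq_derivable dg.
pose e := 1 - `|complex.Re t|.
have e0 : 0 < e by rewrite subr_gt0.
exists e%:C => /=; first by rewrite ltcR.
move=> u; rewrite /ball_/= => tu; rewrite PhiE//.
have {}tu : Normc.normc (t - u) < e by rewrite -ltcR.
have u1 : `|complex.Re u| < 1.
  have := normr_Re_le (t - u); rewrite complexReD complexReN.
  have := ler_normB (complex.Re t) (complex.Re t - complex.Re u); rewrite opprB addrC subrK.
  move: tu; rewrite /e; lra.
have := Re_sqrtc_gt0 u1; apply: contraTneq => ->.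
by rewrite sqrtc0 ltxx.
Qed.

End Phi_derivable.

Section density_measure.
Context {R : realType} d (T : measurableType d) (m : {measure set T -> \bar R}).
Variable p : T -> R.

Definition density_measure of measurable_fun setT p & (forall x, 0 <= p x) :=
  fun A : set T => (\int[m]_(x in A) (p x)%:E)%E.

Hypotheses (mp : measurable_fun setT p) (p0 : forall x, 0 <= p x).
Local Notation dm := (density_measure mp p0).

Let density0 : dm set0 = 0%E.
Proof. by rewrite /density_measure integral_set0. Qed.

Let density_ge0 A : (0 <= dm A)%E.
Proof. by apply: integral_ge0 => x _; rewrite lee_fin. Qed.

Let density_sigma_additive : semi_sigma_additive dm.
Proof.
move=> /= A mA tA mUA.
rewrite /density_measure/= ge0_integral_bigcup//=; last 2 first.
- by apply: measurable_funTS; exact/measurable_EFinP.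
- by move=> x _; rewrite lee_fin.
apply: is_cvg_ereal_nneg_natsum_cond => k _ _.
exact: density_ge0.
Qed.

HB.instance Definition _ := isMeasure.Build _ _ _
  dm density0 density_ge0 density_sigma_additive.

End density_measure.

Section law.
Context {R : realType} {n : nat}.
Local Notation Tn2 := (n.-tuple R * n.-tuple R)%type.

Definition box (A : 'I_n -> set (R * R)) : set Tn2 :=
  [set z | forall j, A j (tnth z.1 j, tnth z.2 j)].

Definition boxes : set (set Tn2) :=
  [set E | exists2 A : 'I_n -> set (R * R), (forall j, measurable (A j)) & E = box A].

Lemma measurable_box A : (forall j, measurable (A j)) -> measurable (box A).
Proof.
move=> mA; rewrite (_ : box A = \bigcap_(j in [set: 'I_n])
    ((fun z : Tn2 => (tnth z.1 j, tnth z.2 j)) @^-1` A j)); last first.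
  by apply/seteqP; split => [z zA j _|z zA j]; [exact: zA|exact: (zA j)].
apply: fin_bigcap_measurable => // j _.
by rewrite -[X in measurable X]setTI; exact: (measurable_tnth_pair j).
Qed.

Lemma setI_closed_boxes : setI_closed boxes.
Proof.
move=> _ _ [A mA ->] [B mB ->]; exists (fun j => A j `&` B j).
  by move=> j; exact: measurableI.
apply/seteqP; split => [z [zA zB] j|z zAB]; first by split; [exact: zA|exact: zB].
by split => j; have [] := zAB j.
Qed.

Lemma boxes_setT : boxes setT.
Proof. by exists (fun=> setT) => //; apply/seteqP; split. Qed.

Lemma measurable_boxesE : measurable = <<s boxes >>.
Proof.
apply/seteqP; split; last first.
  apply: smallest_sub; first exact: sigma_algebra_measurable.
  by move=> _ [A mA ->]; exact: measurable_box.
have mid : measurable_fun [set: g_sigma_algebraType boxes] (fun z => z : Tn2).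
  rewrite (_ : (fun z => z) = (fun z : g_sigma_algebraType boxes => ((z : Tn2).1, (z : Tn2).2))); last first.
    by apply/funext => -[].
  have slot (B : set (R * R)) (j : 'I_n) : measurable B ->
      <<s boxes >> [set z : Tn2 | B (tnth z.1 j, tnth z.2 j)].
    move=> mB; apply: sub_sigma_algebra.
    exists (fun i => if i == j then B else setT); first by move=> i; case: ifP.
    apply/seteqP; split => [z zB i|z zB]; first by case: eqP => // ->.
    by have := zB j; rewrite eqxx.
  apply: measurable_fun_pair; apply/measurable_fun_tnthP => j _ B mB; rewrite setTI.
    have := slot (B `*` setT) j; apply: contraPP => h.
    move=> /(_ (measurableX mB measurableT)); apply: contra_not h.
    by congr (<<s boxes >> _); apply/seteqP; split => z //= -[].
  have := slot (setT `*` B) j; apply: contraPP => h.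
  move=> /(_ (measurableX measurableT mB)); apply: contra_not h.
  by congr (<<s boxes >> _); apply/seteqP; split => z //= -[].
move=> E mE; have := mid measurableT E mE.
by rewrite setTI.
Qed.

End law.

Section expectation_law.
Context {R : realType} {n : nat} d (T : measurableType d) (P : probability T R).
Variables (t : R) (X Y : 'I_n -> {RV P >-> R}).
Hypotheses (t1 : -1 < t < 1) (XY : correlated_gaussians t X Y).
Local Notation mR := (measurableTypeR R).
Local Notation lam2 := (@lebesgue_pairs R).
Local Notation mu2 := (@lebesgue2 R).
Local Notation Tn2 := (n.-tuple R * n.-tuple R)%type.

Definition jointv (w : T) : Tn2 := (random_vector X w, random_vector Y w).

Lemma measurable_jointv : measurable_fun setT jointv.
Proof.
apply: measurable_fun_pair; apply/measurable_fun_tnthP => j.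
  rewrite (_ : _ \o _ = X j); first exact: measurable_funP.
  by apply/funext => w; rewrite /= tnth_mktuple.
rewrite (_ : _ \o _ = Y j); first exact: measurable_funP.
by apply/funext => w; rewrite /= tnth_mktuple.
Qed.

Lemma gauss2_pdf_ge0 z : 0 <= gauss2_pdf t z.
Proof.
by rewrite mulr_ge0 ?expR_ge0// invr_ge0 !mulr_ge0 ?pi_ge0.
Qed.

Lemma measurable_gauss2_pdf : measurable_fun [set: mR * mR] (gauss2_pdf t).
Proof.
apply: measurable_funM => //; apply: measurableT_comp => //.
apply: measurableT_comp => //; apply: measurable_funM => //.
apply: measurable_funB.
  exact: measurable_sqnorm2.
by apply: measurable_funM => //; exact: measurable_funM.
Qed.

Definition gauss_density (z : Tn2) : R := \prod_(j < n) gauss2_pdf t (tnth z.1 j, tnth z.2 j).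

Lemma gauss_density_ge0 z : 0 <= gauss_density z.
Proof. by apply: prodr_ge0 => j _; exact: gauss2_pdf_ge0. Qed.

Lemma measurable_gauss_density : measurable_fun setT gauss_density.
Proof.
apply: measurable_prod => j _.
exact: measurableT_comp measurable_gauss2_pdf (measurable_tnth_pair j).
Qed.

Definition gauss_measure : {measure set Tn2 -> \bar R} :=
  density_measure (lam2 n) measurable_gauss_density gauss_density_ge0.

Definition law_measure : {measure set Tn2 -> \bar R} :=
  measure_function_pushforward__canonical__measure_function_Measure P measurable_jointv.

Lemma law_box A : (forall j, measurable (A j)) ->
  law_measure (box A) = gauss_measure (box A).
Proof.
move=> mA; have [gXY iXY] := XY.
transitivity (\prod_(j < n) P [set w | A j (X j w, Y j w)])%E.
  rewrite -iXY//; congr (P _); apply/seteqP; split => w /=; rewrite /box/=.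
    by move=> wA j; have := wA j; rewrite !tnth_mktuple.
  by move=> wA j; rewrite !tnth_mktuple; exact: wA.
transitivity (\prod_(j < n) \int[mu2]_z (\1_(A j) z * gauss2_pdf t z)%:E)%E.
  apply: eq_bigr => j _; rewrite gXY//.
  rewrite integral_mkcond; apply: eq_integral => z _.
  by rewrite patchE indicE; case: (z \in A j); rewrite ?mul1r ?mul0r.
rewrite -(ge0_integral_pairs_prod (f := fun j z => \1_(A j) z * gauss2_pdf t z)); last 2 first.
- move=> j; apply: measurable_funM; last exact: measurable_gauss2_pdf.
  exact: measurable_indic (mA j).
- by move=> j w; rewrite mulr_ge0// gauss2_pdf_ge0.
rewrite /gauss_measure/= /density_measure [RHS]integral_mkcond.
apply: eq_integral => z _; rewrite patchE big_split/= -/(gauss_density z).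
have [zA|zA] := boolP (z \in box A).
  rewrite big1 ?mul1r// => j _; rewrite indicE; case: (boolP (_ \in _)) => // /negP[].
  by rewrite inE; move: zA; rewrite inE; exact.
suff [j zj] : exists j, (tnth z.1 j, tnth z.2 j) \notin A j.
  by rewrite (bigD1 j)//= indicE (negbTE zj) !mul0r.
apply: contrapT => h; move/negP: zA; apply; rewrite inE => j.
by apply: contrapT => hj; apply: h; exists j; rewrite notin_setE.
Qed.

Lemma law_measureE E : measurable E -> law_measure E = gauss_measure E.
Proof.
apply: (measure_unique (@boxes R n) (fun=> setT)).
- exact: measurable_boxesE.
- exact: setI_closed_boxes.
- by move=> _; exact: boxes_setT.
- by apply/seteqP; split => // z _; exists 0%N.
- by move=> _ [A mA ->]; exact: law_box.
- by move=> _; rewrite /law_measure/= /pushforward preimage_setT probability_setT ltry.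
Qed.

Lemma integrable_gauss_density : (lam2 n).-integrable setT (EFin \o gauss_density).
Proof.
apply/integrableP; split.
  by apply/measurable_EFinP; exact: measurable_gauss_density.
rewrite (_ : (\int[_]_(_ in _) _)%E = gauss_measure setT).
  rewrite -law_measureE// /law_measure/= /pushforward preimage_setT.
  by rewrite probability_setT ltry.
by apply: eq_integral => z _; rewrite /= ger0_norm ?gauss_density_ge0.
Qed.

Lemma Rintegral_law (s : Tn2 -> R) : measurable_fun setT s ->
  (forall z, s z = 0 \/ s z = 1 \/ s z = -1) ->
  \int[P]_w s (jointv w) = \int[lam2 n]_z (s z * gauss_density z).
Proof.
move=> ms s01.
pose A1 := s @^-1` [set 1]; pose A2 := s @^-1` [set -1].
have mA1 : measurable A1 by rewrite -[A1]setTI; exact: ms.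
have mA2 : measurable A2 by rewrite -[A2]setTI; exact: ms.
have sE z : s z = \1_A1 z - \1_A2 z.
  rewrite !indicE /A1 /A2.
  have -> : (z \in s @^-1` [set 1]) = (s z == 1).
    by apply/idP/eqP; rewrite inE.
  have -> : (z \in s @^-1` [set -1]) = (s z == -1).
    by apply/idP/eqP; rewrite inE.
  have n11 : (1 == -1 :> R) = false by apply/negP => /eqP; lra.
  have n01 : (0 == -1 :> R) = false by apply/negP => /eqP; lra.
  have n02 : (0 == 1 :> R) = false by apply/negP => /eqP; lra.
  by case: (s01 z) => [->|[->|->]]; rewrite ?n01 ?n02 ?n11 ?eqxx ?subr0 ?subrr// eq_sym n11 sub0r.
have part A : measurable A ->
    [/\ P.-integrable setT (EFin \o (fun w => \1_A (jointv w) : R)),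
       (lam2 n).-integrable setT (EFin \o (fun z => \1_A z * gauss_density z)) &
    \int[P]_w \1_A (jointv w) = \int[lam2 n]_z (\1_A z * gauss_density z)].
  move=> mA.
  have mJ : measurable (jointv @^-1` A).
    by rewrite -[X in measurable X]setTI; exact: measurable_jointv.
  have E1 : (\int[P]_w (\1_A (jointv w))%:E = law_measure A)%E.
    by have := measure_integral_indic P mJ => /esym.
  have E2 : (\int[lam2 n]_z (\1_A z * gauss_density z)%:E = gauss_measure A)%E.
    rewrite /gauss_measure/= /density_measure [RHS]integral_mkcond.
    apply: eq_integral => z _; rewrite patchE indicE.
    by case: (z \in A); rewrite ?mul1r ?mul0r.
  split.
  - apply/integrableP; split.
      apply/measurable_EFinP; exact: (measurableT_comp (measurable_indic mA) measurable_jointv).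
    under eq_integral do rewrite /= ger0_norm//.
    by rewrite E1 /law_measure/= ltey_eq fin_num_measure.
  - apply: (le_integrable measurableT _ _ integrable_gauss_density).
      apply/measurable_EFinP; apply: measurable_funM; last exact: measurable_gauss_density.
      exact: measurable_indic.
    move=> z _ /=; rewrite lee_fin normrM ler_piMl// indicE.
    by case: (_ \in _); rewrite ?normr0 ?normr1.
  - by rewrite /Rintegral E1 E2 law_measureE.
have [i1 j1 e1] := part _ mA1; have [i2 j2 e2] := part _ mA2.
under eq_Rintegral do rewrite sE.
rewrite RintegralB// e1 e2 -RintegralB//.
by apply: eq_Rintegral => z _; rewrite sE mulrBl.
Qed.

End expectation_law.

Section Phi_real.
Context {R : realType} {n : nat}.
Local Open Scope complex_scope.
Variables F G : n.-tuple R -> R.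
Hypotheses (mF : measurable_fun setT F) (mG : measurable_fun setT G).

Lemma gauss_densityE (t : R) (z : n.-tuple R * n.-tuple R) :
  gauss_density t z = (2 * pi * Num.sqrt (1 - t ^+ 2)) ^- n *
    expR (- ((sqnorm_pair z - 2 * t * dotpp z) / (2 * (1 - t ^+ 2)))).
Proof.
rewrite /gauss_density /gauss2_pdf big_split/= prodr_const card_ord exprVn.
congr (_ * _); rewrite -expR_sum; congr expR.
rewrite sumrN -mulr_suml; congr (- (_ / _)).
rewrite sumrB big_split/= /sqnorm_pair /dotpp /dotp mulr_sumr.
by congr (_ + _ - _); apply: eq_bigr => j _; rewrite expr2.
Qed.

Lemma Phi_realE (t : R) : -1 < t < 1 ->
  Phi F G t%:C = (\int[lebesgue_pairs n]_z (sgFG F G z * gauss_density t z))%:C.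
Proof.
move=> /andP[t1 t2].
have t0 : 0 < 1 - t ^+ 2 by have : 0 < (1 - t) * (1 + t) by [apply: mulr_gt0; lra|]; rewrite -subr_sqr expr1n.
rewrite /Phi.
have two : (2 : R[i]) = (2 : R)%:C by rewrite rmorph_nat.
have E1 : 1 - t%:C ^+ 2 = (1 - t ^+ 2)%:C by rewrite rmorphB rmorph1 rmorphXn.
rewrite E1 sqrtc_sqrtr; last by rewrite lecR ltW.
set c := (2 * pi * Num.sqrt (1 - t ^+ 2)) ^- n.
have -> : (2 * pi%:C * (Num.sqrt (complex.Re (1 - t ^+ 2)%:C))%:C) ^- n = c%:C.
  by rewrite /c fmorphV rmorphXn !rmorphM two.
pose f z := sgFG F G z * expR (- ((sqnorm_pair z - 2 * t * dotpp z) / (2 * (1 - t ^+ 2)))).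
rewrite /Cintegral.
have fE (z : n.-tuple R * n.-tuple R) : (Num.sg (F z.1) * Num.sg (G z.2))%:C *
     cexp (- (((enorm z.1 ^+ 2 + enorm z.2 ^+ 2)%:C - 2 * t%:C * (dotp z.1 z.2)%:C) /
             (2 * (1 - t ^+ 2)%:C))) = (f z)%:C.
  have -> : - (((enorm z.1 ^+ 2 + enorm z.2 ^+ 2)%:C - 2 * t%:C * (dotp z.1 z.2)%:C) /
             (2 * (1 - t ^+ 2)%:C)) =
      (- ((sqnorm_pair z - 2 * t * dotpp z) / (2 * (1 - t ^+ 2))))%:C.
    by rewrite !enorm2 two -!rmorphM -rmorphB -fmorphV -rmorphM -rmorphN.
  rewrite /cexp/= sin0 cos0 -[1 +i* 0]/(1 : R[i]) mulr1 -rmorphM /f.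
  by [].
under eq_Rintegral do rewrite fE/=.
under [X in _ +i* X]eq_Rintegral do rewrite fE/=.
have -> : \int[lebesgue_pairs n]_(z in setT) (0 : R) = 0.
  by rewrite /Rintegral integral0.
rewrite -rmorphM; congr (_%:C).
have i0 := cint_kern (measurable_sgFG mF mG) (sgFG_le1 F G).
have -> : \int[lebesgue_pairs n]_z (sgFG F G z * gauss_density t z) =
    \int[lebesgue_pairs n]_z (c * f z).
  by apply: eq_Rintegral => z _; rewrite gauss_densityE /f mulrCA.
rewrite RintegralZl//.
have tC1 : `|complex.Re t%:C| < 1 by rewrite /= ltr_norml t1.
have [+ _] := i0 _ _ (Re_alp_gt0 tC1) (Re_bet_gt0 tC1).
apply: eq_integrable => // z _; rewrite /comp.
have t0' : 1 - t%:C ^+ 2 != 0.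
  by rewrite E1 -[0]/(0%:C) (inj_eq (@complexI _)) gt_eqF.
have -> : kern (sgFG F G) (alp t%:C) (bet t%:C) z = (f z)%:C.
  rewrite -fE /kern; congr (_ * cexp _); rewrite /phase; congr (- _).
  have : (1 - t%:C) * (1 + t%:C) != 0 by rewrite -subr_sqr expr1n.
  rewrite mulf_eq0 negb_or => /andP[tB tD].
  rewrite -E1 !enorm2 -/(sqnorm_pair z) -/(dotpp z) /sumsq /diffsq /alp /bet.
  rewrite !(rmorphM, rmorphD, rmorphN, fmorphV, rmorph_nat)/=.
  by field; rewrite tB tD t0'.
by [].
Qed.

Lemma analytic_extension_Phi : analytic_extension F G (Phi F G).
Proof.
split=> [t t1|t t1 d T P X Y XY].
  by apply: Phi_derivable => //; move: t1; rewrite -[1]/(1%:C) normc_def ltcR.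
rewrite Phi_realE//; congr (_%:C).
have s01 z : sgFG F G z = 0 \/ sgFG F G z = 1 \/ sgFG F G z = -1.
  rewrite /sgFG.
  have [/eqP|x0|x0] := sgrP (F z.1); rewrite ?mul0r; first by left.
    by case: (sgrP (G z.2)) => _; rewrite ?mulr0 ?mul1r; auto.
  by case: (sgrP (G z.2)) => _; rewrite ?mulr0 ?mulr1 ?mulN1r ?opprK; auto.
rewrite -(Rintegral_law XY (measurable_sgFG mF mG) s01).
rewrite /Rintegral unlock.
done.
Qed.

End Phi_real.

Section half_line.
Context {R : realType}.
Local Notation mR := (measurableTypeR R).
Local Notation mu := (@lebesgue_measure R).
Local Notation half := (`[0, +oo[%classic : set mR).

Lemma measurable_half : measurable half.
Proof. exact: measurable_itv. Qed.

Definition sq (x : mR) : R := x ^+ 2.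

Lemma sq_ge0 x : 0 <= sq x. Proof. exact: sqr_ge0. Qed.

Lemma measurable_sq : measurable_fun setT sq.
Proof. exact: measurable_funX. Qed.

Lemma subexp_integrable1 (g : mR -> R) a : subexp sq g -> 0 < a ->
  mu.-integrable setT (EFin \o (fun z : mR => g z * expR (- (a * z ^+ 2)))).
Proof.
apply: (@subexp_integrable _ _ mR sq mu g a measurable_sq).
exact: integrable_gauss_scale.
Qed.

Lemma subexp_integrable_half (g : mR -> R) a : subexp sq g -> 0 < a ->
  mu.-integrable half (EFin \o (fun z : mR => g z * expR (- (a * z ^+ 2)))).
Proof.
by move=> sg a0; apply: integrableS (subexp_integrable1 sg a0).
Qed.

Lemma subexp_id : subexp sq (fun x : mR => x : R).
Proof. apply: subexp_coord; [exact: sq_ge0|exact: measurable_id|by []]. Qed.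

Lemma cvg_subexp0 (g : mR -> R) a : subexp sq g -> 0 < a ->
  (fun n : nat => g n.+1%:R * expR (- (a * n.+1%:R ^+ 2))) @ \oo --> (0 : R).
Proof.
move=> [_ gC] a0; have a20 : 0 < a / 2 by rewrite divr_gt0.
have [C gC'] := gC _ a20.
have C0 : 0 <= C by have := gC' 0; rewrite /sq expr0n/= mulr0 expR0 mulr1; exact: le_trans.
have h : (fun n => C / (a / 2) * harmonic n) @ \oo --> (0 : R).
  by rewrite -[X in _ --> X](mulr0 (C / (a / 2))); apply: cvgMl_tmp; exact: cvg_harmonic.
apply: norm_cvg0; apply: (squeeze_cvgr _ (cvg_cst 0) h).
apply: nearW => n; rewrite normr_ge0/= normrM [`|expR _|]ger0_norm ?expR_ge0//.
apply: le_trans (ler_wpM2r (expR_ge0 _) (gC' _)) _.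
rewrite -[leLHS]mulrA -expRD -[leRHS]mulrA ler_wpM2l// /sq /harmonic/=.
set x : R := n.+1%:R.
have -> : a / 2 * x ^+ 2 + - (a * x ^+ 2) = - (a / 2 * x ^+ 2) by field.
rewrite -invfM expRN lef_pV2 ?posrE ?expR_gt0 ?mulr_gt0//.
apply: le_trans _ (expR_ge1Dx _).
have x1 : 1 <= x by rewrite ler1n.
have : a / 2 * x <= a / 2 * x ^+ 2.
  by apply: ler_wpM2l; [exact: ltW|rewrite expr2 ler_peMr// (le_trans ler01)].
lra.
Qed.

Lemma continuous_of_is_derive (F f : R -> R) :
  (forall x, is_derive x (1 : R) F (f x)) -> continuous F.
Proof.
move=> dF x; apply: differentiable_continuous; apply/derivable1_diffP.
by case: (dF x).
Qed.

Lemma continuous_FTC2_everywhere (F f : R -> R) (a b : R) : a < b ->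
  (forall x, is_derive x (1 : R) F (f x)) -> continuous f ->
  (\int[mu]_(x in `[a, b]) (f x)%:E = (F b - F a)%:E)%E.
Proof.
move=> ab dF cf; rewrite EFinB; apply: continuous_FTC2 => //.
- exact: continuous_subspaceT.
- have cF := continuous_of_is_derive dF; split.
  + by move=> x _; case: (dF x).
  + exact: cvg_at_right_filter (cF a).
  + exact: cvg_at_left_filter (cF b).
- by move=> x _; rewrite derive1E; case: (dF x).
Qed.

Lemma half_FTC (F f : mR -> R) a : 0 < a -> subexp sq F -> subexp sq f ->
  (forall x, is_derive (x : R) (1 : R) (fun x => F x * expR (- (a * x ^+ 2)) : R)
     (f x * expR (- (a * x ^+ 2)))) ->
  continuous (f : R -> R) ->
  \int[mu]_(x in half) (f x * expR (- (a * x ^+ 2))) = - F 0.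
Proof.
move=> a0 sF sf dF cf.
set fE := fun x => f x * _.
have ifE := subexp_integrable_half sf a0.
pose fn (n : nat) : mR -> \bar R := (EFin \o fE) \_ `[0, n.+1%:R].
have mf : measurable_fun setT fE.
  have [mf _] := sf; apply: measurable_funM => //.
  by apply: measurable_expRN_quad; exact: measurable_sq.
have mfn n : measurable_fun half (fn n).
  apply: measurable_funTS; apply/(measurable_restrictT _ _).1 => //.
  by apply: measurable_funTS; exact/measurable_EFinP.
have cfE : continuous fE.
  move=> x; apply: cvgM; first exact: cf.
  apply: (@continuous_comp _ _ _ (fun x : R => - (a * x ^+ 2)) expR); last exact: continuous_expR.
  apply: cvgN; apply: cvgM; first exact: cvg_cst.
  exact: exprn_continuous.
have cvgfn x : half x -> fn ^~ x @ \oo --> (EFin \o fE) x.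
  rewrite /= in_itv/= andbT => x0; apply: cvg_near_cst.
  near=> n; rewrite /fn patchE ifT// inE/= in_itv/= x0/=.
  near: n; exists (Num.truncn x).+1 => // n /= xn.
  apply: ltW; apply: lt_trans (truncnS_gt _) _; rewrite ltr_nat; exact: leq_trans xn _.
have mfE' : measurable_fun half (EFin \o fE).
  by apply: measurable_funTS; exact/measurable_EFinP.
have dom x n : half x -> (`|fn n x| <= (abse \o (EFin \o fE)) x)%E.
  by move=> _; rewrite /fn patchE; case: ifP => //= _; rewrite normr0 lee_fin.
have [_ _ lim1] := @dominated_convergence _ mR R mu half measurable_half fn
   (EFin \o fE) (abse \o (EFin \o fE)) mfn mfE'
   (aeW _ cvgfn) (integrable_abse ifE) (aeW _ dom).
have lim2 : (fun n => \int[mu]_(x in half) fn n x)%E @ \oo --> (- F 0)%:E.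
  have -> : (fun n => \int[mu]_(x in half) fn n x)%E =
      (fun n => (F n.+1%:R * expR (- (a * n.+1%:R ^+ 2)) - F 0)%:E).
    apply/funext => n; rewrite /fn -integral_mkcondr.
    rewrite setIidr; last by move=> x /=; rewrite !in_itv/= andbT => /andP[].
    rewrite (continuous_FTC2_everywhere _ dF cfE) ?ltr0Sn//.
    by rewrite expr0n/= mulr0 oppr0 expR0 mulr1.
  apply: cvg_EFin; first exact: nearW.
  rewrite -[X in _ --> X]add0r; apply: cvgD; last exact: cvg_cst.
  exact: cvg_subexp0.
rewrite /Rintegral.
have -> : (\int[mu]_(x in half) (fE x)%:E = (- F 0)%:E)%E.
  exact: (cvg_unique _ lim1 lim2).
by [].
Unshelve. all: end_near.
Qed.
End half_line.

Section half_calculus.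
Context {R : realType}.
Local Notation mR := (measurableTypeR R).
Local Notation mu := (@lebesgue_measure R).
Local Notation half := (`[0, +oo[%classic : set mR).
Local Notation sq := (@sq R).

Lemma half_IBP (F dF : mR -> R) a : 0 < a -> subexp sq F -> subexp sq dF ->
  (forall x, is_derive (x : R) (1 : R) (F : R -> R) (dF x)) ->
  continuous (dF : R -> R) ->
  \int[mu]_(x in half) ((dF x - 2 * a * x * F x) * expR (- (a * x ^+ 2))) = - F 0.
Proof.
move=> a0 sF sdF hF cF.
apply: (half_FTC (f := fun x => dF x - 2 * a * x * F x)) => //.
- apply: subexpB => //; apply: subexpM => //.
  by apply: subexpZ; [exact: sq_ge0|exact: subexp_id].
- move=> x; have hE : is_derive (x : R) (1 : R) (fun x : R => expR (- (a * x ^+ 2)))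
      (expR (- (a * x ^+ 2)) * - (a * 2%:R * x ^+ 1)).
    have -> : (fun x : R => expR (- (a * x ^+ 2))) = expR \o (- (fun x : R => a * x ^+ 2)).
      by [].
    by apply: is_derive1_comp; apply: is_deriveN; exact: is_derive_scaleX.
  have := is_deriveM (hF x) hE.
  set A := (X in is_derive _ _ _ X); have -> // : A = (dF x - 2 * a * x * F x) * expR (- (a * x ^+ 2)).
  by rewrite /A /GRing.scale/= expr1; ring.
- move=> x; have c1 : (F : R -> R) @ x --> F x by exact: continuous_of_is_derive.
  have c2 : (fun y : R => 2 * a * y) @ x --> 2 * a * x.
    by apply: cvgM; [exact: cvg_cst|exact: cvg_id].
  exact: (cvgB (cF x) (cvgM c2 c1)).
Qed.

Lemma half_DUI (k k' : R -> mR -> R) (B : mR -> R) a : 0 < a -> subexp sq B ->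
  (forall t, subexp sq (k t)) ->
  (forall t v, is_derive t (1 : R) (k ^~ v) (k' t v)) ->
  (forall t v, `|k' t v| <= B v) ->
  forall t, is_derive t (1 : R)
    (fun t => \int[mu]_(v in half) (k t v * expR (- (a * v ^+ 2))))
    (\int[mu]_(v in half) (k' t v * expR (- (a * v ^+ 2)))).
Proof.
move=> a0 sB sk dk kB t.
pose f t (v : mR) := k t v * expR (- (a * v ^+ 2)).
have df x v : is_derive x (1 : R) (f ^~ v) (k' x v * expR (- (a * v ^+ 2))).
  rewrite (_ : f ^~ v = expR (- (a * v ^+ 2)) \*: (k ^~ v)); last first.
    by apply/funext => y; rewrite /f mulrC.
  by rewrite [X in is_derive _ _ _ X]mulrC; exact: is_deriveZ.
have d1E x v : partial1of2 f x v = k' x v * expR (- (a * v ^+ 2)).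
  by rewrite partial1of2E; case: (df x v).
have tI : `]t - 1, t + 1[%classic t.
  by rewrite /= in_itv/=; apply/andP; split; lra.
have intf x : `]t - 1, t + 1[%classic x -> mu.-integrable half (EFin \o f x).
  by move=> _; exact: subexp_integrable_half.
have derf x v : `]t - 1, t + 1[%classic x -> half v -> derivable (f ^~ v) x 1.
  by move=> _ _; case: (df x v).
have G0 v : 0 <= `|B v| * expR (- (a * v ^+ 2)) by rewrite mulr_ge0 ?expR_ge0.
have intG : mu.-integrable half (EFin \o (fun v : mR => `|B v| * expR (- (a * v ^+ 2)))).
  by apply: subexp_integrable_half => //; exact: subexp_norm.
have Gub x v : `]t - 1, t + 1[%classic x -> half v ->
    `|partial1of2 f x v| <= `|B v| * expR (- (a * v ^+ 2)).
  move=> _ _; rewrite d1E normrM [`|expR _|]ger0_norm ?expR_ge0//.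
  by rewrite ler_wpM2r ?expR_ge0// (le_trans (kB _ _))// ler_norm.
have h1 := @derivable_under_integral R _ mR mu f half measurable_half t _ _ tI
  intf derf _ G0 intG Gub.
have h2 := @differentiation_under_integral R _ mR mu f half measurable_half t _ _ tI
  intf derf _ G0 intG Gub.
apply: DeriveDef; first exact: h1.
rewrite -derive1E h2; apply: eq_Rintegral => v _; exact: d1E.
Qed.

Lemma is_derive_sin_aff (c d x : R) :
  is_derive x (1 : R) (fun x : R => sin (c * x + d)) (c * cos (c * x + d)).
Proof.
have h : is_derive x (1 : R) ((fun x : R => c * x ^+ 1) + cst d) (c * 1%:R * x ^+ 0 + 0).
  by apply: is_deriveD; exact: is_derive_scaleX.
have := @is_derive1_comp R sin _ x _ _ (is_derive_sin _) h.
rewrite (_ : sin \o _ = (fun x : R => sin (c * x + d))); last first.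
  by apply/funext => y /=; rewrite !fctE.
by rewrite !fctE expr1 expr0 addr0 !mulr1 mulrC.
Qed.

Lemma is_derive_cos_aff (c d x : R) :
  is_derive x (1 : R) (fun x : R => cos (c * x + d)) (- (c * sin (c * x + d))).
Proof.
have := is_derive_sin_aff c (d + pi / 2) x.
rewrite addrA cosDpihalf mulrN.
by under eq_fun do rewrite addrA sinDpihalf.
Qed.

End half_calculus.

Section sine_transforms.
Context {R : realType}.
Local Notation mR := (measurableTypeR R).
Local Notation mu := (@lebesgue_measure R).
Local Notation half := (`[0, +oo[%classic : set mR).
Local Notation sq := (@sq R).
Local Notation E v := (expR (- (4^-1 * v ^+ 2))).

(* Letter s or c: sine or cosine transform; each v: a factor v under the integral. *)
Definition Gs (u : R) : R := \int[mu]_(v in half) (sin (u * v / 2) * E v).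
Definition Gc (u : R) : R := \int[mu]_(v in half) (cos (u * v / 2) * E v).
Definition Gvs (u : R) : R := \int[mu]_(v in half) ((v * sin (u * v / 2)) * E v).
Definition Gvc (u : R) : R := \int[mu]_(v in half) ((v * cos (u * v / 2)) * E v).
Definition Gvvc (u : R) : R := \int[mu]_(v in half) ((v ^+ 2 * cos (u * v / 2)) * E v).

Let q40 : 0 < 4^-1 :> R. Proof. by rewrite invr_gt0. Qed.

Lemma is_derive_sin_uv (u v : R) :
  is_derive u (1 : R) (fun u => sin (u * v / 2)) (v / 2 * cos (u * v / 2)).
Proof.
have := is_derive_sin_aff (v / 2) 0 u.
under eq_fun do rewrite addr0 mulrC mulrA.
by rewrite addr0 [v / 2 * u]mulrC mulrA.
Qed.

Lemma is_derive_cos_uv (u v : R) :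
  is_derive u (1 : R) (fun u => cos (u * v / 2)) (- (v / 2 * sin (u * v / 2))).
Proof.
have := is_derive_cos_aff (v / 2) 0 u.
under eq_fun do rewrite addr0 mulrC mulrA.
by rewrite addr0 [v / 2 * u]mulrC mulrA.
Qed.

Lemma is_derive_sin_vu (u v : R) :
  is_derive v (1 : R) (fun v => sin (u * v / 2)) (u / 2 * cos (u * v / 2)).
Proof. by under eq_fun do rewrite (mulrC u); rewrite (mulrC u v); exact: is_derive_sin_uv. Qed.

Lemma is_derive_cos_vu (u v : R) :
  is_derive v (1 : R) (fun v => cos (u * v / 2)) (- (u / 2 * sin (u * v / 2))).
Proof. by under eq_fun do rewrite (mulrC u); rewrite (mulrC u v); exact: is_derive_cos_uv. Qed.

Lemma measurable_uv (u : R) : measurable_fun setT (fun v : mR => u * v / 2).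
Proof. by apply: measurable_funM => //; exact: measurable_funM. Qed.

Lemma subexp_sin_uv (u : R) : subexp sq (fun v : mR => sin (u * v / 2)).
Proof. by apply: subexp_sin; [exact: sq_ge0|exact: measurable_uv]. Qed.

Lemma subexp_cos_uv (u : R) : subexp sq (fun v : mR => cos (u * v / 2)).
Proof. by apply: subexp_cos; [exact: sq_ge0|exact: measurable_uv]. Qed.

Lemma subexp_vpow k : subexp sq (fun v : mR => (v : R) ^+ k).
Proof. by apply: subexpX; [exact: sq_ge0|exact: subexp_id]. Qed.

Let sE (f : mR -> R) : subexp sq f -> mu.-integrable half (EFin \o (fun v => f v * E v)).
Proof. by move=> sf; exact: subexp_integrable_half. Qed.

Lemma half_intZ (c : R) (f : mR -> R) : subexp sq f ->
  \int[mu]_(v in half) ((c * f v) * E v) = c * \int[mu]_(v in half) (f v * E v).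
Proof.
move=> sf; rewrite -RintegralZl//; last exact: sE.
  by apply: eq_Rintegral => v _; rewrite mulrA.
Qed.

Lemma half_intD (f g : mR -> R) : subexp sq f -> subexp sq g ->
  \int[mu]_(v in half) ((f v + g v) * E v) =
  \int[mu]_(v in half) (f v * E v) + \int[mu]_(v in half) (g v * E v).
Proof.
move=> sf sg; rewrite -RintegralD//; [|exact: sE|exact: sE].
by apply: eq_Rintegral => v _; rewrite mulrDl.
Qed.

Lemma is_derive_Gs u : is_derive u (1 : R) Gs (Gvc u / 2).
Proof.
have := @half_DUI R (fun u v => sin (u * v / 2)) (fun u v => v / 2 * cos (u * v / 2))
  (fun v => `|v|) 4^-1 q40 (subexp_norm subexp_id) subexp_sin_uv is_derive_sin_uv.
move=> /(_ _ u) h.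
have {}h := h _.
have -> : Gvc u / 2 = \int[mu]_(v in half) (v / 2 * cos (u * v / 2) * E v).
  rewrite mulrC -half_intZ; last first.
    by apply: subexpM; [exact: subexp_id|exact: subexp_cos_uv].
  by apply: eq_Rintegral => v _; ring.
apply: h => t v; rewrite normrM.
have c1 : `|cos (t * v / 2)| <= 1 by rewrite ler_norml cos_geN1 cos_le1.
rewrite normrM (@ger0_norm _ 2^-1)//.
have := normr_ge0 v; nra.
Qed.

Lemma is_derive_Gc u : is_derive u (1 : R) Gc (- (Gvs u / 2)).
Proof.
have := @half_DUI R (fun u v => cos (u * v / 2)) (fun u v => - (v / 2 * sin (u * v / 2)))
  (fun v => `|v|) 4^-1 q40 (subexp_norm subexp_id) subexp_cos_uv is_derive_cos_uv.
move=> /(_ _ u) h.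
have {}h := h _.
have -> : - (Gvs u / 2) = \int[mu]_(v in half) (- (v / 2 * sin (u * v / 2)) * E v).
  rewrite mulrC -mulNr -half_intZ; last first.
    by apply: subexpM; [exact: subexp_id|exact: subexp_sin_uv].
  by apply: eq_Rintegral => v _; ring.
apply: h => t v; rewrite normrN normrM.
have c1 : `|sin (t * v / 2)| <= 1 by rewrite ler_norml sin_geN1 sin_le1.
rewrite normrM (@ger0_norm _ 2^-1)//.
have := normr_ge0 v; nra.
Qed.

Lemma GvsE u : Gvs u = u * Gc u.
Proof.
have := @half_IBP R (fun v => sin (u * v / 2)) (fun v => u / 2 * cos (u * v / 2)) 4^-1
  q40 (subexp_sin_uv u) _ (is_derive_sin_vu u) _.
rewrite mulr0 mul0r sin0 oppr0 => h.
have {h} : \int[mu]_(x in half) ((u / 2 * cos (u * x / 2) - 2 / 4 * x * sin (u * x / 2)) * E x) = 0.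
  apply: h.
    by apply: subexpZ; [exact: sq_ge0|exact: subexp_cos_uv].
  move=> v; apply: cvgM; first exact: cvg_cst.
  exact: continuous_of_is_derive (is_derive_cos_vu u) v.
have sC : subexp sq (fun v => u / 2 * cos (u * v / 2)).
  by apply: subexpZ; [exact: sq_ge0|exact: subexp_cos_uv].
have sS : subexp sq (fun v : mR => v * sin (u * v / 2)).
  by apply: subexpM; [exact: subexp_id|exact: subexp_sin_uv].
have -> : \int[mu]_(x in half) ((u / 2 * cos (u * x / 2) - 2 / 4 * x * sin (u * x / 2)) * E x) =
   u / 2 * Gc u + (- 2^-1) * Gvs u.
  rewrite -half_intZ; last exact: subexp_cos_uv.
  rewrite -half_intZ// -half_intD//; last by apply: subexpZ; [exact: sq_ge0|].
  by apply: eq_Rintegral => v _; field.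
lra.
Qed.

Lemma GvcE u : Gvc u = 2 - u * Gs u.
Proof.
have := @half_IBP R (fun v => cos (u * v / 2)) (fun v => - (u / 2 * sin (u * v / 2))) 4^-1
  q40 (subexp_cos_uv u) _ (is_derive_cos_vu u) _.
rewrite mulr0 mul0r cos0 => h.
have {h} : \int[mu]_(x in half) ((- (u / 2 * sin (u * x / 2)) - 2 / 4 * x * cos (u * x / 2)) * E x) = -1.
  apply: h.
    by apply: subexpN; apply: subexpZ; [exact: sq_ge0|exact: subexp_sin_uv].
  move=> v; apply: cvgN; apply: cvgM; first exact: cvg_cst.
  exact: continuous_of_is_derive (is_derive_sin_vu u) v.
have sC : subexp sq (fun v => - (u / 2) * sin (u * v / 2)).
  by apply: subexpZ; [exact: sq_ge0|exact: subexp_sin_uv].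
have sS : subexp sq (fun v : mR => v * cos (u * v / 2)).
  by apply: subexpM; [exact: subexp_id|exact: subexp_cos_uv].
have -> : \int[mu]_(x in half) ((- (u / 2 * sin (u * x / 2)) - 2 / 4 * x * cos (u * x / 2)) * E x) =
   - (u / 2) * Gs u + (- 2^-1) * Gvc u.
  rewrite -half_intZ; last exact: subexp_sin_uv.
  rewrite -half_intZ// -half_intD//; last by apply: subexpZ; [exact: sq_ge0|].
  by apply: eq_Rintegral => v _; field.
lra.
Qed.

Lemma GvvcE u : Gvvc u = (2 - u ^+ 2) * Gc u.
Proof.
have dF v : is_derive (v : R) (1 : R) (fun v => v * cos (u * v / 2))
    (cos (u * v / 2) - u / 2 * (v * sin (u * v / 2))).
  have := is_deriveM (is_derive_id v (1 : R)) (is_derive_cos_vu u v).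
  set A := (X in is_derive _ _ _ X).
  have -> // : A = cos (u * v / 2) - u / 2 * (v * sin (u * v / 2)).
  by rewrite /A /GRing.scale/=; ring.
have sF : subexp sq (fun v : mR => v * cos (u * v / 2)).
  by apply: subexpM; [exact: subexp_id|exact: subexp_cos_uv].
have sS : subexp sq (fun v : mR => v * sin (u * v / 2)).
  by apply: subexpM; [exact: subexp_id|exact: subexp_sin_uv].
have sdF : subexp sq (fun v => cos (u * v / 2) - u / 2 * (v * sin (u * v / 2))).
  by apply: subexpB; [exact: subexp_cos_uv|apply: subexpZ; [exact: sq_ge0|]].
have sV : subexp sq (fun v : mR => (v : R) ^+ 2 * cos (u * v / 2)).
  by apply: subexpM; [exact: subexp_vpow|exact: subexp_cos_uv].
have := @half_IBP R _ _ 4^-1 q40 sF sdF dF _.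
rewrite mul0r oppr0 => h.
have {h} : \int[mu]_(x in half) ((cos (u * x / 2) - u / 2 * (x * sin (u * x / 2)) -
    2 / 4 * x * (x * cos (u * x / 2))) * E x) = 0.
  apply: h => v.
  have c1 : (fun v => cos (u * v / 2)) @ v --> cos (u * v / 2).
    exact: continuous_of_is_derive (is_derive_cos_vu u) v.
  have c2 : (fun v => sin (u * v / 2)) @ v --> sin (u * v / 2).
    exact: continuous_of_is_derive (is_derive_sin_vu u) v.
  have c3 : (fun v : R => v * sin (u * v / 2)) @ v --> v * sin (u * v / 2).
    by apply: cvgM => //; exact: cvg_id.
  by apply: cvgB => //; apply: cvgM => //; exact: cvg_cst.
have -> : \int[mu]_(x in half) ((cos (u * x / 2) - u / 2 * (x * sin (u * x / 2)) -
    2 / 4 * x * (x * cos (u * x / 2))) * E x) =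
   Gc u + - (u / 2) * Gvs u + (- 2^-1) * Gvvc u.
  rewrite -half_intZ// -half_intZ// -!half_intD//.
  1: by apply: eq_Rintegral => v _; field.
  all: try first [ exact: subexp_cos_uv | by apply: subexpZ; [exact: sq_ge0|]
    | by apply: subexpD; [exact: subexp_cos_uv|apply: subexpZ; [exact: sq_ge0|]] ].
rewrite GvsE; lra.
Qed.

End sine_transforms.

Section evenness.
Context {R : realType}.
Local Notation mR := (measurableTypeR R).
Local Notation mu := (@lebesgue_measure R).
Local Notation half := (`[0, +oo[%classic : set mR).

Lemma Rintegral_oppr (f : mR -> R) : measurable_fun setT f ->
  \int[mu]_x f (- x) = \int[mu]_x f x.
Proof.
move=> mf; have mf' : measurable_fun [set: mR] (EFin \o f) by exact/measurable_EFinP.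
rewrite /Rintegral; congr fine; rewrite integralE [RHS]integralE; congr (_ - _)%E.
  rewrite -[RHS](ge0_integral_oppr (f := ((EFin \o f)^\+)%E)); last 2 first.
  - exact: measurable_funepos.
  - by move=> z; exact: funepos_ge0.
  by apply: eq_integral => z _; rewrite !funeposE.
rewrite -[RHS](ge0_integral_oppr (f := ((EFin \o f)^\-)%E)); last 2 first.
- exact: measurable_funeneg.
- by move=> z; exact: funeneg_ge0.
by apply: eq_integral => z _; rewrite !funenegE.
Qed.

Lemma Rintegral_odd (f : mR -> R) : mu.-integrable setT (EFin \o f) ->
  (forall x, f (- x) = - f x) -> \int[mu]_x f x = 0.
Proof.
move=> intf fN.
have mf : measurable_fun setT f by apply/measurable_EFinP; exact: measurable_int intf.
have := Rintegral_oppr mf.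
under eq_Rintegral do rewrite fN -mulN1r.
rewrite RintegralZl//; lra.
Qed.

Lemma Rintegral_even (f : mR -> R) : mu.-integrable setT (EFin \o f) ->
  (forall x, f (- x) = f x) -> \int[mu]_x f x = 2 * \int[mu]_(x in half) f x.
Proof.
move=> intf fN.
have mf : measurable_fun setT f by apply/measurable_EFinP; exact: measurable_int intf.
pose neg := (`]-oo, 0[%classic : set mR).
have mneg : measurable neg by exact: measurable_itv.
have -> : [set: mR] = half `|` neg.
  apply/seteqP; split => // x _; rewrite /half /neg/= !in_itv/= andbT.
  by have [|] := leP 0 x; [left|right].
rewrite Rintegral_setU//; last 2 first.
- by apply: integrableS intf => //; apply: measurableU => //; exact: measurable_half.
- apply/disj_setPS => x []; rewrite /half /neg/= !in_itv/= andbT => x0.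
  by rewrite ltNge x0.
rewrite mulr_natl mulr2n; congr (_ + _).
rewrite Rintegral_mkcond -Rintegral_oppr; last first.
  by apply/(measurable_restrictT _ _).1 => //; exact: measurable_funTS.
rewrite [RHS]Rintegral_mkcond.
transitivity (\int[mu]_x (f \_ (`]0, +oo[%classic : set mR)) x).
  apply: eq_Rintegral => x _; rewrite !patchE fN.
  congr (if _ then _ else _); rewrite /neg !mem_setE !in_itv/= andbT.
  by rewrite oppr_lt0.
rewrite -!Rintegral_mkcond; apply: Rintegral_itv_obnd_cbnd.
by apply: integrableS intf => //; exact: measurable_itv.
Qed.

End evenness.

Section closed_forms.
Context {R : realType}.
Local Notation mR := (measurableTypeR R).
Local Notation mu := (@lebesgue_measure R).
Local Notation half := (`[0, +oo[%classic : set mR).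
Local Notation sq := (@sq R).
Local Notation E v := (expR (- (4^-1 * v ^+ 2))).

Lemma is_derive_expR_quad (c x : R) :
  is_derive x (1 : R) (fun x : R => expR (c * x ^+ 2)) (expR (c * x ^+ 2) * (c * 2%:R * x ^+ 1)).
Proof.
have -> : (fun x : R => expR (c * x ^+ 2)) = expR \o (fun x : R => c * x ^+ 2) by [].
by apply: is_derive1_comp; exact: is_derive_scaleX.
Qed.

Lemma Gc_closed (u : R) : Gc u = Gc 0 * E u.
Proof.
pose F := (Gc : R -> R) * (fun x : R => expR (4^-1 * x ^+ 2)).
have dF x : is_derive x (1 : R) F 0.
  have := is_deriveM (is_derive_Gc x) (is_derive_expR_quad 4^-1 x).
  set A := (X in is_derive _ _ _ X); have -> // : A = 0.
  by rewrite /A /GRing.scale/= GvsE expr1; field.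
have := is_derive_0_is_cst u 0 dF.
rewrite /F !fctE expr0n/= mulr0 expR0 mulr1 => <-.
by rewrite -mulrA -expRD subrr expR0 mulr1.
Qed.

Lemma half_gauss (a : R) : 0 < a ->
  \int[mu]_(x in half) expR (- (a * x ^+ 2)) = 2^-1 * Num.sqrt (pi / a).
Proof.
move=> a0; have := Rintegral_even (integrable_gauss_scale a0).
rewrite {1}/Rintegral integral_gauss_scale//= => ->; last by move=> x; rewrite sqrrN.
by rewrite mulrA mulVf// mul1r.
Qed.

Lemma Gc0 : Gc 0 = Num.sqrt pi :> R.
Proof.
rewrite /Gc; under eq_Rintegral do rewrite !mul0r cos0 mul1r.
rewrite half_gauss ?invr_gt0// invrK mulrC sqrtrM ?pi_ge0//.
have -> : Num.sqrt (4 : R) = 2.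
  have -> : (4 : R) = 2 ^+ 2 by ring.
  by rewrite sqrtr_sqr ger0_norm.
by field.
Qed.

Let half_IBPpow (a : R) k : 0 < a ->
  \int[mu]_(x in half) ((k.+1%:R * x ^+ k - 2 * a * x * x ^+ k.+1) * expR (- (a * x ^+ 2))) = 0.
Proof.
move=> a0.
have dF (x : R) : is_derive x (1 : R) (fun x : R => x ^+ k.+1) (k.+1%:R * x ^+ k).
  have := is_derive_scaleX 1 k x; rewrite mul1r.
  by under eq_fun do rewrite mul1r.
have := @half_IBP R (fun x => x ^+ k.+1) (fun x => k.+1%:R * x ^+ k) a a0
  (subexp_vpow k.+1) _ dF _.
rewrite expr0n/= oppr0; apply.
  by apply: subexpZ; [exact: sq_ge0|exact: subexp_vpow].
by move=> x; apply: cvgM; [exact: cvg_cst|exact: exprn_continuous].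
Qed.

Definition Hm (a : R) k : R := \int[mu]_(x in half) (x ^+ k * expR (- (a * x ^+ 2))).

Lemma HmSS (a : R) k : 0 < a -> Hm a k.+2 = k.+1%:R / (2 * a) * Hm a k.
Proof.
move=> a0; have := half_IBPpow k a0.
have i1 := subexp_integrable_half (subexpZ sq_ge0 k.+1%:R (@subexp_vpow R k)) a0.
have i2 := subexp_integrable_half (subexpZ sq_ge0 (2 * a) (@subexp_vpow R k.+2)) a0.
have j1 := subexp_integrable_half (@subexp_vpow R k) a0.
have j2 := subexp_integrable_half (@subexp_vpow R k.+2) a0.
have -> : \int[mu]_(x in half) ((k.+1%:R * x ^+ k - 2 * a * x * x ^+ k.+1) * expR (- (a * x ^+ 2)))
    = k.+1%:R * Hm a k - (2 * a) * Hm a k.+2.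
  rewrite /Hm -!RintegralZl// -RintegralB//.
  - by apply: eq_Rintegral => x _; rewrite [x ^+ k.+2]exprS; ring.
  - by apply: eq_integrable i1 => // x _ /=; rewrite mulrA.
  - by apply: eq_integrable i2 => // x _ /=; rewrite mulrA.
move=> h; have a20 : 2 * a != 0 by rewrite mulf_neq0// gt_eqF.
apply: (mulfI a20); rewrite mulrA mulrCA divff// mulr1; lra.
Qed.

Lemma Hm1 : Hm 4^-1 1 = 2.
Proof.
have := GvcE (0 : R); rewrite mul0r subr0 => <-.
by apply: eq_Rintegral => x _; rewrite !mul0r cos0 mulr1 expr1.
Qed.

Lemma Hm3 : Hm 4^-1 3 = 8.
Proof. by rewrite HmSS ?invr_gt0// Hm1; field. Qed.

Lemma Hm5 : Hm 4^-1 5 = 64.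
Proof. by rewrite HmSS ?invr_gt0// Hm3; field. Qed.

Lemma GsN (u : R) : Gs (- u) = - Gs u.
Proof.
rewrite /Gs -[RHS]mulN1r -half_intZ; last exact: subexp_sin_uv.
apply: eq_Rintegral => x _; have -> : - u * x / 2 = - (u * x / 2) by ring.
by rewrite sinN mulN1r.
Qed.

Lemma Gs_ub (u : R) : 0 <= u -> Gs u <= u - 6^-1 * u ^+ 3 + 60^-1 * u ^+ 5.
Proof.
move=> u0.
have q40 : 0 < 4^-1 :> R by rewrite invr_gt0.
have sZ c k : subexp sq (fun x : mR => c * x ^+ k) by apply: subexpZ; [exact: sq_ge0|exact: subexp_vpow].
have -> : u - 6^-1 * u ^+ 3 + 60^-1 * u ^+ 5 =
   u / 2 * Hm 4^-1 1 + (- (48^-1 * u ^+ 3)) * Hm 4^-1 3 + 3840^-1 * u ^+ 5 * Hm 4^-1 5.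
  by rewrite Hm1 Hm3 Hm5; field.
rewrite /Hm -(half_intZ _ (subexp_vpow 1)) -(half_intZ _ (subexp_vpow 3))
  -(half_intZ _ (subexp_vpow 5)) -half_intD// -half_intD//; last exact: subexpD.
apply: le_Rintegral; first exact: measurable_half.
- exact: subexp_integrable_half (subexp_sin_uv u) q40.
- by apply: subexp_integrable_half => //; apply: subexpD => //; exact: subexpD.
move=> x; rewrite /= in_itv/= andbT => x0; rewrite ler_wpM2r ?expR_ge0//.
have x1 : 0 <= u * x / 2 by rewrite divr_ge0// mulr_ge0.
by apply: le_trans (sin_ub5 x1) _; rewrite le_eqVlt; apply/orP; left; apply/eqP; field.
Qed.

Lemma Gs_lb (u : R) : 0 <= u -> u - 6^-1 * u ^+ 3 <= Gs u.
Proof.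
move=> u0.
have q40 : 0 < 4^-1 :> R by rewrite invr_gt0.
have sZ c k : subexp sq (fun x : mR => c * x ^+ k) by apply: subexpZ; [exact: sq_ge0|exact: subexp_vpow].
have -> : u - 6^-1 * u ^+ 3 = u / 2 * Hm 4^-1 1 + (- (48^-1 * u ^+ 3)) * Hm 4^-1 3.
  by rewrite Hm1 Hm3; field.
rewrite /Hm -(half_intZ _ (subexp_vpow 1)) -(half_intZ _ (subexp_vpow 3)) -half_intD//.
apply: le_Rintegral; first exact: measurable_half.
- by apply: subexp_integrable_half => //; exact: subexpD.
- exact: subexp_integrable_half (subexp_sin_uv u) q40.
move=> x; rewrite /= in_itv/= andbT => x0; rewrite ler_wpM2r ?expR_ge0//.
have x1 : 0 <= u * x / 2 by rewrite divr_ge0// mulr_ge0.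
by apply: le_trans _ (sin_lb3 x1); rewrite le_eqVlt; apply/orP; left; apply/eqP; field.
Qed.

End closed_forms.

Section dawson_integral.
Context {R : realType}.
Local Notation mR := (measurableTypeR R).
Local Notation mu := (@lebesgue_measure R).
Local Notation half := (`[0, +oo[%classic : set mR).
Local Notation sq := (@sq R).
Local Notation E v := (expR (- (4^-1 * v ^+ 2))).

Let q40 : 0 < 4^-1 :> R. Proof. by rewrite invr_gt0. Qed.

Lemma measurable_of_is_derive (F f : R -> R) :
  (forall x, is_derive x (1 : R) F (f x)) -> measurable_fun [set: mR] F.
Proof.
move=> dF; apply: continuous_measurable_fun; exact: continuous_of_is_derive dF.
Qed.

Lemma normr_Gvc_le (u : R) : `|Gvc u| <= 2.
Proof.
have sV : subexp sq (fun v : mR => (v : R) * cos (u * v / 2)).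
  by apply: subexpM; [exact: subexp_id|exact: subexp_cos_uv].
rewrite -Hm1 /Gvc /Hm.
apply: le_trans (le_normr_Rintegral (@measurable_half R) (subexp_integrable_half sV q40)) _.
apply: le_Rintegral; first exact: measurable_half.
- exact: integrable_norm (subexp_integrable_half sV q40).
- exact: subexp_integrable_half (subexp_vpow 1) q40.
move=> x; rewrite /= in_itv/= andbT => x0.
rewrite normrM [`|expR _|]ger0_norm ?expR_ge0// ler_wpM2r ?expR_ge0//.
rewrite normrM ger0_norm// expr1 ler_piMr//.
by rewrite ler_norml cos_geN1 cos_le1.
Qed.

Lemma normr_Gs_le (u : R) : `|Gs u| <= Num.sqrt pi.
Proof.
have sV : subexp sq (fun v : mR => sin (u * v / 2)) by exact: subexp_sin_uv.
rewrite -Gc0 /Gs /Gc.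
apply: le_trans (le_normr_Rintegral (@measurable_half R) (subexp_integrable_half sV q40)) _.
apply: le_Rintegral; first exact: measurable_half.
- exact: integrable_norm (subexp_integrable_half sV q40).
- exact: subexp_integrable_half (subexp_cos_uv 0) q40.
move=> x _; rewrite normrM [`|expR _|]ger0_norm ?expR_ge0// ler_wpM2r ?expR_ge0//.
by rewrite !mul0r cos0 ler_norml sin_geN1 sin_le1.
Qed.

Lemma subexp_Gs (t : R) : subexp sq (fun u : mR => Gs (t * u)).
Proof.
apply: (@subexp_bounded _ _ _ _ (@sq_ge0 R) _ (Num.sqrt pi)) => [|u]; last exact: normr_Gs_le.
apply: (measurableT_comp (measurable_of_is_derive is_derive_Gs)).
exact: measurable_funM.
Qed.

Lemma is_derive_Gvc (u : R) : is_derive u (1 : R) Gvc (- (Gs u + u * (Gvc u / 2))).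
Proof.
have -> : (Gvc : R -> R) = cst 2 - (id : R -> R) * (Gs : R -> R).
  by apply/funext => y; rewrite GvcE !fctE.
have := is_deriveB (is_derive_cst (2 : R) u (1 : R)) (is_deriveM (is_derive_id u (1 : R)) (is_derive_Gs u)).
set A := (X in is_derive _ _ _ X); have -> : A = - (Gs u + u * (Gvc u / 2)).
  by rewrite /A /GRing.scale/=; ring.
by rewrite GvcE !fctE.
Qed.

Lemma subexp_Gvc (t : R) : subexp sq (fun u : mR => Gvc (t * u)).
Proof.
apply: (@subexp_bounded _ _ _ _ (@sq_ge0 R) _ 2) => [|u]; last exact: normr_Gvc_le.
apply: (measurableT_comp (measurable_of_is_derive is_derive_Gvc)).
exact: measurable_funM.
Qed.

Definition Lf (t : R) : R := \int[mu]_(u in half) (Gs (t * u) * E u).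
Definition Lf1 (t : R) : R := \int[mu]_(u in half) ((u * Gvc (t * u)) * E u).

Lemma is_derive_scale (c x : R) (F : R -> R) (f : R) :
  is_derive (c * x) (1 : R) F f -> is_derive x (1 : R) (fun x => F (c * x)) (f * c).
Proof.
move=> dF; have h : is_derive x (1 : R) (fun x : R => c * x) c.
  have := is_derive_scaleX c 0 x; rewrite expr0 !mulr1.
  by under eq_fun do rewrite expr1.
exact: (@is_derive1_comp _ F (fun x => c * x)).
Qed.

Lemma is_derive_Lf (t : R) : is_derive t (1 : R) Lf (2^-1 * Lf1 t).
Proof.
have sB : subexp sq (fun u : mR => `|u : R|) by exact: subexp_norm subexp_id.
have dk (s u : R) : is_derive s (1 : R) (fun s => Gs (s * u)) (2^-1 * (u * Gvc (s * u))).
  have := is_derive_Gs (u * s) => /is_derive_scale.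
  under eq_fun do rewrite mulrC.
  by have -> : Gvc (u * s) / 2 * u = 2^-1 * (u * Gvc (s * u)) by rewrite [s * u]mulrC; ring.
have kB (s u : R) : `|2^-1 * (u * Gvc (s * u))| <= `|u|.
  rewrite !normrM (@ger0_norm _ 2^-1)//; have := normr_Gvc_le (s * u).
  have := normr_ge0 u; nra.
have := half_DUI q40 sB subexp_Gs dk kB t.
rewrite half_intZ//; apply: subexpM; [exact: subexp_id|exact: subexp_Gvc].
Qed.

Lemma Lf_ODE (t : R) : (1 + t ^+ 2) * (2^-1 * Lf1 t) = 2 - t * Lf t.
Proof.
have sG := subexp_Gs t.
have sV : subexp sq (fun u : mR => (u : R) * Gvc (t * u)).
  by apply: subexpM; [exact: subexp_id|exact: subexp_Gvc].
have dF (u : R) : is_derive u (1 : R) (fun u => Gvc (t * u))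
   (- t * Gs (t * u) + - (2^-1 * t ^+ 2) * (u * Gvc (t * u))).
  have := is_derive_Gvc (t * u) => /is_derive_scale.
  set A := (X in is_derive _ _ _ X); have -> // : A = - t * Gs (t * u) + - (2^-1 * t ^+ 2) * (u * Gvc (t * u)).
  by rewrite /A; ring.
have cG : continuous (fun u : R => Gs (t * u)).
  have dG (u : R) : is_derive u (1 : R) (fun u => Gs (t * u)) (Gvc (t * u) / 2 * t).
    exact: is_derive_scale (is_derive_Gs _).
  exact: continuous_of_is_derive dG.
have cV : continuous (fun u : R => Gvc (t * u)) by exact: continuous_of_is_derive dF.
have sdF : subexp sq (fun u => - t * Gs (t * u) + - (2^-1 * t ^+ 2) * (u * Gvc (t * u))).
  by apply: subexpD; apply: subexpZ => //; exact: sq_ge0.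
have := half_IBP q40 (subexp_Gvc t) sdF dF _.
rewrite mulr0 [Gvc 0]GvcE mul0r subr0 => h.
have {h} : \int[mu]_(x in half) ((- t * Gs (t * x) + - (2^-1 * t ^+ 2) * (x * Gvc (t * x)) -
    2 / 4 * x * Gvc (t * x)) * E x) = - 2.
  apply: h => u; have c1 : (fun u : R => u * Gvc (t * u)) @ u --> u * Gvc (t * u).
    by apply: cvgM; [exact: cvg_id|exact: cV].
  apply: cvgD; apply: cvgM => //; try exact: cvg_cst.
  exact: cG.
have -> : \int[mu]_(x in half) ((- t * Gs (t * x) + - (2^-1 * t ^+ 2) * (x * Gvc (t * x)) -
    2 / 4 * x * Gvc (t * x)) * E x) = - t * Lf t + (- (2^-1 * t ^+ 2) - 2^-1) * Lf1 t.
  rewrite -(half_intZ _ sG) -(half_intZ _ sV) -half_intD; last 2 first.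
  - by apply: subexpZ => //; exact: sq_ge0.
  - by apply: subexpZ => //; exact: sq_ge0.
  by apply: eq_Rintegral => u _; field.
lra.
Qed.

Lemma Lf0 : Lf 0 = 0.
Proof.
have G0 : Gs (0 : R) = 0 by have := GsN (0 : R); rewrite oppr0; lra.
rewrite /Lf; under eq_Rintegral do rewrite mul0r G0 mul0r.
by rewrite /Rintegral integral0.
Qed.

(* The substitution t = sinh y turns the linear equation for Lf into an exact one. *)
Lemma Lf1E : Num.sqrt 2 * Lf 1 = 2 * ln (1 + Num.sqrt 2).
Proof.
pose sh (y : R) := 2^-1 * (expR y - expR (- y)).
pose ch (y : R) := 2^-1 * (expR y + expR (- y)).
have dN (y : R) : is_derive y (1 : R) (fun y => expR (- y)) (- expR (- y)).
  have := is_derive_scale (is_derive_expR (-1 * y)).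
  by rewrite mulN1r mulrN1; under eq_fun do rewrite mulN1r.
have dsh (y : R) : is_derive y (1 : R) sh (ch y).
  have := is_deriveZ 2^-1 (is_deriveB (is_derive_expR y) (dN y)).
  by rewrite opprK.
have dch (y : R) : is_derive y (1 : R) ch (sh y).
  by have := is_deriveZ 2^-1 (is_deriveD (is_derive_expR y) (dN y)).
have chsh y : ch y ^+ 2 = 1 + sh y ^+ 2.
  have := expRD y (- y); rewrite subrr expR0 /ch /sh => h.
  by rewrite !exprMn sqrrD sqrrB -h; field.
pose N := (ch : R -> R) * (Lf \o sh) - (fun y : R => 2 * y ^+ 1).
have dN0 (y : R) : is_derive y (1 : R) N 0.
  have dL : is_derive y (1 : R) (Lf \o sh) (2^-1 * Lf1 (sh y) * ch y).
    exact: is_derive1_comp (is_derive_Lf _) (dsh y).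
  have := is_deriveB (is_deriveM (dch y) dL) (is_derive_scaleX 2 0 y).
  set A := (X in is_derive _ _ _ X); have -> // : A = 0.
  rewrite /A /GRing.scale/= expr0.
  have := Lf_ODE (sh y); rewrite -chsh => h.
  have -> : ch y * (2^-1 * Lf1 (sh y) * ch y) = ch y ^+ 2 * (2^-1 * Lf1 (sh y)) by ring.
  rewrite h; ring.
pose y0 := ln (1 + Num.sqrt 2 : R).
have s2 : Num.sqrt 2 ^+ 2 = 2 :> R by rewrite sqr_sqrtr.
have s20 : 0 <= Num.sqrt 2 :> R by exact: sqrtr_ge0.
have ey : expR y0 = 1 + Num.sqrt 2 by rewrite lnK// posrE; lra.
have eNy : expR (- y0) = Num.sqrt 2 - 1.
  rewrite expRN ey; apply: (mulfI (_ : 1 + Num.sqrt 2 != 0)); first by rewrite gt_eqF//; lra.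
  rewrite divff; last by rewrite gt_eqF//; lra.
  have -> : (1 + Num.sqrt 2) * (Num.sqrt 2 - 1) = Num.sqrt 2 ^+ 2 - 1 :> R by ring.
  rewrite s2; lra.
have sh0 : sh y0 = 1 by rewrite /sh ey eNy; field.
have ch0 : ch y0 = Num.sqrt 2 by rewrite /ch ey eNy; field.
have := is_derive_0_is_cst y0 0 dN0.
rewrite /N !fctE /= sh0 ch0.
have -> : sh 0 = 0 by rewrite /sh oppr0 subrr mulr0.
rewrite Lf0 !expr1 !mulr0 -/y0 subr0 => h; apply/eqP; rewrite -subr_eq0 h eqxx.
by [].
Qed.

End dawson_integral.

Section sign_shift.
Context {R : realType}.
Local Notation mR := (measurableTypeR R).
Local Notation mu := (@lebesgue_measure R).
Implicit Types a u : R.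

(* The signed indicator function of the interval between 0 and a, up to the endpoints. *)
Definition chi a (u : mR) : R := (Num.sg u - Num.sg (u - a)) / 2.

Lemma sgr_shift a u : Num.sg (u - a) = Num.sg u - 2 * chi a u.
Proof. by rewrite /chi; field. Qed.

Lemma measurable_chi a : measurable_fun setT (chi a).
Proof.
apply: measurable_funM => //; apply: measurable_funB; first exact: measurable_sgr.
by apply: measurableT_comp; [exact: measurable_sgr|exact: measurable_funB].
Qed.

Lemma chiN a u : chi a (- u) = - chi (- a) u.
Proof.
rewrite /chi sgrN; have -> : - u - a = - (u - - a) by ring.
by rewrite sgrN; field.
Qed.

Lemma chi_out a u : `|a| < `|u| -> chi a u = 0.
Proof.
rewrite /chi => au.
suff -> : Num.sg (u - a) = Num.sg u by rewrite subrr mul0r.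
have [u0|u0] := leP 0 u.
  move: au; rewrite (ger0_norm u0) ltr_norml => /andP[h1 h2].
  by rewrite !gtr0_sg//; lra.
move: au; rewrite (ltr0_norm u0) ltr_norml => /andP[h1 h2].
by rewrite !ltr0_sg//; lra.
Qed.

Lemma normr_chi_sg a u : `|chi a u| = Num.sg a * chi a u.
Proof.
wlog a0 : a u / 0 <= a.
  move=> h; have [/h//|a0] := leP 0 a.
  have := h (- a) (- u); rewrite chiN opprK normrN sgrN mulrNN; apply.
  by rewrite oppr_ge0 ltW.
have [->|aN0] := eqVneq a 0; first by rewrite /chi subr0 subrr mul0r normr0 mulr0.
rewrite gtr0_sg ?lt0r ?aN0// mul1r ger0_norm// /chi divr_ge0// subr_ge0.
have [u0|u0|->] := ltgtP u 0.
- by rewrite !ltr0_sg//; lra.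
- by rewrite (gtr0_sg u0); case: (sgrP (u - a)) => _; lra.
- by rewrite sub0r sgrN sgr0 oppr_le0 sgr_ge0.
Qed.

Lemma normr_chi_le1 a u : `|chi a u| <= 1.
Proof.
rewrite /chi normrM (@ger0_norm _ 2^-1)// ler_pdivrMr// mul1r.
apply: le_trans (ler_normB _ _) _; rewrite !normr_sg.
by case: (u != 0); case: (u - a != 0) => /=; lra.
Qed.

Lemma normr_chi_odd a u k : `|chi a u| * `|u| ^+ (2 * k).+1 = chi a u * u ^+ (2 * k).+1.
Proof.
rewrite -normrX -normrM ger0_norm// exprS mulrA.
apply: mulr_ge0; last by rewrite exprM exprn_ge0// sqr_ge0.
have [u0|u0|->] := ltgtP u 0; last by rewrite mulr0.
  rewrite /chi (ltr0_sg u0); case: (sgrP (u - a)) => _; nra.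
rewrite /chi (gtr0_sg u0); case: (sgrP (u - a)) => _; nra.
Qed.

Lemma integrable_chi a (f : mR -> R) (M : R) : measurable_fun setT f ->
  (forall u, `|u| <= `|a| -> `|f u| <= M) ->
  mu.-integrable setT (EFin \o (fun u : mR => chi a u * f u)).
Proof.
move=> mf fM.
have M0 : 0 <= M by apply: le_trans (fM 0 _); rewrite ?normr0.
apply: (@le_integrable _ _ _ mu setT measurableT _
  (EFin \o (fun u : mR => M * expR (a ^+ 2) * expR (- (1 * u ^+ 2))))).
- by apply/measurable_EFinP; apply: measurable_funM => //; exact: measurable_chi.
- move=> u _ /=; rewrite lee_fin; apply: le_trans _ (ler_norm _).
  have [ua|au] := leP `|u| `|a|; last first.
    by rewrite (chi_out au) mul0r normr0 !mulr_ge0 ?expR_ge0.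
  rewrite normrM; apply: le_trans (ler_wpM2r (normr_ge0 _) (normr_chi_le1 a u)) _.
  rewrite mul1r -mulrA -expRD [leLHS]mul1r; apply: le_trans (fM _ ua) _; rewrite ler_peMr//.
  rewrite -[leLHS]expR0 ler_expR subr_ge0 -[u ^+ 2]real_normK ?num_real//.
  by rewrite -[leRHS]real_normK ?num_real// ler_pXn2r ?nnegrE.
- have := integrableZl measurableT (M * expR (a ^+ 2)) (integrable_gauss_scale (ltr01 : 0 < 1 :> R)).
  exact: eq_integrable.
Qed.

Lemma integrable_chi_pow a k :
  mu.-integrable setT (EFin \o (fun u : mR => chi a u * u ^+ k)).
Proof.
apply: (@integrable_chi a (fun u => u ^+ k) (`|a| ^+ k)); first exact: measurable_funX.
by move=> u ua; rewrite normrX lerXn2r ?nnegrE.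
Qed.

Lemma Rintegral_chi_pow a k :
  \int[mu]_u (chi a u * u ^+ k) = a ^+ k.+1 / k.+1%:R.
Proof.
wlog a0 : a / 0 <= a.
  move=> h; have [/h//|a0] := leP 0 a.
  rewrite -Rintegral_oppr; last first.
    by apply: measurable_funM; [exact: measurable_chi|exact: measurable_funX].
  have ik := integrable_chi_pow (- a) k.
  have -> : \int[mu]_x (chi a (- x) * (- x) ^+ k) =
      \int[mu]_x (- (-1) ^+ k * (chi (- a) x * x ^+ k)).
    apply: eq_Rintegral => x _; rewrite chiN (exprNn x); ring.
  rewrite RintegralZl// h; last by rewrite oppr_ge0 ltW.
  rewrite (exprNn a) exprS.
  have s1 : (-1) ^+ k * (-1) ^+ k = 1 :> R by rewrite -expr2 sqrr_sign.
  rewrite [LHS](_ : _ = ((-1) ^+ k * (-1) ^+ k) * (a ^+ k.+1 / k.+1%:R)); last by ring.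
  by rewrite s1 mul1r.
have [->|aN0] := eqVneq a 0.
  rewrite exprS !mul0r; under eq_Rintegral do rewrite /chi subr0 subrr !mul0r.
  by rewrite /Rintegral integral0.
have {}a0 : 0 < a by rewrite lt0r aN0.
have -> : \int[mu]_u (chi a u * u ^+ k) = \int[mu]_(u in (`]0, a[%classic : set mR)) (u ^+ k).
  transitivity (\int[mu]_(u in (`[0, a]%classic : set mR)) (chi a u * u ^+ k)).
    rewrite [RHS]Rintegral_mkcond; apply: eq_Rintegral => u _; rewrite patchE.
    case: ifPn => //; rewrite mem_setE in_itv/= negb_and -!ltNge => /orP[u0|ua].
      rewrite /chi (ltr0_sg u0) ltr0_sg ?subrr ?mul0r//; lra.
    rewrite chi_out ?mul0r// !ger0_norm ?ltW//; lra.
  rewrite /Rintegral; congr fine.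
  rewrite integral_itv_bndoo; last first.
    apply/measurable_EFinP; apply: measurable_funTS.
    by apply: measurable_funM; [exact: measurable_chi|exact: measurable_funX].
  apply: eq_integral => u; rewrite mem_setE in_itv/= => /andP[u0 ua].
  rewrite /chi (gtr0_sg u0) ltr0_sg; last by rewrite subr_lt0.
  by rewrite opprK (_ : (1 + 1) / 2 = 1 :> R) ?mul1r//; field.
rewrite /Rintegral -(@integral_itv_bndoo _ _ _ _ true false); last first.
  by apply/measurable_EFinP; apply: measurable_funTS; exact: measurable_funX.
have dF (x : R) : is_derive x (1 : R) (fun x : R => k.+1%:R^-1 * x ^+ k.+1) (x ^+ k).
  have := is_derive_scaleX (k.+1%:R^-1) k x.
  by rewrite mulVf ?pnatr_eq0// mul1r.
rewrite (continuous_FTC2_everywhere a0 dF); last exact: exprn_continuous.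
by rewrite /= expr0n/= mulr0 subr0 mulrC.
Qed.

End sign_shift.

Section plane.
Context {R : realType}.
Local Notation mR := (measurableTypeR R).
Local Notation mu := (@lebesgue_measure R).
Local Notation mu2 := (@lebesgue2 R).
Local Notation sq := (@sq R).

Lemma integrable_mu2M (f g : mR -> R) :
  mu.-integrable setT (EFin \o f) -> mu.-integrable setT (EFin \o g) ->
  mu2.-integrable setT (EFin \o (fun w => f w.1 * g w.2)).
Proof.
move=> intf intg.
have mf : measurable_fun setT f by apply/measurable_EFinP; exact: measurable_int intf.
have mg : measurable_fun setT g by apply/measurable_EFinP; exact: measurable_int intg.
apply/integrableP; split.
  by apply/measurable_EFinP; apply: measurable_funM; exact: measurableT_comp.
under eq_integral => w _ do rewrite /= normrM EFinM.
rewrite (ge0_integral_prodM mu mu (f := fun x => (`|f x|)%:E) (g := fun x => (`|g x|)%:E))//.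
- have /integrableP[_ h1] := intf; have /integrableP[_ h2] := intg.
  by apply: lte_mul_pinfty => //; [exact: integral_ge0|rewrite ge0_fin_numE//; exact: integral_ge0].
- by apply/measurable_EFinP; exact: measurableT_comp.
- by apply/measurable_EFinP; exact: measurableT_comp.
Qed.

Lemma Rintegral_mu2M (f g : mR -> R) :
  mu.-integrable setT (EFin \o f) -> mu.-integrable setT (EFin \o g) ->
  \int[mu2]_w (f w.1 * g w.2) = (\int[mu]_u f u) * (\int[mu]_v g v).
Proof.
move=> intf intg; rewrite (Rfubini12 (integrable_mu2M intf intg)) => [|x].
  rewrite -RintegralZr//; apply: eq_Rintegral => u _; rewrite /= RintegralZl//.
by have := integrableZl measurableT (f x) intg; exact: eq_integrable.
Qed.

Lemma subexp_pair1 (f : mR * mR -> R) u :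
  subexp sqnorm2 f -> subexp sq (fun v => f (u, v)).
Proof.
move=> [mf fC]; split=> [|e e0]; first exact: measurableT_comp mf (pair1_measurable u).
have [C fC'] := fC e e0; exists (C * expR (e * u ^+ 2)) => v.
by rewrite (le_trans (fC' _))// /sqnorm2 mulrDr expRD mulrA.
Qed.

Lemma subexp_swap (f : mR * mR -> R) :
  subexp sqnorm2 f -> subexp sqnorm2 (fun w => f (w.2, w.1)).
Proof.
move=> [mf fC]; split=> [|e e0]; first by apply: (measurableT_comp mf); exact: measurable_fun_pair.
by have [C fC'] := fC e e0; exists C => w; rewrite (le_trans (fC' _))// /sqnorm2/= addrC.
Qed.

Lemma Rintegral_mu2_iter (f : mR * mR -> R) a : subexp sqnorm2 f -> 0 < a ->
  \int[mu2]_w (f w * expR (- (a * sqnorm2 w))) =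
  \int[mu]_u ((\int[mu]_v (f (u, v) * expR (- (a * v ^+ 2)))) * expR (- (a * u ^+ 2))).
Proof.
move=> sf a0; have ie u := subexp_integrable1 (subexp_pair1 u sf) a0.
have sE u v : expR (- (a * @sqnorm2 R (u, v))) = expR (- (a * v ^+ 2)) * expR (- (a * u ^+ 2)).
  by rewrite /sqnorm2/= mulrDr opprD expRD mulrC.
rewrite (Rfubini12 (subexp_integrable2 sf a0)) => [|u].
  apply: eq_Rintegral => u _; rewrite -RintegralZr//.
  by apply: eq_Rintegral => v _; rewrite sE mulrA.
have := integrableZr measurableT (expR (- (a * u ^+ 2))) (ie u).
by apply: eq_integrable => // v _ /=; rewrite -EFinM sE mulrA.
Qed.

Lemma Rintegral_mu2_swap (f : mR * mR -> R) a : subexp sqnorm2 f -> 0 < a ->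
  \int[mu2]_w (f (w.2, w.1) * expR (- (a * sqnorm2 w))) =
  \int[mu2]_w (f w * expR (- (a * sqnorm2 w))).
Proof.
move=> sf a0; have ie u := subexp_integrable1 (subexp_pair1 u (subexp_swap sf)) a0.
have sE u v : expR (- (a * @sqnorm2 R (u, v))) = expR (- (a * u ^+ 2)) * expR (- (a * v ^+ 2)).
  by rewrite /sqnorm2/= mulrDr opprD expRD.
rewrite (Rintegral_mu2_iter (subexp_swap sf) a0).
rewrite (Rfubini21 (subexp_integrable2 sf a0)) => [|v].
  apply: eq_Rintegral => u _; rewrite -RintegralZr//.
  by apply: eq_Rintegral => v _; rewrite sE mulrA.
have := integrableZr measurableT (expR (- (a * v ^+ 2))) (ie v).
by apply: eq_integrable => // u _ /=; rewrite -EFinM sE mulrA.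
Qed.

End plane.

Section chi_moments.
Context {R : realType}.
Local Notation mR := (measurableTypeR R).
Local Notation mu := (@lebesgue_measure R).

Lemma normr_chi_pow (a u : R) k :
  `|chi a u| * `|u| ^+ k = Num.sg a ^+ k.+1 * (chi a u * u ^+ k).
Proof.
elim: k => [|k IH]; first by rewrite !expr0 !mulr1 expr1 normr_chi_sg.
rewrite exprSr mulrA IH.
have h1 : chi a u * `|u| = Num.sg a * (chi a u * u).
  have := normr_chi_odd a u 0; rewrite muln0 !expr1 normr_chi_sg => <-.
  have [->|aN0] := eqVneq a 0; first by rewrite sgr0 /chi subr0 subrr !mul0r.
  have s1 : Num.sg a * Num.sg a = 1 by rewrite -expr2 sqr_sg aN0.
  by rewrite !mulrA s1 mul1r.
rewrite (exprSr (Num.sg a) k.+1) (exprSr u k).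
transitivity (Num.sg a ^+ k.+1 * (u ^+ k * (chi a u * `|u|))); first by ring.
by rewrite h1; ring.
Qed.

Lemma integrable_normr_chi_pow (a : R) k :
  mu.-integrable setT (EFin \o (fun u : mR => `|chi a u| * `|u| ^+ k)).
Proof.
have := integrableZl measurableT (Num.sg a ^+ k.+1) (integrable_chi_pow a k).
by apply: eq_integrable => // u _ /=; rewrite -EFinM normr_chi_pow.
Qed.

Lemma Rintegral_normr_chi_pow (a : R) k :
  \int[mu]_u (`|chi a u| * `|u| ^+ k) = `|a| ^+ k.+1 / k.+1%:R.
Proof.
under eq_Rintegral do rewrite normr_chi_pow.
rewrite RintegralZl//; last exact: integrable_chi_pow.
by rewrite Rintegral_chi_pow mulrA -exprMn -normrEsg.
Qed.

End chi_moments.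

Lemma ler_normr_RintegralB d (T : measurableType d) (R : realType)
    (m : {measure set T -> \bar R}) (f g h : T -> R) :
  m.-integrable setT (EFin \o f) -> m.-integrable setT (EFin \o g) ->
  m.-integrable setT (EFin \o h) -> (forall x, `|f x - g x| <= h x) ->
  `|\int[m]_x f x - \int[m]_x g x| <= \int[m]_x h x.
Proof.
move=> intf intg inth fgh.
have intB : m.-integrable setT (EFin \o (fun x => f x - g x)).
  by have := integrableB measurableT intf intg; exact: eq_integrable.
rewrite -RintegralB//; apply: le_trans (le_normr_Rintegral measurableT intB) _.
apply: le_Rintegral => //; exact: integrable_norm intB.
Qed.

Section chi_expansions.
Context {R : realType}.
Local Notation mR := (measurableTypeR R).
Local Notation mu := (@lebesgue_measure R).
Local Notation mu2 := (@lebesgue2 R).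
Local Notation sq := (@sq R).
Local Notation E v := (expR (- (4^-1 * v ^+ 2))).
Local Notation E2 w := (expR (- (4^-1 * sqnorm2 w))).

Let q40 : 0 < 4^-1 :> R. Proof. by rewrite invr_gt0. Qed.

Lemma GsE_approx (u : R) : `|Gs u * E u - (u - 5 / 12 * u ^+ 3)| <= `|u| ^+ 5.
Proof.
wlog u0 : u / 0 <= u.
  move=> h; have [/h//|u0] := leP 0 u.
  have := h (- u); rewrite GsN sqrrN normrN oppr_ge0 ltW// => /(_ isT).
  move=> h1; rewrite -normrN (_ : - _ = - Gs u * E u - (- u - 5 / 12 * (- u) ^+ 3))//; ring.
rewrite (ger0_norm u0).
have G1 := Gs_ub u0; have G2 := Gs_lb u0.
have y0 : 0 <= 4^-1 * u ^+ 2 by rewrite mulr_ge0 ?sqr_ge0.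
have e1 := expR_ge1Dx (- (4^-1 * u ^+ 2)); have e2 := expRN_ub2 y0.
have e3 : E u <= 1 by rewrite -[leRHS]expR0 ler_expR oppr_le0.
have e4 := expR_gt0 (- (4^-1 * u ^+ 2)).
move: (E u) e1 e2 e3 e4 => e e1 e2 e3 e4.
have p5 : 0 <= u ^+ 5 by exact: exprn_ge0.
have p3 : 0 <= u ^+ 3 by exact: exprn_ge0.
set d := e - 1 + 4^-1 * u ^+ 2.
have d0 : 0 <= d by rewrite /d; lra.
have d1 : d <= 4^-1 * u ^+ 2 by rewrite /d; lra.
have d2 : d <= 32^-1 * u ^+ 4.
  rewrite /d; have -> : 32^-1 * u ^+ 4 = 2^-1 * (4^-1 * u ^+ 2) ^+ 2 by field.
  lra.
set g := Gs u - (u - 6^-1 * u ^+ 3).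
have g0 : 0 <= g by rewrite /g; lra.
have g1 : g <= 60^-1 * u ^+ 5 by rewrite /g; lra.
have -> : Gs u * e - (u - 5 / 12 * u ^+ 3) = g * e + u * d - 6^-1 * u ^+ 3 * d + 24^-1 * u ^+ 5.
  by rewrite /g /d; field.
have a1 : 0 <= g * e by rewrite mulr_ge0// ltW.
have a2 : g * e <= 60^-1 * u ^+ 5 by apply: le_trans g1; rewrite ler_piMr.
have a3 : 0 <= u * d by rewrite mulr_ge0.
have a4 : u * d <= 32^-1 * u ^+ 5.
  have := ler_wpM2l u0 d2; rewrite (_ : u * (32^-1 * u ^+ 4) = 32^-1 * u ^+ 5)//; ring.
have a5 : 0 <= u ^+ 3 * d by rewrite mulr_ge0.
have a6 : u ^+ 3 * d <= 4^-1 * u ^+ 5.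
  have := ler_wpM2l p3 d1; rewrite (_ : u ^+ 3 * (4^-1 * u ^+ 2) = 4^-1 * u ^+ 5)//; ring.
by rewrite ler_norml; apply/andP; split; lra.
Qed.

Lemma subexp_chi (a : R) : subexp sq (chi a).
Proof.
apply: (@subexp_bounded _ _ _ _ (@sq_ge0 R) _ 1); first exact: measurable_chi.
exact: normr_chi_le1.
Qed.

Lemma subexp_Gs1 : subexp sq (fun u : mR => Gs u).
Proof.
by have := @subexp_Gs R 1; under eq_fun do rewrite mul1r.
Qed.

Definition Hchi (a : R) : R := \int[mu]_u ((chi a u * (2 * Gs u)) * E u).

Lemma Hchi_approx (a : R) : `|Hchi a - (a ^+ 2 - 5 / 24 * a ^+ 4)| <= 3^-1 * `|a| ^+ 6.
Proof.
have -> : a ^+ 2 - 5 / 24 * a ^+ 4 =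
    \int[mu]_u (2 * (chi a u * u ^+ 1) - 5 / 6 * (chi a u * u ^+ 3)).
  have i1 := integrableZl measurableT 2 (integrable_chi_pow a 1).
  have i2 := integrableZl measurableT (5 / 6) (integrable_chi_pow a 3).
  rewrite RintegralB// RintegralZl//; last exact: integrable_chi_pow.
  by rewrite RintegralZl ?Rintegral_chi_pow//; [field|exact: integrable_chi_pow].
have -> : 3^-1 * `|a| ^+ 6 = \int[mu]_u (2 * (`|chi a u| * `|u| ^+ 5)).
  rewrite RintegralZl ?Rintegral_normr_chi_pow//; first by field.
  exact: integrable_normr_chi_pow.
apply: ler_normr_RintegralB.
- apply: subexp_integrable1 => //; apply: subexpM; first exact: subexp_chi.
  by apply: subexpZ; [exact: sq_ge0|exact: subexp_Gs1].
- have i1 := integrableZl measurableT 2 (integrable_chi_pow a 1).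
  have i2 := integrableZl measurableT (5 / 6) (integrable_chi_pow a 3).
  by have := integrableB measurableT i1 i2; exact: eq_integrable.
- have := integrableZl measurableT 2 (integrable_normr_chi_pow a 5).
  exact: eq_integrable.
- move=> u.
  have -> : chi a u * (2 * Gs u) * E u - (2 * (chi a u * u ^+ 1) - 5 / 6 * (chi a u * u ^+ 3)) =
    2 * chi a u * (Gs u * E u - (u - 5 / 12 * u ^+ 3)) by field.
  rewrite !normrM (@ger0_norm _ 2)// -mulrA ler_wpM2l// ler_wpM2l//.
  exact: GsE_approx.
Qed.

Section corner.
Variables a b : R.

Let cc j k (w : mR * mR) : R := (chi a w.1 * w.1 ^+ j) * (chi b w.2 * w.2 ^+ k).
Let nn j k (w : mR * mR) : R := (`|chi a w.1| * `|w.1| ^+ j) * (`|chi b w.2| * `|w.2| ^+ k).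

Let int_cc c j k : mu2.-integrable setT (EFin \o (fun w => c * cc j k w)).
Proof.
have := integrableZl measurableT c
  (integrable_mu2M (integrable_chi_pow a j) (integrable_chi_pow b k)).
exact: eq_integrable.
Qed.

Let int_nn c j k : mu2.-integrable setT (EFin \o (fun w => c * nn j k w)).
Proof.
have := integrableZl measurableT c
  (integrable_mu2M (integrable_normr_chi_pow a j) (integrable_normr_chi_pow b k)).
exact: eq_integrable.
Qed.

Let int2D (f g : mR * mR -> R) : mu2.-integrable setT (EFin \o f) ->
  mu2.-integrable setT (EFin \o g) ->
  mu2.-integrable setT (EFin \o (fun w => f w + g w)).
Proof. by move=> i1 i2; have := integrableD measurableT i1 i2; exact: eq_integrable. Qed.

Let Rcc c j k : \int[mu2]_w (c * cc j k w) =
  c * (a ^+ j.+1 / j.+1%:R * (b ^+ k.+1 / k.+1%:R)).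
Proof.
rewrite RintegralZl//; last first.
  exact: integrable_mu2M (integrable_chi_pow a j) (integrable_chi_pow b k).
by rewrite (Rintegral_mu2M (integrable_chi_pow a j) (integrable_chi_pow b k)) !Rintegral_chi_pow.
Qed.

Let Rnn c j k : \int[mu2]_w (c * nn j k w) =
  c * (`|a| ^+ j.+1 / j.+1%:R * (`|b| ^+ k.+1 / k.+1%:R)).
Proof.
rewrite RintegralZl//; last first.
  exact: integrable_mu2M (integrable_normr_chi_pow a j) (integrable_normr_chi_pow b k).
by rewrite (Rintegral_mu2M (integrable_normr_chi_pow a j) (integrable_normr_chi_pow b k))
  !Rintegral_normr_chi_pow.
Qed.

Lemma subexp_chi2 : subexp sqnorm2 (fun w : mR * mR => chi a w.1 * chi b w.2).
Proof.
apply: (@subexp_bounded _ _ _ _ (@sqnorm2_ge0 R) _ 1) => [|w].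
  by apply: measurable_funM; apply: measurableT_comp => //; exact: measurable_chi.
rewrite normrM -[leRHS]mulr1; apply: ler_pM => //; exact: normr_chi_le1.
Qed.

Lemma measurable_half_mul : measurable_fun setT (fun w : mR * mR => w.1 * w.2 / 2).
Proof. by apply: measurable_funM => //; exact: measurable_funM. Qed.

Definition chi_sin : R :=
  \int[mu2]_w ((chi a w.1 * chi b w.2 * sin (w.1 * w.2 / 2)) * E2 w).
Definition chi_cos : R :=
  \int[mu2]_w ((chi a w.1 * chi b w.2 * cos (w.1 * w.2 / 2)) * E2 w).

Let E2_le1 w : 0 <= 4^-1 * @sqnorm2 R w.
Proof. by rewrite mulr_ge0// sqnorm2_ge0. Qed.

Lemma chi_sin_approx : `|chi_sin - 8^-1 * a ^+ 2 * b ^+ 2| <=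
  768^-1 * `|a| ^+ 4 * `|b| ^+ 4 + 64^-1 * `|a| ^+ 4 * `|b| ^+ 2 + 64^-1 * `|a| ^+ 2 * `|b| ^+ 4.
Proof.
have -> : 8^-1 * a ^+ 2 * b ^+ 2 = \int[mu2]_w (2^-1 * cc 1 1 w) by rewrite Rcc; field.
have -> : 768^-1 * `|a| ^+ 4 * `|b| ^+ 4 + 64^-1 * `|a| ^+ 4 * `|b| ^+ 2 + 64^-1 * `|a| ^+ 2 * `|b| ^+ 4
   = \int[mu2]_w (48^-1 * nn 3 3 w + 8^-1 * nn 3 1 w + 8^-1 * nn 1 3 w).
  rewrite !RintegralD//; do ?exact: int_nn; last by apply: int2D; exact: int_nn.
  by rewrite !Rnn; field.
apply: ler_normr_RintegralB.
- apply: subexp_integrable2 => //; apply: subexpM; first exact: subexp_chi2.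
  by apply: subexp_sin; [exact: sqnorm2_ge0|exact: measurable_half_mul].
- exact: int_cc.
- by apply: int2D; [apply: int2D|]; exact: int_nn.
move=> [u v]; rewrite /cc /nn /=.
have := normr_sin_sub (u * v / 2); have := normr_sin_le (u * v / 2).
have e0 := E2_le1 (u, v).
have e1 := expR_ge1Dx (- (4^-1 * sqnorm2 (u, v))).
have e3 : E2 (u, v) <= 1 by rewrite -[leRHS]expR0 ler_expR oppr_le0.
set e := E2 _ in e1 e3 *; set s := sin _ => s1 s2.
have -> : chi a u * chi b v * s * e - 2^-1 * (chi a u * u ^+ 1 * (chi b v * v ^+ 1)) =
  chi a u * chi b v * ((s - u * v / 2) + s * (e - 1)) by field.
rewrite 2!normrM.
have h : `|s - u * v / 2 + s * (e - 1)| <=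
    48^-1 * `|u| ^+ 3 * `|v| ^+ 3 + 8^-1 * `|u| ^+ 3 * `|v| + 8^-1 * `|u| * `|v| ^+ 3.
  apply: le_trans (ler_normD _ _) _.
  have -> : 48^-1 * `|u| ^+ 3 * `|v| ^+ 3 + 8^-1 * `|u| ^+ 3 * `|v| + 8^-1 * `|u| * `|v| ^+ 3 =
    6^-1 * `|u * v / 2| ^+ 3 + `|u * v / 2| * (4^-1 * sqnorm2 (u, v)).
    rewrite /sqnorm2/= -(real_normK (num_real u)) -(real_normK (num_real v)).
    by rewrite !normrM (@ger0_norm _ 2^-1)//; field.
  rewrite lerD// normrM ler_pM//.
  rewrite ler0_norm; lra.
apply: le_trans (ler_wpM2l _ h) _; first by rewrite mulr_ge0.
rewrite le_eqVlt; apply/orP; left; apply/eqP; rewrite !expr1; ring.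
Qed.

Lemma chi_cos_approx : `|chi_cos - (a * b - 12^-1 * (a ^+ 3 * b + a * b ^+ 3))| <=
  72^-1 * `|a| ^+ 3 * `|b| ^+ 3 + 80^-1 * `|a| ^+ 5 * `|b| + 80^-1 * `|a| * `|b| ^+ 5.
Proof.
have -> : a * b - 12^-1 * (a ^+ 3 * b + a * b ^+ 3) =
    \int[mu2]_w (1 * cc 0 0 w + (- 4^-1) * cc 2 0 w + (- 4^-1) * cc 0 2 w).
  rewrite !RintegralD//; do ?exact: int_cc; last by apply: int2D; exact: int_cc.
  by rewrite !Rcc; field.
have -> : 72^-1 * `|a| ^+ 3 * `|b| ^+ 3 + 80^-1 * `|a| ^+ 5 * `|b| + 80^-1 * `|a| * `|b| ^+ 5
   = \int[mu2]_w (8^-1 * nn 2 2 w + 16^-1 * nn 4 0 w + 16^-1 * nn 0 4 w).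
  rewrite !RintegralD//; do ?exact: int_nn; last by apply: int2D; exact: int_nn.
  by rewrite !Rnn; field.
apply: ler_normr_RintegralB.
- apply: subexp_integrable2 => //; apply: subexpM; first exact: subexp_chi2.
  by apply: subexp_cos; [exact: sqnorm2_ge0|exact: measurable_half_mul].
- by apply: int2D; [apply: int2D|]; exact: int_cc.
- by apply: int2D; [apply: int2D|]; exact: int_nn.
move=> [u v]; rewrite /cc /nn /=.
have := normr_cos_sub1 (u * v / 2).
have e0 := E2_le1 (u, v).
have e1 := normr_expRN_sub1D e0.
have e2 := expR_ge0 (- (4^-1 * sqnorm2 (u, v))).
have e3 : E2 (u, v) <= 1 by rewrite -[leRHS]expR0 ler_expR oppr_le0.
set e := E2 _ in e1 e2 e3 *; set s := cos _ => s1.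
have -> : chi a u * chi b v * s * e - (1 * (chi a u * u ^+ 0 * (chi b v * v ^+ 0)) +
    - 4^-1 * (chi a u * u ^+ 2 * (chi b v * v ^+ 0)) + - 4^-1 * (chi a u * u ^+ 0 * (chi b v * v ^+ 2))) =
  chi a u * chi b v * ((s - 1) * e + (e - 1 + 4^-1 * sqnorm2 (u, v))).
  by rewrite /sqnorm2/=; field.
rewrite 2!normrM.
have h : `|(s - 1) * e + (e - 1 + 4^-1 * sqnorm2 (u, v))| <=
    8^-1 * `|u| ^+ 2 * `|v| ^+ 2 + 16^-1 * `|u| ^+ 4 + 16^-1 * `|v| ^+ 4.
  apply: le_trans (ler_normD _ _) _; rewrite normrM (ger0_norm e2).
  have h1 : `|s - 1| * e <= 2^-1 * (u * v / 2) ^+ 2.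
    by apply: le_trans s1; rewrite ler_piMr.
  have h2 : 0 <= (u ^+ 2 - v ^+ 2) ^+ 2 by exact: sqr_ge0.
  have -> : `|u| ^+ 4 = u ^+ 4 by rewrite (exprM `|u| 2 2) real_normK ?num_real// -exprM.
  have -> : `|v| ^+ 4 = v ^+ 4 by rewrite (exprM `|v| 2 2) real_normK ?num_real// -exprM.
  rewrite !real_normK ?num_real//.
  apply: le_trans (lerD h1 e1) _; rewrite /sqnorm2/=; nra.
apply: le_trans (ler_wpM2l _ h) _; first by rewrite mulr_ge0.
rewrite le_eqVlt; apply/orP; left; apply/eqP; rewrite !expr0; ring.
Qed.

End corner.

End chi_expansions.

Lemma integrable_addZ d (T : measurableType d) (R : realType)
    (m : {measure set T -> \bar R}) (c : R) (f g : T -> R) :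
  m.-integrable setT (EFin \o f) -> m.-integrable setT (EFin \o g) ->
  m.-integrable setT (EFin \o (fun x => f x + c * g x)).
Proof.
move=> i1 /(integrableZl measurableT c) i2.
by have := integrableD measurableT i1 i2; exact: eq_integrable.
Qed.

Lemma Rintegral_addZ d (T : measurableType d) (R : realType)
    (m : {measure set T -> \bar R}) (c : R) (f g : T -> R) :
  m.-integrable setT (EFin \o f) -> m.-integrable setT (EFin \o g) ->
  \int[m]_x (f x + c * g x) = \int[m]_x f x + c * \int[m]_x g x.
Proof.
move=> i1 ig; have i2 := integrableZl measurableT c ig.
by rewrite RintegralD// RintegralZl.
Qed.

Section shifted_signs.
Context {R : realType}.
Local Notation mR := (measurableTypeR R).
Local Notation mu := (@lebesgue_measure R).
Local Notation mu2 := (@lebesgue2 R).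
Local Notation half := (`[0, +oo[%classic : set mR).
Local Notation sq := (@sq R).
Local Notation E v := (expR (- (4^-1 * v ^+ 2))).
Local Notation E2 w := (expR (- (4^-1 * sqnorm2 w))).

Let q40 : 0 < 4^-1 :> R. Proof. by rewrite invr_gt0. Qed.

Let sgR (u : mR) : R := Num.sg u.

Definition plane_form (k : mR * mR -> R) (p r : mR -> R) : R :=
  \int[mu2]_w ((p w.1 * r w.2 * k w) * E2 w).

Let ssg : subexp sq sgR.
Proof.
apply: (@subexp_bounded _ _ _ _ (@sq_ge0 R) _ 1) => [|u]; first exact: measurable_sgr.
by rewrite /sgR normr_sg; case: (u != 0).
Qed.

Let sub1 (p : mR -> R) : subexp sq p -> subexp sqnorm2 (fun w : mR * mR => p w.1).
Proof.
move=> [mp pC]; split=> [|e e0]; first exact: measurableT_comp.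
have [C pC'] := pC e e0; exists C => w; apply: le_trans (pC' _) _.
rewrite ler_wpM2l//.
  by have := le_trans (normr_ge0 _) (pC' 0); rewrite pmulr_lge0 ?expR_gt0.
by rewrite ler_expR ler_pM2l// /sqnorm2 lerDl sqr_ge0.
Qed.

Let sub2 (p : mR -> R) : subexp sq p -> subexp sqnorm2 (fun w : mR * mR => p w.2).
Proof. by move=> /sub1 /subexp_swap. Qed.

Let sform k p r : subexp sqnorm2 k -> subexp sq p -> subexp sq r ->
  subexp sqnorm2 (fun w : mR * mR => p w.1 * r w.2 * k w).
Proof.
move=> sk sp sr; apply: subexpM => //.
by apply: subexpM; [exact: sub1|exact: sub2].
Qed.

Lemma plane_form_swap k p r : (forall w, k (w.2, w.1) = k w) ->
  subexp sqnorm2 k -> subexp sq p -> subexp sq r ->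
  plane_form k p r = plane_form k r p.
Proof.
move=> ksym sk sp sr; rewrite /plane_form -[RHS]Rintegral_mu2_swap//; last exact: sform.
by apply: eq_Rintegral => w _ /=; rewrite ksym; ring.
Qed.

Lemma plane_form_shift k a b : (forall w, k (w.2, w.1) = k w) -> subexp sqnorm2 k ->
  \int[mu2]_w ((Num.sg (w.1 - a) * Num.sg (w.2 - b) * k w) * E2 w) =
  plane_form k Num.sg Num.sg - 2 * plane_form k (chi a) Num.sg
    - 2 * plane_form k (chi b) Num.sg + 4 * plane_form k (chi a) (chi b).
Proof.
move=> ksym sk; rewrite (plane_form_swap (p := chi b))//; last exact: subexp_chi.
have i00 := subexp_integrable2 (sform sk ssg ssg) q40.
have i10 := subexp_integrable2 (sform sk (subexp_chi a) ssg) q40.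
have i01 := subexp_integrable2 (sform sk ssg (subexp_chi b)) q40.
have i11 := subexp_integrable2 (sform sk (subexp_chi a) (subexp_chi b)) q40.
have j1 := integrable_addZ (-2) i00 i10.
have j2 := integrable_addZ (-2) j1 i01.
rewrite -!mulNr /plane_form -(Rintegral_addZ (-2) i00 i10) -(Rintegral_addZ (-2) j1 i01).
rewrite -(Rintegral_addZ 4 j2 i11).
by apply: eq_Rintegral => w _; rewrite !sgr_shift /sgR; ring.
Qed.

Lemma plane_form_sg k p (K : R -> R) : subexp sqnorm2 k -> subexp sq p ->
  (forall u, \int[mu]_v ((Num.sg v * k (u, v)) * E v) = K u) ->
  plane_form k p Num.sg = \int[mu]_u ((p u * K u) * E u).
Proof.
move=> sk sp kK; rewrite /plane_form (Rintegral_mu2_iter (sform sk sp ssg) q40)/=.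
apply: eq_Rintegral => u _; congr (_ * _); rewrite -kK -RintegralZl//.
  by apply: eq_Rintegral => v _; rewrite /sgR; ring.
by apply: subexp_integrable1 => //; apply: subexpM; [exact: ssg|exact: subexp_pair1].
Qed.

Lemma Rintegral_sg_sin (u : R) : \int[mu]_v ((Num.sg v * sin (u * v / 2)) * E v) = 2 * Gs u.
Proof.
rewrite Rintegral_even.
- congr (_ * _); apply: eq_Rintegral => v; rewrite mem_setE in_itv/= andbT.
  rewrite le_eqVlt => /predU1P[<-|v0]; first by rewrite mulr0 mul0r sin0 !mulr0.
  by rewrite gtr0_sg// mul1r.
- by apply: subexp_integrable1 => //; apply: subexpM; [exact: ssg|exact: subexp_sin_uv].
- move=> v; have -> : u * - v / 2 = - (u * v / 2) by ring.
  by rewrite sgrN sinN mulrNN sqrrN.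
Qed.

Lemma Rintegral_sg_cos (u : R) : \int[mu]_v ((Num.sg v * cos (u * v / 2)) * E v) = 0.
Proof.
rewrite Rintegral_odd//.
  by apply: subexp_integrable1 => //; apply: subexpM; [exact: ssg|exact: subexp_cos_uv].
move=> v; have -> : u * - v / 2 = - (u * v / 2) by ring.
by rewrite sgrN cosN sqrrN !mulNr.
Qed.

Let ksin (w : mR * mR) : R := sin (w.1 * w.2 / 2).
Let kcos (w : mR * mR) : R := cos (w.1 * w.2 / 2).
Let sksin : subexp sqnorm2 ksin.
Proof. by apply: subexp_sin; [exact: sqnorm2_ge0|exact: measurable_half_mul]. Qed.
Let skcos : subexp sqnorm2 kcos.
Proof. by apply: subexp_cos; [exact: sqnorm2_ge0|exact: measurable_half_mul]. Qed.

Lemma Gs0 : Gs 0 = 0 :> R.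
Proof. by have := GsN (0 : R); rewrite oppr0; lra. Qed.

Definition shift_sin (a b : R) : R :=
  \int[mu2]_w ((Num.sg (w.1 - a) * Num.sg (w.2 - b) * sin (w.1 * w.2 / 2)) * E2 w).
Definition shift_cos (a b : R) : R :=
  \int[mu2]_w ((Num.sg (w.1 - a) * Num.sg (w.2 - b) * cos (w.1 * w.2 / 2)) * E2 w).

Lemma shift_sinE a b : shift_sin a b =
  4 * Lf 1 - 2 * Hchi a - 2 * Hchi b + 4 * chi_sin a b.
Proof.
have ksym w : ksin (w.2, w.1) = ksin w by rewrite /ksin/= mulrC (mulrC w.1) mulrC.
rewrite /shift_sin (plane_form_shift _ _ ksym sksin).
congr (_ - 2 * _ - 2 * _ + _).
- rewrite (plane_form_sg sksin ssg Rintegral_sg_sin) Rintegral_even.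
  + rewrite /Lf (_ : 4 * _ = 2 * (2 * \int[mu]_(u in half) (Gs (1 * u) * E u))); last by ring.
    congr (_ * _); rewrite -RintegralZl//; last first.
      by apply: subexp_integrable_half => //; exact: subexp_Gs.
    apply: eq_Rintegral => u; rewrite mem_setE in_itv/= andbT mul1r /sgR.
    rewrite le_eqVlt => /predU1P[<-|u0]; first by rewrite Gs0 !(mulr0, mul0r).
    by rewrite gtr0_sg// mul1r mulrA.
  + apply: subexp_integrable1 => //; apply: subexpM; first exact: ssg.
    by apply: subexpZ; [exact: sq_ge0|exact: subexp_Gs1].
  + by move=> u; rewrite /sgR sgrN GsN sqrrN mulrN mulrNN.
- exact: plane_form_sg sksin (subexp_chi a) Rintegral_sg_sin.
- exact: plane_form_sg sksin (subexp_chi b) Rintegral_sg_sin.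
Qed.

Lemma shift_cosE a b : shift_cos a b = 4 * chi_cos a b.
Proof.
have ksym w : kcos (w.2, w.1) = kcos w by rewrite /kcos/= mulrC (mulrC w.1) mulrC.
rewrite /shift_cos (plane_form_shift _ _ ksym skcos).
have h0 p : subexp sq p -> plane_form kcos p Num.sg = 0.
  move=> sp; rewrite (plane_form_sg skcos sp Rintegral_sg_cos).
  under eq_Rintegral do rewrite mulr0 mul0r.
  by rewrite /Rintegral integral0.
rewrite !h0; [|exact: subexp_chi|exact: subexp_chi|exact: ssg].
by rewrite !mulr0 !subr0 add0r.
Qed.

Definition expansion_error (a b : R) : R := a ^+ 6 + b ^+ 6 + a ^+ 8 + b ^+ 8.

Lemma shift_sin_approx a b :
  `|shift_sin a b - (4 * Lf 1 + 2^-1 * (a * b) ^+ 2 - 2 * (a ^+ 2 + b ^+ 2)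
     + 5 / 12 * (a ^+ 4 + b ^+ 4))| <= 2 * expansion_error a b.
Proof.
rewrite shift_sinE /expansion_error.
have hA := Hchi_approx a; have hB := Hchi_approx b; have hC := chi_sin_approx a b.
have n2 (c : R) : `|c| ^+ 2 = c ^+ 2 by rewrite real_normK ?num_real.
have n4 (c : R) : `|c| ^+ 4 = (c ^+ 2) ^+ 2 by rewrite (exprM `|c| 2 2) n2.
have n6 (c : R) : `|c| ^+ 6 = (c ^+ 2) ^+ 3 by rewrite (exprM `|c| 2 3) n2.
have e4 (c : R) : c ^+ 4 = (c ^+ 2) ^+ 2 by rewrite -exprM.
have e6 (c : R) : c ^+ 6 = (c ^+ 2) ^+ 3 by rewrite -exprM.
have e8 (c : R) : c ^+ 8 = (c ^+ 2) ^+ 4 by rewrite -exprM.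
move: hA hB hC; rewrite exprMn !n4 !n6 !n2 !e4 !e6 !e8.
have : 0 <= a ^+ 2 by exact: sqr_ge0.
have : 0 <= b ^+ 2 by exact: sqr_ge0.
move: (a ^+ 2) (b ^+ 2) => x y y0 x0; rewrite !ler_norml.
move=> /andP[A1 A2] /andP[B1 B2] /andP[C1 C2].
have p1 : x ^+ 2 * y <= x ^+ 3 + y ^+ 3.
  have : 0 <= (x + y) * (x - y) ^+ 2 by rewrite mulr_ge0 ?sqr_ge0// addr_ge0.
  have : 0 <= x * y ^+ 2 by rewrite mulr_ge0 ?sqr_ge0.
  lra.
have p2 : x * y ^+ 2 <= x ^+ 3 + y ^+ 3.
  have : 0 <= (x + y) * (x - y) ^+ 2 by rewrite mulr_ge0 ?sqr_ge0// addr_ge0.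
  have : 0 <= x ^+ 2 * y by rewrite mulr_ge0 ?sqr_ge0.
  lra.
have p3 : x ^+ 2 * y ^+ 2 <= x ^+ 4 + y ^+ 4.
  have : 0 <= (x ^+ 2 - y ^+ 2) ^+ 2 by exact: sqr_ge0.
  have : 0 <= x ^+ 2 * y ^+ 2 by rewrite mulr_ge0 ?sqr_ge0.
  lra.
have x3 : 0 <= x ^+ 3 by exact: exprn_ge0.
have y3 : 0 <= y ^+ 3 by exact: exprn_ge0.
have x4 : 0 <= x ^+ 4 by exact: exprn_ge0.
have y4 : 0 <= y ^+ 4 by exact: exprn_ge0.
apply/andP; split; lra.
Qed.

Lemma shift_cos_approx a b :
  `|shift_cos a b - (4 * (a * b) - 3^-1 * (a ^+ 3 * b + a * b ^+ 3))|
  <= 2 * expansion_error a b.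
Proof.
rewrite shift_cosE /expansion_error.
have ev k : a ^+ (2 * k) = `|a| ^+ (2 * k) by rewrite !exprM real_normK ?num_real.
have evb k : b ^+ (2 * k) = `|b| ^+ (2 * k) by rewrite !exprM real_normK ?num_real.
have hC := chi_cos_approx a b.
rewrite (ev 3) (evb 3) (ev 4) (evb 4).
have -> : 4 * chi_cos a b - (4 * (a * b) - 3^-1 * (a ^+ 3 * b + a * b ^+ 3)) =
  4 * (chi_cos a b - (a * b - 12^-1 * (a ^+ 3 * b + a * b ^+ 3))) by field.
rewrite normrM (@ger0_norm _ 4)//; move: hC; set t := `|_ - _|.
have : 0 <= `|a| by []; have : 0 <= `|b| by [].
move: (`|a|) (`|b|) => x y y0 x0 hC.
have p1 : x ^+ 5 * y <= x ^+ 6 + y ^+ 6.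
  have [xy|yx] := leP x y.
    have : x ^+ 5 * y <= y ^+ 5 * y by rewrite ler_wpM2r// lerXn2r.
    have : 0 <= x ^+ 6 by exact: exprn_ge0.
    lra.
  have : x ^+ 5 * y <= x ^+ 5 * x by rewrite ler_wpM2l ?exprn_ge0// ltW.
  have : 0 <= y ^+ 6 by exact: exprn_ge0.
  lra.
have p2 : x * y ^+ 5 <= x ^+ 6 + y ^+ 6.
  have [xy|yx] := leP x y.
    have : x * y ^+ 5 <= y * y ^+ 5 by rewrite ler_wpM2r ?exprn_ge0.
    have : 0 <= x ^+ 6 by exact: exprn_ge0.
    lra.
  have : x * y ^+ 5 <= x * x ^+ 5 by rewrite ler_wpM2l// lerXn2r// ltW.
  have : 0 <= y ^+ 6 by exact: exprn_ge0.
  lra.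
have p3 : x ^+ 3 * y ^+ 3 <= x ^+ 6 + y ^+ 6.
  have : 0 <= (x ^+ 3 - y ^+ 3) ^+ 2 by exact: sqr_ge0.
  have : 0 <= x ^+ 3 * y ^+ 3 by rewrite mulr_ge0 ?exprn_ge0.
  lra.
have x8 : 0 <= x ^+ 8 by exact: exprn_ge0.
have y8 : 0 <= y ^+ 8 by exact: exprn_ge0.
have x6 : 0 <= x ^+ 6 by exact: exprn_ge0.
have y6 : 0 <= y ^+ 6 by exact: exprn_ge0.
lra.
Qed.

End shifted_signs.

Section gaussian_moments.
Context {R : realType}.
Local Notation mR := (measurableTypeR R).
Local Notation mu := (@lebesgue_measure R).
Local Notation mu2 := (@lebesgue2 R).
Local Notation lam2 := (@lebesgue_pairs R).
Local Notation half := (`[0, +oo[%classic : set mR).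
Local Notation sq := (@sq R).
Local Notation E v := (expR (- (4^-1 * v ^+ 2))).
Local Notation E2 w := (expR (- (4^-1 * sqnorm2 w))).

Let q40 : 0 < 4^-1 :> R. Proof. by rewrite invr_gt0. Qed.
Let h0 : 0 < 2^-1 :> R. Proof. by rewrite invr_gt0. Qed.

Definition gmass : R := 2 * pi * Num.sqrt 2.

Definition plane_moment (k : R -> R) al be : R :=
  \int[mu2]_w ((w.1 ^+ al * w.2 ^+ be * k (w.1 * w.2 / 2)) * E2 w).

Let smono al be : subexp sqnorm2 (fun w : mR * mR => w.1 ^+ al * w.2 ^+ be).
Proof.
apply: subexpM; apply: subexpX; try exact: sqnorm2_ge0.
- by apply: subexp_coord => //; [exact: sqnorm2_ge0|move=> w; rewrite /sqnorm2 lerDl sqr_ge0].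
- by apply: subexp_coord => //; [exact: sqnorm2_ge0|move=> w; rewrite /sqnorm2 lerDr sqr_ge0].
Qed.

Section kernel.
Variable k : R -> R.
Hypothesis sk : subexp sqnorm2 (fun w : mR * mR => k (w.1 * w.2 / 2)).

Let smk al be : subexp sqnorm2 (fun w : mR * mR => w.1 ^+ al * w.2 ^+ be * k (w.1 * w.2 / 2)).
Proof. by apply: subexpM. Qed.

Let sk1 (u : R) : subexp sq (fun v : mR => k (u * v / 2)).
Proof. exact: (subexp_pair1 u sk). Qed.

Lemma plane_moment_iter al be : plane_moment k al be =
  \int[mu]_u ((u ^+ al * \int[mu]_v ((v ^+ be * k (u * v / 2)) * E v)) * E u).
Proof.
rewrite /plane_moment (Rintegral_mu2_iter (smk al be) q40)/=.
apply: eq_Rintegral => u _; congr (_ * _); rewrite -RintegralZl//.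
  by apply: eq_Rintegral => v _; rewrite !mulrA.
by apply: subexp_integrable1 => //; apply: subexpM; [exact: subexp_vpow|exact: sk1].
Qed.

Lemma plane_moment_swap al be : plane_moment k al be = plane_moment k be al.
Proof.
rewrite /plane_moment -[RHS]Rintegral_mu2_swap//.
apply: eq_Rintegral => w _ /=; congr (_ * k _ * _); last by rewrite (mulrC w.2).
by rewrite mulrC.
Qed.

Lemma plane_moment0 al be : (forall x, (-1) ^+ be * k (- x) = - k x) ->
  plane_moment k al be = 0.
Proof.
move=> kN; rewrite plane_moment_iter.
rewrite (_ : \int[mu]_u _ = \int[mu]_(u in [set: mR]) 0); first by rewrite /Rintegral integral0.
apply: eq_Rintegral => u _; rewrite (Rintegral_odd _ _) ?mulr0 ?mul0r//.
  by apply: subexp_integrable1 => //; apply: subexpM; [exact: subexp_vpow|exact: sk1].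
move=> v; rewrite sqrrN -[RHS]mulNr; congr (_ * _).
have -> : u * - v / 2 = - (u * v / 2) by ring.
by rewrite (exprNn v) mulrAC kN; ring.
Qed.

Lemma plane_moment_gauss al be (ka : R -> R) : subexp sq ka ->
  (forall u, ka (- u) = (-1) ^+ al * ka u) ->
  (forall u, \int[mu]_v ((v ^+ be * k (u * v / 2)) * E v) = ka u * (2 * Gc u)) ->
  plane_moment k al be =
  4 * Num.sqrt pi * \int[mu]_(u in half) ((u ^+ al * ka u) * expR (- (2^-1 * u ^+ 2))).
Proof.
move=> ska kaN kE; rewrite plane_moment_iter.
have sak : subexp sq (fun u : mR => u ^+ al * ka u).
  by apply: subexpM => //; exact: subexp_vpow.
transitivity (\int[mu]_u ((2 * Num.sqrt pi) * ((u ^+ al * ka u) * expR (- (2^-1 * u ^+ 2))))).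
  apply: eq_Rintegral => u _; rewrite kE Gc_closed Gc0.
  have -> : expR (- (2^-1 * u ^+ 2)) = E u * E u by rewrite -expRD; congr expR; field.
  by ring.
rewrite RintegralZl//; last exact: subexp_integrable1.
rewrite Rintegral_even; first by ring.
  exact: subexp_integrable1.
move=> u; rewrite sqrrN kaN (exprNn u); congr (_ * _).
rewrite mulrACA -exprMn mulrN1 opprK expr1n; ring.
Qed.

End kernel.

Let scos : subexp sqnorm2 (fun w : mR * mR => cos (w.1 * w.2 / 2) : R).
Proof. by apply: subexp_cos; [exact: sqnorm2_ge0|exact: measurable_half_mul]. Qed.
Let ssin : subexp sqnorm2 (fun w : mR * mR => sin (w.1 * w.2 / 2) : R).
Proof. by apply: subexp_sin; [exact: sqnorm2_ge0|exact: measurable_half_mul]. Qed.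

Lemma gmassE : gmass = 4 * Num.sqrt pi * Hm 2^-1 0 :> R.
Proof.
rewrite /Hm; under eq_Rintegral do rewrite expr0 mul1r.
rewrite half_gauss// invrK sqrtrM ?pi_ge0// /gmass -[in LHS](sqr_sqrtr (pi_ge0 R)).
by field.
Qed.

Let Hm2 : Hm 2^-1 2 = Hm 2^-1 0 :> R.
Proof. by rewrite HmSS//; field. Qed.
Let Hm4 : Hm 2^-1 4 = 3 * Hm 2^-1 0 :> R.
Proof. by rewrite HmSS// Hm2; field. Qed.

Let inner_cos0 (u : R) : \int[mu]_v ((v ^+ 0 * cos (u * v / 2)) * E v) = 1 * (2 * Gc u).
Proof.
rewrite mul1r Rintegral_even.
- by congr (_ * _); apply: eq_Rintegral => v _; rewrite mul1r.
- by apply: subexp_integrable1 => //; apply: subexpM; [exact: subexp_vpow|exact: subexp_cos_uv].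
- by move=> v; rewrite sqrrN (_ : u * - v / 2 = - (u * v / 2)) ?cosN//; ring.
Qed.

Let inner_sin1 (u : R) : \int[mu]_v ((v ^+ 1 * sin (u * v / 2)) * E v) = u * (2 * Gc u).
Proof.
rewrite mulrCA -GvsE Rintegral_even.
- by congr (_ * _); apply: eq_Rintegral => v _; rewrite expr1.
- by apply: subexp_integrable1 => //; apply: subexpM; [exact: subexp_vpow|exact: subexp_sin_uv].
- move=> v; rewrite sqrrN (_ : u * - v / 2 = - (u * v / 2)); last by ring.
  by rewrite sinN !expr1 mulrNN.
Qed.

Let inner_cos2 (u : R) : \int[mu]_v ((v ^+ 2 * cos (u * v / 2)) * E v) = (2 - u ^+ 2) * (2 * Gc u).
Proof.
rewrite mulrCA -GvvcE Rintegral_even//.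
- by apply: subexp_integrable1 => //; apply: subexpM; [exact: subexp_vpow|exact: subexp_cos_uv].
- by move=> v; rewrite !sqrrN (_ : u * - v / 2 = - (u * v / 2)) ?cosN//; ring.
Qed.

Lemma plane_cos_even0 j : plane_moment cos (2 * j) 0 = 4 * Num.sqrt pi * Hm 2^-1 (2 * j) :> R.
Proof.
rewrite (plane_moment_gauss scos (ka := fun=> 1) _ _ inner_cos0).
- by congr (_ * _); apply: eq_Rintegral => u _; rewrite mulr1.
- exact: subexp_cst (@sq_ge0 R) _.
- by move=> u; rewrite exprM sqrrN expr1n expr1n mulr1.
Qed.

Lemma plane_sin_odd1 j : plane_moment sin (2 * j).+1 1 = 4 * Num.sqrt pi * Hm 2^-1 (2 * j).+2 :> R.
Proof.
rewrite (plane_moment_gauss ssin (ka := id) _ _ inner_sin1).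
- by congr (_ * _); apply: eq_Rintegral => u _; rewrite -exprSr.
- exact: subexp_id.
- by move=> u; rewrite exprS exprM sqrrN !expr1n mulr1 mulN1r.
Qed.

Lemma plane_cos00 : plane_moment cos 0 0 = gmass.
Proof. by rewrite (plane_cos_even0 0) gmassE. Qed.

Lemma plane_cos20 : plane_moment cos 2 0 = gmass.
Proof. by rewrite (plane_cos_even0 1) gmassE Hm2. Qed.

Lemma plane_cos40 : plane_moment cos 4 0 = 3 * gmass.
Proof. by rewrite (plane_cos_even0 2) gmassE Hm4; ring. Qed.

Lemma plane_sin11 : plane_moment sin 1 1 = gmass.
Proof. by rewrite (plane_sin_odd1 0) gmassE Hm2. Qed.

Lemma plane_sin31 : plane_moment sin 3 1 = 3 * gmass.
Proof. by rewrite (plane_sin_odd1 1) gmassE Hm4; ring. Qed.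

Lemma plane_cos22 : plane_moment cos 2 2 = - gmass.
Proof.
have sk : subexp sq (fun u : mR => 2 - u ^+ 2).
  by apply: subexpB; [exact: subexp_cst (@sq_ge0 R) _|exact: subexp_vpow].
rewrite (plane_moment_gauss scos sk _ inner_cos2); last first.
  by move=> u; rewrite !sqrrN expr1n mul1r.
have i2 := subexp_integrable_half (@subexp_vpow R 2) h0.
have i4 := subexp_integrable_half (@subexp_vpow R 4) h0.
rewrite gmassE (_ : \int[mu]_(u in half) _ = 2 * Hm 2^-1 2 - Hm 2^-1 4).
  by rewrite Hm2 Hm4; ring.
rewrite /Hm -RintegralZl// -RintegralB//.
- by apply: eq_Rintegral => u _; ring.
- by have := integrableZl (@measurable_half R) 2 i2; exact: eq_integrable.
Qed.

Lemma plane_sin_even al j : plane_moment sin al (2 * j) = 0.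
Proof.
by apply: plane_moment0 => // x; rewrite exprM sqrrN !expr1n mul1r sinN.
Qed.

Lemma plane_cos_odd al j : plane_moment cos al (2 * j).+1 = 0.
Proof.
by apply: plane_moment0 => // x; rewrite exprS exprM sqrrN !expr1n mulr1 mulN1r cosN.
Qed.

Lemma plane_cos02 : plane_moment cos 0 2 = gmass.
Proof. by rewrite (plane_moment_swap scos) plane_cos20. Qed.

Lemma plane_cos04 : plane_moment cos 0 4 = 3 * gmass.
Proof. by rewrite (plane_moment_swap scos) plane_cos40. Qed.

Lemma plane_sin13 : plane_moment sin 1 3 = 3 * gmass.
Proof. by rewrite (plane_moment_swap ssin) plane_sin31. Qed.

Section tensor_moments.
Variable n : nat.

Definition xprod (z : n.-tuple R * n.-tuple R) : R := \prod_(j < n) tnth z.1 j.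
Definition yprod (z : n.-tuple R * n.-tuple R) : R := \prod_(j < n) tnth z.2 j.

Definition tensor_moment (k : R -> R) al be : R :=
  \int[lam2 n]_z ((xprod z ^+ al * yprod z ^+ be * k (dotpp z / 2)) *
    expR (- (4^-1 * sqnorm_pair z))).

Let tensor_momentE (k : R -> R) al be : tensor_moment k al be =
  \int[lam2 n]_z (tprod (fun w : mR * mR => w.1 ^+ al * w.2 ^+ be) z *
    k (tphase (fun w : mR * mR => w.1 * w.2 / 2) z) * expR (- (4^-1 * sqnorm_pair z))).
Proof.
apply: eq_Rintegral => z _; congr (_ * k _ * _).
- by rewrite /tprod /xprod /yprod -!prodrXl -big_split.
- by rewrite /tphase /dotpp /dotp mulr_suml.
Qed.

Local Open Scope complex_scope.

Lemma tensor_momentX al be :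
  Complex (tensor_moment cos al be) (tensor_moment sin al be) =
  (Complex (plane_moment cos al be) (plane_moment sin al be)) ^+ n.
Proof.
rewrite !tensor_momentE.
exact: (Rintegral_tensor (smono al be) measurable_half_mul q40).
Qed.

Lemma tensor_cosX al be : plane_moment sin al be = 0 ->
  tensor_moment cos al be = plane_moment cos al be ^+ n.
Proof.
move=> s0; have := tensor_momentX al be; rewrite s0.
have -> (c : R) : Complex c 0 ^+ n = Complex (c ^+ n) 0.
  by have := rmorphXn (@real_complex R) n c => /esym.
by case.
Qed.

End tensor_moments.

Local Open Scope complex_scope.

(* The exponent 5 enters here: i ^+ 5 = i. *)
Lemma tensor_sin5 al be : plane_moment cos al be = 0 ->
  tensor_moment 5 sin al be = plane_moment sin al be ^+ 5.
Proof.
move=> s0; have := tensor_momentX 5 al be; rewrite s0.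
have -> (c : R) : Complex 0 c ^+ 5 = Complex 0 (c ^+ 5).
  have -> : Complex 0 c = 'i * c%:C by simpc.
  rewrite exprMn -rmorphXn (exprS _ 4) (exprM _ 2 2) sqr_i sqrrN expr1n mulr1.
  by simpc.
by case.
Qed.

End gaussian_moments.

Section perturbed_half_space.
Context {R : realType}.
Local Notation mR := (measurableTypeR R).
Local Notation mu2 := (@lebesgue2 R).
Local Notation lam2 := (@lebesgue_pairs R).
Local Notation E2 w := (expR (- (4^-1 * sqnorm2 w))).
Local Notation En z := (expR (- (4^-1 * sqnorm_pair z))).

Let q40 : 0 < 4^-1 :> R. Proof. by rewrite invr_gt0. Qed.

Definition bent_form (eta : R) n (x : n.+1.-tuple R) : R :=
  tnth x ord0 - eta * \prod_(j < n) tnth x (lift ord0 j).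

Lemma measurable_bent_form eta n : measurable_fun setT (@bent_form eta n).
Proof.
apply: measurable_funB; first exact: measurable_tnth.
apply: measurable_funM => //; apply: measurable_prod => j _; exact: measurable_tnth.
Qed.

Lemma bent_form_odd eta n : odd n -> odd_function (@bent_form eta n).
Proof.
move=> no x; rewrite /bent_form tnth_map.
under eq_bigr do rewrite tnth_map.
by rewrite prodrN card_ord -signr_odd no expr1; ring.
Qed.

Lemma bent_form_cons eta n r (x : n.-tuple R) :
  bent_form eta (tuple_cons (r, x)) = r - eta * \prod_(j < n) tnth x j.
Proof.
rewrite /bent_form tnth_tuple_cons0; congr (_ - _ * _).
by apply: eq_bigr => j _; rewrite tnth_tuple_consS.
Qed.

Variable n : nat.
Let T := (n.-tuple R * n.-tuple R)%type.

Let q0 := @sqnorm_pair_ge0 R n.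

Let sxy al be : subexp (@sqnorm_pair R n) (fun z => xprod z ^+ al * yprod z ^+ be).
Proof.
apply: subexpM; apply: subexpX => //; apply: subexp_prod => // j.
- apply: (@subexp_tnth_pair R (fun w => w.1)).
  apply: subexp_coord; [exact: sqnorm2_ge0|exact: measurable_fst|].
  by move=> w; rewrite /sqnorm2 lerDl sqr_ge0.
- apply: (@subexp_tnth_pair R (fun w => w.2)).
  apply: subexp_coord; [exact: sqnorm2_ge0|exact: measurable_snd|].
  by move=> w; rewrite /sqnorm2 lerDr sqr_ge0.
Qed.

(* One function for both kernels, so that a combination of moments is a list of data. *)
Definition trig (b : bool) (x : R) : R := if b then sin x else cos x.

Let sm b al be : subexp (@sqnorm_pair R n)
  (fun z => xprod z ^+ al * yprod z ^+ be * trig b (dotpp z / 2)).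
Proof.
have md : measurable_fun setT (fun z : T => dotpp z / 2).
  by apply: measurable_funM => //; exact: measurable_dotpp.
apply: subexpM; first exact: sxy.
by case: b; rewrite /trig; [exact: subexp_sin|exact: subexp_cos].
Qed.

Let im b al be : (lam2 n).-integrable setT (EFin \o (fun z =>
  (xprod z ^+ al * yprod z ^+ be * trig b (dotpp z / 2)) * En z)).
Proof. exact: subexp_integrable_pairs (sm b al be) q40. Qed.

Lemma Rintegral_trig_comb (s : seq (R * (bool * nat * nat))) :
  (lam2 n).-integrable setT (EFin \o (fun z => \sum_(i <- s) i.1 *
    ((xprod z ^+ i.2.1.2 * yprod z ^+ i.2.2 * trig i.2.1.1 (dotpp z / 2)) * En z))) /\
  \int[lam2 n]_z (\sum_(i <- s) i.1 *
    ((xprod z ^+ i.2.1.2 * yprod z ^+ i.2.2 * trig i.2.1.1 (dotpp z / 2)) * En z)) =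
  \sum_(i <- s) i.1 * tensor_moment n (trig i.2.1.1) i.2.1.2 i.2.2.
Proof.
elim: s => [|i s [IH1 IH2]].
  split; first by under [X in EFin \o X]eq_fun do rewrite big_nil; exact: integrable0.
  under eq_Rintegral do rewrite big_nil.
  by rewrite big_nil /Rintegral integral0.
split.
  under [X in EFin \o X]eq_fun do rewrite big_cons addrC.
  exact: integrable_addZ.
under eq_Rintegral do rewrite big_cons addrC.
by rewrite Rintegral_addZ// IH2 big_cons addrC.
Qed.

Variable eta : R.

Let F := @bent_form eta n.
Let mF : measurable_fun setT F. Proof. exact: measurable_bent_form. Qed.

Let sF : subexp (@sqnorm_pair R n.+1) (fun z => sgFG F F z * sin (dotpp z / 2)).
Proof.
apply: subexpM.
  apply: (@subexp_bounded _ _ _ _ (@sqnorm_pair_ge0 R n.+1) _ 1).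
    exact: measurable_sgFG.
  exact: sgFG_le1.
apply: subexp_sin; first exact: sqnorm_pair_ge0.
by apply: measurable_funM => //; exact: measurable_dotpp.
Qed.

Definition bent_integral : R :=
  \int[lam2 n.+1]_z ((sgFG F F z * sin (dotpp z / 2)) * En z).

Let inner (z : T) : R := shift_sin (eta * xprod z) (eta * yprod z) * cos (dotpp z / 2) +
   shift_cos (eta * xprod z) (eta * yprod z) * sin (dotpp z / 2).

Let innerE z : \int[mu2]_w ((sgFG F F (consp (z, w)) * sin (dotpp (consp (z, w)) / 2)) * E2 w) =
  inner z.
Proof.
have ssg (a b : R) (k : mR * mR -> R) : subexp sqnorm2 k ->
    subexp sqnorm2 (fun w : mR * mR => Num.sg (w.1 - a) * Num.sg (w.2 - b) * k w).
  move=> sk; apply: subexpM => //.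
  apply: (@subexp_bounded _ _ _ _ (@sqnorm2_ge0 R) _ 1) => [|w].
    apply: measurable_funM; apply: measurableT_comp; try exact: measurable_sgr;
      by apply: measurable_funB.
  by rewrite normrM !normr_sg -natrM mulnb lern1; case: (_ && _).
have i1 := subexp_integrable2 (ssg (eta * xprod z) (eta * yprod z) _
  (subexp_sin (@sqnorm2_ge0 R) measurable_half_mul)) q40.
have i2 := subexp_integrable2 (ssg (eta * xprod z) (eta * yprod z) _
  (subexp_cos (@sqnorm2_ge0 R) measurable_half_mul)) q40.
rewrite /inner /shift_sin /shift_cos mulrC [X in _ = _ + X]mulrC -RintegralZl//.
rewrite -Rintegral_addZ//; last first.
  by have := integrableZl measurableT (cos (dotpp z / 2)) i1; exact: eq_integrable.
apply: eq_Rintegral => w _.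
have -> : sgFG F F (consp (z, w)) = Num.sg (w.1 - eta * xprod z) * Num.sg (w.2 - eta * yprod z).
  by rewrite /sgFG /F /consp/= !bent_form_cons.
have -> : dotpp (consp (z, w)) / 2 = w.1 * w.2 / 2 + dotpp z / 2.
  by rewrite /dotpp /consp/= dotp_tuple_cons mulrDl.
by rewrite sinD; ring.
Qed.

Lemma bent_integralE : bent_integral = \int[lam2 n]_z (inner z * En z).
Proof.
rewrite /bent_integral Rintegral_pairsS//.
by apply: eq_Rintegral => z _; rewrite innerE.
Qed.

Definition tail_bound : R := \int[lam2 n]_z
  ((xprod z ^+ 6 * yprod z ^+ 0 + xprod z ^+ 0 * yprod z ^+ 6 +
    xprod z ^+ 8 * yprod z ^+ 0 + xprod z ^+ 0 * yprod z ^+ 8) * En z).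

Let s : seq (R * (bool * nat * nat)) :=
  [:: (4 * Lf 1, (false, 0, 0)%N); (2^-1 * eta ^+ 4, (false, 2, 2)%N);
      (- 2 * eta ^+ 2, (false, 2, 0)%N); (- 2 * eta ^+ 2, (false, 0, 2)%N);
      (5 / 12 * eta ^+ 4, (false, 4, 0)%N); (5 / 12 * eta ^+ 4, (false, 0, 4)%N);
      (4 * eta ^+ 2, (true, 1, 1)%N); (- 3^-1 * eta ^+ 4, (true, 3, 1)%N);
      (- 3^-1 * eta ^+ 4, (true, 1, 3)%N)].

Lemma bent_integral_approx : 0 <= eta <= 1 ->
  `|bent_integral - \sum_(i <- s) i.1 * tensor_moment n (trig i.2.1.1) i.2.1.2 i.2.2| <=
  4 * eta ^+ 6 * tail_bound.
Proof.
move=> /andP[eta0 eta1]; have [ims <-] := Rintegral_trig_comb s.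
have st : subexp (@sqnorm_pair R n) (fun z =>
    xprod z ^+ 6 * yprod z ^+ 0 + xprod z ^+ 0 * yprod z ^+ 6 +
    xprod z ^+ 8 * yprod z ^+ 0 + xprod z ^+ 0 * yprod z ^+ 8).
  by do 3 (apply: subexpD; last exact: sxy).
have it := subexp_integrable_pairs st q40.
rewrite bent_integralE /tail_bound -RintegralZl//.
apply: ler_normr_RintegralB => //.
- have := subexp_integrable_pairs (subexp_Rintegral_consp sF q40) q40.
  by apply: eq_integrable => // z _ /=; rewrite innerE.
- by have := integrableZl measurableT (4 * eta ^+ 6) it; exact: eq_integrable.
move=> z; rewrite /s !big_cons big_nil /trig/=.
have h1 := shift_sin_approx (eta * xprod z) (eta * yprod z).
have h2 := shift_cos_approx (eta * xprod z) (eta * yprod z).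
have c1 : `|cos (dotpp z / 2)| <= 1 by rewrite ler_norml cos_geN1 cos_le1.
have c2 : `|sin (dotpp z / 2)| <= 1 by rewrite ler_norml sin_geN1 sin_le1.
have hR : 2 * expansion_error (eta * xprod z) (eta * yprod z) <=
   2 * eta ^+ 6 * (xprod z ^+ 6 * yprod z ^+ 0 + xprod z ^+ 0 * yprod z ^+ 6 +
    xprod z ^+ 8 * yprod z ^+ 0 + xprod z ^+ 0 * yprod z ^+ 8).
  rewrite /expansion_error !expr0 !mulr1 !mul1r !exprMn -mulrA ler_wpM2l//.
  have e8 : eta ^+ 8 <= eta ^+ 6 by rewrite ler_wiXn2l.
  have p8 : 0 <= xprod z ^+ 8 by rewrite (exprM _ 4 2) sqr_ge0.
  have r8 : 0 <= yprod z ^+ 8 by rewrite (exprM _ 4 2) sqr_ge0.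
  have := ler_wpM2r p8 e8; have := ler_wpM2r r8 e8; lra.
rewrite /inner.
move: h1 h2; set A := shift_sin _ _; set B := shift_cos _ _.
set a := (X in `|A - X| <= _); set b := (X in `|B - X| <= _) => h1 h2.
rewrite [X in `|X|](_ : _ = ((A - a) * cos (dotpp z / 2) + (B - b) * sin (dotpp z / 2)) * En z).
  rewrite normrM (@ger0_norm _ (En z)) ?expR_ge0// mulrA ler_wpM2r ?expR_ge0//.
  apply: le_trans (ler_normD _ _) _; rewrite !normrM.
  have k1 : `|A - a| * `|cos (dotpp z / 2)| <= `|A - a| by rewrite ler_piMr.
  have k2 : `|B - b| * `|sin (dotpp z / 2)| <= `|B - b| by rewrite ler_piMr.
  lra.
by rewrite /a /b !expr0 !expr1 !mulr1 !mul1r; ring.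
Qed.

End perturbed_half_space.

Section strict_inequality.
Context {R : realType}.

(* The terms in eta ^+ 2 cancel; 40 = - 1 / 2 + 2 * (5 / 12) * 3 ^ 5 - 2 * (1 / 3) * 3 ^ 5. *)
Lemma bent_integral5_lb (eta : R) : 0 <= eta <= 1 ->
  gmass ^+ 5 * (4 * Lf 1 + 40 * eta ^+ 4) - 4 * eta ^+ 6 * tail_bound 5 <= bent_integral 5 eta.
Proof.
move=> /bent_integral_approx => /(_ 5).
rewrite !big_cons big_nil /trig/=.
rewrite (tensor_cosX 5 (plane_sin_even 0 0)) (tensor_cosX 5 (plane_sin_even 2 1))
  (tensor_cosX 5 (plane_sin_even 2 0)) (tensor_cosX 5 (plane_sin_even 0 1))
  (tensor_cosX 5 (plane_sin_even 4 0)) (tensor_cosX 5 (plane_sin_even 0 2))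
  (tensor_sin5 (plane_cos_odd 1 0)) (tensor_sin5 (plane_cos_odd 3 0))
  (tensor_sin5 (plane_cos_odd 1 1)).
rewrite plane_cos00 plane_cos22 plane_cos20 plane_cos40 plane_sin11 plane_sin31.
have -> : plane_moment cos 0 (2 * 1) = gmass :> R by rewrite plane_cos02.
have -> : plane_moment cos 0 (2 * 2) = 3 * gmass :> R by rewrite plane_cos04.
have -> : plane_moment sin 1 (2 * 1).+1 = 3 * gmass :> R by rewrite plane_sin13.
rewrite ler_norml => /andP[h _].
lra.
Qed.

Lemma gmass_gt0 : 0 < gmass :> R.
Proof. by rewrite /gmass !mulr_gt0 ?pi_gt0// sqrtr_gt0. Qed.

Lemma exists_bent_integral_gt : exists eta : R, gmass ^+ 5 * (4 * Lf 1) < bent_integral 5 eta.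
Proof.
have M0 : 0 < gmass ^+ 5 :> R by rewrite exprn_gt0// gmass_gt0.
set M := gmass ^+ 5 in M0 *; set K : R := `|tail_bound 5|.
have K1 : 0 < K + 1 by rewrite ltr_wpDl // /K normr_ge0.
exists (Num.min 1 (M / (K + 1))); set eta := Num.min _ _.
have eta0 : 0 < eta by rewrite lt_min ltr01 divr_gt0.
have eta1 : eta <= 1 by rewrite ge_min lexx.
have etaM : eta * (K + 1) <= M by rewrite -ler_pdivlMr// ge_min lexx orbT.
have := @bent_integral5_lb eta; rewrite ltW//= -/M => /(_ eta1).
apply: lt_le_trans.
have e4 : 0 < eta ^+ 4 by rewrite exprn_gt0.
have h1 : tail_bound 5 * eta ^+ 2 <= M.
  apply: le_trans etaM; apply: le_trans (_ : K * eta ^+ 2 <= _).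
    by rewrite ler_wpM2r ?sqr_ge0// ler_norm.
  have e2 : eta ^+ 2 <= eta by rewrite expr2 ler_piMl// ltW.
  have := ler_wpM2l (normr_ge0 (tail_bound 5 : R)) e2; rewrite -/K; lra.
have h2 : 0 <= eta ^+ 4 * (M - tail_bound 5 * eta ^+ 2).
  by rewrite mulr_ge0 ?subr_ge0// ltW.
have h3 : 0 < eta ^+ 4 * M by rewrite mulr_gt0.
have -> : 4 * eta ^+ 6 * tail_bound 5 = 4 * (eta ^+ 4 * (tail_bound 5 * eta ^+ 2)) by ring.
lra.
Qed.

Lemma krivine_constantE : 2 / pi * ln (1 + Num.sqrt 2) = gmass ^- 6 * (gmass ^+ 5 * (4 * Lf 1)) :> R.
Proof.
have g0 : gmass != 0 :> R by rewrite gt_eqF// gmass_gt0.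
have s0 : Num.sqrt 2 != 0 :> R by rewrite gt_eqF// sqrtr_gt0.
have p0 : pi != 0 :> R by rewrite gt_eqF// pi_gt0.
have -> : ln (1 + Num.sqrt 2) = 2^-1 * (Num.sqrt 2 * Lf 1) :> R by rewrite Lf1E mulKf.
have -> : gmass ^- 6 * (gmass ^+ 5 * (4 * Lf 1)) = 4 * Lf 1 / gmass :> R.
  by rewrite exprS invfM; field.
have s2 : Num.sqrt 2 ^+ 2 = 2 :> R by rewrite sqr_sqrtr.
apply: (mulIf g0); rewrite divfK// /gmass.
have key (p r L : R) : p != 0 -> r ^+ 2 = 2 ->
    2 / p * (2^-1 * (r * L)) * (2 * p * r) = 4 * L.
  move=> pN0 r2; transitivity (2 * L * r ^+ 2); first by field.
  by rewrite r2; ring.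
exact: key.
Qed.

End strict_inequality.

Local Open Scope complex_scope.

Theorem theorem1 (R : realType) :
  exists (n : nat) (F G : n.-tuple R -> R),
    [/\ (1 <= n)%N,
        odd_function F, odd_function G,
        measurable_fun [set: n.-tuple R] F &
        measurable_fun [set: n.-tuple R] G] /\
    [/\ analytic_extension F G (Phi F G),
        Phi F G 'i%C / 'i%C =
          ((2 * pi * Num.sqrt 2) ^- n *
           \int[(lebesgue_tuple n \x lebesgue_tuple n)%E]_z
             (Num.sg (F z.1) * Num.sg (G z.2) *
              expR (- ((enorm z.1 ^+ 2 + enorm z.2 ^+ 2) / 4)) *
              sin (dotp z.1 z.2 / 2)))%:C &
        (2 / pi * ln (1 + Num.sqrt 2))%:C < Phi F G 'i%C / 'i%C].
Proof.
have [eta etaI] := @exists_bent_integral_gt R.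
have mF := @measurable_bent_form R eta 5.
have oF : odd_function (@bent_form R eta 5) by exact: bent_form_odd.
exists 6%N, (@bent_form R eta 5), (@bent_form R eta 5); split; first by split.
have PhiE := Phi_i_E mF mF oF.
split; [exact: analytic_extension_Phi|exact: PhiE|].
rewrite PhiE ltcR krivine_constantE ltr_pM2l ?invr_gt0 ?exprn_gt0 ?gmass_gt0//.
apply: (lt_le_trans etaI); rewrite le_eqVlt; apply/orP; left; apply/eqP.
apply: eq_Rintegral => z _; rewrite /sgFG !enorm2 mulrAC /dotpp /sqnorm_pair.
by rewrite [_ / 4]mulrC.
Qed.
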